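(* Let $F(x,y)$ be a Finsler metric on $\mathbb{R}^3$ satisfying $$0<m_F:=\inf_{\mathbb{R}^3\times\mathbb{S}^2}F(\cdot,\cdot)\le\sup_{\mathbb{R}^3\times\mathbb{S}^2}F(\cdot,\cdot)=:M_F<\infty,$$ and let $\Gamma\subset\mathbb{R}^3$ be a rectifiable Jordan curve. Then any minimizer $X\in\mathcal{C}(\Gamma)$ of the Finsler area $\mathrm{area}^F_B$ in $\mathcal{C}(\Gamma)$ satisfies the isoperimetric inequality $$\mathrm{area}^F_B(X)\le\frac{M_F^2}{4\pi m_F^2}\Big(\mathscr{L}^F(\Gamma)\Big)^2,$$ where $\mathscr{L}^F(\Gamma):=\int F(\Gamma,\dot\Gamma)$ denotes the Finslerian length of $\Gamma$.
   Context: A Finsler metric on $\mathbb{R}^{n}$ is a non-negative function $F=F(x,y)$, smooth on $\mathbb{R}^{n}\times(\mathbb{R}^{n}\setminus\{0\})$ (extended by $F(x,0)=0$), such that (F1) $F(x,ty)=tF(x,y)$ for all $t>0$; and (F2) the matrix $(F^2/2)_{y^iy^j}(x,y)$ is positive definite for all $x$ and all $y\neq0$. In $\mathscr{L}^F(\Gamma)$ the curve $\Gamma$ is represented by a closed Lipschitz (e.g. arclength) parametrization, also denoted $\Gamma$, traversing it once. $B=\{u=(u^1,u^2)\in\mathbb{R}^2:|u|<1\}$. For a closed Jordan curve $\Gamma\subset\mathbb{R}^3$, $\mathcal{C}(\Gamma)$ is the class of all $X\in W^{1,2}(B,\mathbb{R}^3)$ whose trace $X|_{\partial B}$ is a continuous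 and weakly monotonic parametrization of $\Gamma$ (i.e. as the parameter runs once around $\partial B$, the image runs once around $\Gamma$ in one direction, being allowed to be constant on arcs). For $X\in W^{1,2}(B,\mathbb{R}^3)$ the Finsler area is $$\mathrm{area}^F_B(X):=\int_B\mathcal{A}^F(X(u),(X_{u^1}\wedge X_{u^2})(u))\,du,$$ where $\wedge$ is the cross product in $\mathbb{R}^3$, and $$\mathcal{A}^F(x,Z):=\frac{\pi|Z|}{\mathscr{H}^2(\{T\in\mathbb{R}^3:T\cdot Z=0,\ F(x,T)\le1\})}\ (Z\ne0),\qquad\mathcal{A}^F(x,0):=0.$$ *)

(* Defs.v *)
From HB Require Import structures.
From mathcomp Require Import all_boot all_order all_algebra.
From mathcomp Require Import all_classical all_reals all_analysis measurable_realfun.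
Set Implicit Arguments.
Unset Strict Implicit.
Unset Printing Implicit Defensive.
Import Order.TTheory GRing.Theory Num.Theory.
Import numFieldNormedType.Exports.

Local Open Scope classical_set_scope.
Local Open Scope ring_scope.

Definition dotp (R : realType) (n : nat) (x y : 'rV[R]_n) : R :=
  \sum_(i < n) x 0 i * y 0 i.

(* The library norm on 'rV is the sup norm, hence a separate Euclidean norm;
   the two induce the same topology. *)
Definition enorm (R : realType) (n : nat) (x : 'rV[R]_n) : R :=
  Num.sqrt (dotp x x).

Definition cross (R : realType) (x y : 'rV[R]_3) : 'rV[R]_3 :=
  \row_(k < 3)
    (x 0 (k + 1) * y 0 (k + 2) - x 0 (k + 2) * y 0 (k + 1)).

(* U is meant to be open: outside of U the values of f are irrelevant. *)
Fixpoint Ck_on (R : realType) (V W : normedModType R) (U : set V) (k : nat)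
    (f : V -> W) : Prop :=
  (forall x, U x -> {for x, continuous f}) /\
  (if k is k'.+1 then
     forall v : V, (forall x, U x -> derivable f x v) /\ Ck_on U k' ('D_v f)
   else True).

Definition smooth_on (R : realType) (V W : normedModType R) (U : set V)
    (f : V -> W) : Prop := forall k, Ck_on U k f.

Definition hessian (R : realType) (n : nat) (f : 'rV[R]_n -> R)
    (y : 'rV[R]_n) : 'M[R]_n :=
  \matrix_(i < n, j < n)
    'D_(delta_mx 0 i) ('D_(delta_mx 0 j) f) y.

Definition positive_definite (R : realType) (n : nat) (A : 'M[R]_n) : Prop :=
  forall v : 'rV[R]_n, v != 0 -> 0 < (v *m A *m v^T) 0 0.

Record finsler_metric (R : realType) (n : nat)
    (F : 'rV[R]_n -> 'rV[R]_n -> R) : Prop := FinslerMetric {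
  finsler_ge0 : forall x y, 0 <= F x y ;
  finsler_at0 : forall x, F x 0 = 0 ;
  finsler_smooth :
    smooth_on [set p : 'rV[R]_n * 'rV[R]_n | p.2 != 0]
      (fun p : 'rV[R]_n * 'rV[R]_n => F p.1 p.2) ;
  finsler_homogeneous : forall x y t, 0 < t -> F x (t *: y) = t * F x y ;
  finsler_elliptic : forall x y, y != 0 ->
    positive_definite (hessian (fun z => F x z ^+ 2 / 2) y) }.

Definition finsler_values (R : realType) (n : nat)
    (F : 'rV[R]_n -> 'rV[R]_n -> R) : set (\bar R) :=
  [set r | exists x y, enorm y = 1 /\ r = (F x y)%:E].

Definition finsler_inf (R : realType) (n : nat)
    (F : 'rV[R]_n -> 'rV[R]_n -> R) : \bar R := ereal_inf (finsler_values F).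

Definition finsler_sup (R : realType) (n : nat)
    (F : 'rV[R]_n -> 'rV[R]_n -> R) : \bar R := ereal_sup (finsler_values F).

(* The added value 0 makes the diameter of the empty set 0 instead of -oo. *)
Definition diameter (R : realType) (n : nat) (A : set 'rV[R]_n) : \bar R :=
  ereal_sup ([set r | exists x y, [/\ A x, A y & r = (enorm (x - y))%:E]]
             `|` [set 0%E]).

(* The factor pi (diam / 2)^2 is the normalisation for which H^2 agrees with
   Lebesgue measure on planes. *)
Definition hausdorff2_pre (R : realType) (n : nat) (delta : R)
    (A : set 'rV[R]_n) : \bar R :=
  ereal_inf [set (\sum_(0 <= k <oo)
                    pi%:E * (diameter (C k) * (2^-1)%:E) ^+ 2)%E
            | C in [set C : nat -> set 'rV[R]_n |
                A `<=` \bigcup_k C k /\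
                forall k, (diameter (C k) <= delta%:E)%E]].

Definition hausdorff2 (R : realType) (n : nat) (A : set 'rV[R]_n) : \bar R :=
  ereal_sup [set hausdorff2_pre delta A | delta in [set d : R | 0 < d]].

Definition finsler_section (R : realType) (F : 'rV[R]_3 -> 'rV[R]_3 -> R)
    (x Z : 'rV[R]_3) : set 'rV[R]_3 :=
  [set T | dotp T Z = 0 /\ F x T <= 1].

Definition finsler_area_density (R : realType)
    (F : 'rV[R]_3 -> 'rV[R]_3 -> R) (x Z : 'rV[R]_3) : \bar R :=
  if Z == 0 then 0%E
  else ((pi * enorm Z)%:E *
        (hausdorff2 (finsler_section F x Z))^-1)%E.

Definition disc (R : realType) : set (R * R) :=
  [set u | u.1 ^+ 2 + u.2 ^+ 2 < 1].
Arguments disc : clear implicits.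

Definition leb2 (R : realType) :
    {measure set (measurableTypeR R * measurableTypeR R) -> \bar R} :=
  (@lebesgue_measure R \x @lebesgue_measure R)%E.

Definition test_function (R : realType) (phi : R * R -> R) : Prop :=
  [/\ smooth_on setT phi,
      compact (closure [set u | phi u != 0]) &
      closure [set u | phi u != 0] `<=` disc R].

Definition L2_disc (R : realType) (f : R * R -> R) : Prop :=
  measurable_fun (disc R : set (measurableTypeR R * measurableTypeR R)) f /\
  (\int[leb2 R]_(u in disc R) ((f u) ^+ 2)%:E < +oo)%E.

Definition weak_derivative (R : realType) (e : R * R) (f g : R * R -> R)
    : Prop :=
  forall phi, test_function phi ->
    \int[leb2 R]_(u in disc R) (f u * 'D_e phi u) =
    - \int[leb2 R]_(u in disc R) (g u * phi u).

(* An element of W^{1,2}(B, R^3), represented by a function together with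
   versions of its two weak partial derivatives; these are determined by
   the function up to null sets. *)
Record W12 (R : realType) := MkW12 {
  W12_fun :> R * R -> 'rV[R]_3 ;
  W12_d1 : R * R -> 'rV[R]_3 ;
  W12_d2 : R * R -> 'rV[R]_3 ;
  W12_fun_L2 : forall i, L2_disc (fun u => W12_fun u 0 i) ;
  W12_d1_L2 : forall i, L2_disc (fun u => W12_d1 u 0 i) ;
  W12_d2_L2 : forall i, L2_disc (fun u => W12_d2 u 0 i) ;
  W12_d1_weak : forall i,
    weak_derivative (1, 0) (fun u => W12_fun u 0 i) (fun u => W12_d1 u 0 i) ;
  W12_d2_weak : forall i,
    weak_derivative (0, 1) (fun u => W12_fun u 0 i) (fun u => W12_d2 u 0 i) }.

Definition W12_dist2 (R : realType) (X : W12 R) (phi : R * R -> 'rV[R]_3)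
    : \bar R :=
  (\int[leb2 R]_(u in disc R)
     (enorm (X u - phi u) ^+ 2
      + enorm (W12_d1 X u - 'D_((1, 0) : R * R) phi u) ^+ 2
      + enorm (W12_d2 X u - 'D_((0, 1) : R * R) phi u) ^+ 2)%:E)%E.

(* g is the trace of X on the unit circle, in terms of the angle: it is the
   L^2 limit of the boundary values of smooth maps (up to the boundary)
   which converge to X in W^{1,2}(B, R^3). *)
Definition is_trace (R : realType) (X : W12 R) (g : R -> 'rV[R]_3) : Prop :=
  exists phi : nat -> R * R -> 'rV[R]_3,
    [/\ forall k, smooth_on setT (phi k),
        W12_dist2 X (phi k) @[k --> \oo] --> 0%E &
        (\int[@lebesgue_measure R]_(t in `[0%R, (2 * pi)%R])
           (enorm (phi k (cos t, sin t) - g t) ^+ 2)%:E)%E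
          @[k --> \oo] --> 0%E].

(* Closed curves are periodic maps on the real line; this says that c
   traverses Gamma exactly once over a period T. *)
Definition jordan_parametrization (R : realType) (T : R)
    (Gamma : set 'rV[R]_3) (c : R -> 'rV[R]_3) : Prop :=
  [/\ 0 < T, continuous c, (forall t, c (t + T) = c t),
      {in `[0, T[ &, injective c} & range c = Gamma].

Definition curve_length (R : realType) (a b : R) (c : R -> 'rV[R]_3)
    : \bar R :=
  ereal_sup [set (\sum_(i < size s)
                   enorm (c (nth b (a :: s) i.+1) - c (nth b (a :: s) i)))%:E
            | s in [set s | itv_partition a b s]].

Definition rectifiable_jordan_curve (R : realType) (Gamma : set 'rV[R]_3)
    : Prop :=
  exists2 c, jordan_parametrization (2 * pi) Gamma c &
    (curve_length 0 (2 * pi) c < +oo)%E.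

(* Both directions are covered, since c may be reversed. *)
Definition weakly_monotonic_parametrization (R : realType)
    (Gamma : set 'rV[R]_3) (g : R -> 'rV[R]_3) : Prop :=
  exists c tau, [/\ jordan_parametrization (2 * pi) Gamma c,
    continuous tau, {homo tau : s t / s <= t :> R},
    (forall t, tau (t + 2 * pi) = tau t + 2 * pi) &
    forall t, g t = c (tau t)].

Definition plateau_class (R : realType) (Gamma : set 'rV[R]_3) (X : W12 R)
    : Prop :=
  exists2 g, is_trace X g & weakly_monotonic_parametrization Gamma g.

Definition finsler_area (R : realType) (F : 'rV[R]_3 -> 'rV[R]_3 -> R)
    (X : W12 R) : \bar R :=
  (\int[leb2 R]_(u in disc R)
     finsler_area_density F (X u) (cross (W12_d1 X u) (W12_d2 X u)))%E.

Definition finsler_area_minimizer (R : realType)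
    (F : 'rV[R]_3 -> 'rV[R]_3 -> R) (Gamma : set 'rV[R]_3) (X : W12 R)
    : Prop :=
  plateau_class Gamma X /\
  forall Y, plateau_class Gamma Y -> (finsler_area F X <= finsler_area F Y)%E.

(* The derivative of a Lipschitz map exists almost everywhere. *)
Definition finsler_length (R : realType) (F : 'rV[R]_3 -> 'rV[R]_3 -> R)
    (T : R) (c : R -> 'rV[R]_3) : \bar R :=
  (\int[@lebesgue_measure R]_(t in `[0%R, T]) (F (c t) (derive1 c t))%:E)%E.

(* Main.v *)
(* The minimizer is compared with a cone.  Let [l] be the Euclidean length of [Gamma] and let [g]
   run through [Gamma] with constant speed [K = l / (2 pi)] over the unit circle.  The cone
   [Y (r, t) = p + r (g t - p)] satisfies [|Y_1 x Y_2| <= (|g - p|^2 + K^2) / 2] at the angle [t],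
   so for a suitable vertex [p] Wirtinger's inequality bounds its area by [pi K^2 = l^2 / (4 pi)].
   The Finsler area of [Y] is at most [M_F^2] times the Euclidean area: every section of
   [F (x, .) <= 1] contains a disc of radius [1 / M_F], whose Hausdorff measure is at least
   [pi / M_F^2] by the planar isodiametric inequality.  On the other hand the Finsler length of
   [Gamma] is at least [m_F l].  As [Gamma] may have zero velocity on a set of positive measure,
   [l] is first enlarged by [e T], and [e] tends to [0] at the end.

   The cone is only Lipschitz; its weak derivatives and its trace are obtained from Bernstein
   polynomials, whose gradients are bounded and converge wherever the map is differentiable. *)

Require Import Defs.
From HB Require Import structures.
From mathcomp Require Import all_boot all_order all_algebra.
From mathcomp Require Import all_classical all_reals all_analysis measurable_realfun.
From mathcomp Require Import ring lra.
Set Implicit Arguments.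
Unset Strict Implicit.
Unset Printing Implicit Defensive.
Import Order.TTheory GRing.Theory Num.Theory.
Import numFieldNormedType.Exports.
Local Open Scope classical_set_scope.
Local Open Scope ring_scope.

(** * Measurability, Lipschitz functions *)

(** For Euclidean [F] and a round circle the inequality is an equality, so Wirtinger's inequality,
    the bound of the area element and the factor 1/2 coming from the radius all have to be sharp.
    Constants such as 4, 12 or 16 only serve Lipschitz bounds and integrability and are generous.
    Wirtinger's inequality acts on one coordinate at a time, so the vertex is chosen coordinate by
    coordinate. The gradient of a cone depends on the angle alone. The change to polar coordinates
    therefore reduces to an upper bound for the area of angular sectors, which extends from
    intervals to all measurable sets of angles and also transports null sets. The area density and
    [F (c t) (derive1 c t)] are never shown to be measurable. Both integrals are compared with
    measurable functions through the description of the integral of a nonnegative function as a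
    supremum over simple minorants. The reparametrized curve must have Lipschitz constant exactly
    [l / (2 pi)] and also be injective on a period, since the cone has to belong to
    [plateau_class Gamma]. *)

Lemma measure_le_lebesgue (R : realType)
    (nu : {measure set (measurableTypeR R) -> \bar R}) (C : R) : 0 < C ->
  (forall a b, a < b -> (nu `]a, b]%classic <= (C * (b - a))%:E)%E) ->
  forall A, measurable A -> (nu A <= C%:E * lebesgue_measure A)%E.
Proof.
move=> C0 nuab A mA.
(* Lebesgue measure is an infimum over countable covers by half-open intervals, so [nu A] only has
   to be bounded by the sum over one such cover. *)
rewrite muleC -lee_pdivrMr//; apply: le_ereal_inf_tmp => _ /= [B [mB AB] <-].
have mB' k : measurable (B k : set (measurableTypeR R)).
  by apply: sub_sigma_algebra; exact: mB.
rewrite lee_pdivrMr// muleC -nneseriesZl//.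
apply: (le_trans (measure_sigma_subadditive nu mB' mA AB)).
apply: lee_nneseries => // k _.
have [->|[[a b] /= ab ->]] := (ocitvP (B k)).1 (mB k).
  by rewrite measure0 wlength0 mule0.
rewrite wlength_itv_bnd ?(ltW ab)//; exact: nuab.
Qed.

(** The plane has a countable base: an open set is the union of the squares with rational centre and
    radius that it contains, and each square is a product of intervals. *)
Lemma open_measurable2 (R : realType)
    (U : set (measurableTypeR R * measurableTypeR R)) :
  open (U : set (R * R)) -> measurable U.
Proof.
move=> oU.
pose bx (q : rat * rat * rat) : set (R * R) :=
  [set u | `|u.1 - ratr q.1.1| < ratr q.2 /\ `|u.2 - ratr q.1.2| < ratr q.2].
have mbx q : measurable (bx q : set (measurableTypeR R * measurableTypeR R)).
  rewrite (_ : bx q = `]ratr q.1.1 - ratr q.2, ratr q.1.1 + ratr q.2[%classic `*`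
     `]ratr q.1.2 - ratr q.2, ratr q.1.2 + ratr q.2[%classic); last first.
    apply/seteqP; split => -[u v]; rewrite /bx /= !in_itv /= !ltr_distl.
      by case=> -> ->.
    by case=> -> ->.
  by apply: measurableX; exact: measurable_itv.
rewrite (_ : U = \bigcup_(q in [set q | bx q `<=` U]) bx q); last first.
  apply/seteqP; split => [u Uu|u [q] /= qU qu]; last exact: qU.
  have /nbhs_ballP[e /= e0 eU] : nbhs u U by exact: open_nbhs_nbhs.
  have /rat_in_itvoo[r] : (0 < e / 2)%R by rewrite divr_gt0.
  rewrite in_itv /= => /andP[r0 re].
  have ratin (x : R) : exists q : rat, `|x - ratr q| < ratr r.
    have /rat_in_itvoo[q] : x - ratr r < x + ratr r by rewrite ltrD2l; lra.
    by rewrite in_itv /= => /andP[? ?]; exists q; rewrite distrC ltr_distl; apply/andP; split.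
  have [q1 q1u] := ratin u.1; have [q2 q2u] := ratin u.2.
  exists (q1, q2, r) => //= v [v1 v2]; apply: eU.
  split; rewrite /ball /=.
    rewrite (_ : u.1 - v.1 = (u.1 - ratr q1) + - (v.1 - ratr q1)); last by ring.
    by rewrite (le_lt_trans (ler_normD _ _))// normrN; lra.
  rewrite (_ : u.2 - v.2 = (u.2 - ratr q2) + - (v.2 - ratr q2)); last by ring.
  by rewrite (le_lt_trans (ler_normD _ _))// normrN; lra.
by rewrite bigcup_mkcond; apply: countable_bigcupT_measurable => // q; case: ifP.
Qed.

Lemma closed_measurable2 (R : realType)
    (U : set (measurableTypeR R * measurableTypeR R)) :
  closed (U : set (R * R)) -> measurable U.
Proof.
move=> cU; rewrite -(setCK U); apply: measurableC.
by apply: open_measurable2; exact: closed_openC.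
Qed.

Lemma continuous_measurable2 (R : realType) (f : R * R -> R) :
  continuous f ->
  measurable_fun (setT : set (measurableTypeR R * measurableTypeR R)) f.
Proof.
move=> cf; apply: (measurability _ (RGenOpens.measurableE R)) => //.
move=> _ [_ [a [b ->] <-]]; rewrite setTI; apply: open_measurable2.
by move/continuousP : cf; apply; exact: interval_open.
Qed.

Lemma bounded_integrable d (T : measurableType d) (R : realType)
    (mu : {measure set T -> \bar R}) (D : set T) (f : T -> R) (M : R) :
  measurable D -> (mu D < +oo)%E -> measurable_fun D f ->
  (forall x, D x -> `|f x| <= M) -> mu.-integrable D (EFin \o f).
Proof.
move=> mD Dfin mf fM; apply: measurable_bounded_integrable => //.
exists M; split; first exact: num_real.
by move=> x Mx y Dy; apply: (le_trans (fM y Dy)); exact: ltW.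
Qed.

Lemma lipschitz_continuous (R : realType) (V : normedModType R) (f : V -> R) (L : R) :
  (forall x y, `|f x - f y| <= L * `|x - y|) -> continuous f.
Proof.
move=> fL x; apply/cvgrPdist_le => /= e e0.
have L1 : 0 < `|L| + 1 by rewrite ltr_wpDl.
near=> y; rewrite (le_trans (fL _ _))//.
rewrite (@le_trans _ _ ((`|L| + 1) * `|x - y|))//.
  by rewrite ler_wpM2r// (le_trans (ler_norm L))// lerDl.
rewrite mulrC -ler_pdivlMr//; near: y.
by apply: cvgr_dist_le; [exact: cvg_id|rewrite divr_gt0].
Unshelve. all: by end_near. Qed.

Lemma lipschitz_derive_le (R : realType) (f : R -> R) (L t d : R) :
  (forall x y, `|f x - f y| <= L * `|x - y|) -> is_derive t 1 f d -> `|d| <= L.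
Proof.
move=> fL [df <-].
have dfn : `|h^-1 *: (f (h *: 1 + t) - f t)| @[h --> 0^'] --> `|'D_1 f t|.
  by apply: cvg_norm; exact: df.
rewrite -(cvg_lim _ dfn)//; apply: limr_le; first by apply/cvg_ex; eexists; exact: dfn.
near=> h => /=; rewrite normrZ normfV.
have h0 : 0 < `|h| by rewrite normr_gt0; near: h; exact: nbhs_dnbhs_neq.
rewrite mulrC ler_pdivrMr// (le_trans (fL _ _))//.
by rewrite addrK [h *: 1]mulr1.
Unshelve. all: by end_near. Qed.

Lemma ae_null (R : realType) d (T : measurableType d) (mu : {measure set T -> \bar R})
    (P : T -> Prop) : {ae mu, forall x, P x} ->
  exists N, [/\ measurable N, mu N = 0%E & forall x, ~ N x -> P x].
Proof.
by case=> N [mN N0 PN]; exists N; split => // x Nx; apply: contrapT => /PN.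
Qed.

Lemma dominated_integral_cvg d (T : measurableType d) (R : realType)
    (mu : {measure set T -> \bar R}) (D : set T) (f_ : nat -> T -> R) (f : T -> R)
    (M : R) :
  measurable D -> (mu D < +oo)%E -> (forall n, measurable_fun D (f_ n)) ->
  measurable_fun D f ->
  {ae mu, forall x, D x -> f_ n x @[n --> \oo] --> f x} ->
  (forall n x, D x -> `|f_ n x| <= M) ->
  mu.-integrable D (EFin \o f) /\
  (\int[mu]_(x in D) (f_ n x)%:E)%E @[n --> \oo] --> (\int[mu]_(x in D) (f x)%:E)%E.
Proof.
move=> mD Dfin mf_ mf ff fM.
have mfE n : measurable_fun D (fun x => (f_ n x)%:E) by exact/measurable_EFinP.
have [] := @dominated_convergence _ _ _ mu D mD (fun n x => (f_ n x)%:E)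
  (fun x => (f x)%:E) (cst M%:E) mfE.
- exact/measurable_EFinP.
- apply: filterS ff => x h Dx; apply: cvg_EFin; last exact: h.
  by apply: nearW => n.
- by apply: (bounded_integrable (f := cst M) (M := `|M|)) => //; exact: measurable_cst.
- by apply: aeW => x n Dx; rewrite lee_fin; exact: fM.
by move=> intf _ cvgI; split => //; exact: cvgI.
Qed.

Lemma dominated_Rintegral_cvg d (T : measurableType d) (R : realType)
    (mu : {measure set T -> \bar R}) (D : set T) (f_ : nat -> T -> R) (f : T -> R)
    (M : R) :
  measurable D -> (mu D < +oo)%E -> (forall n, measurable_fun D (f_ n)) ->
  measurable_fun D f ->
  {ae mu, forall x, D x -> f_ n x @[n --> \oo] --> f x} ->
  (forall n x, D x -> `|f_ n x| <= M) ->
  \int[mu]_(x in D) f_ n x @[n --> \oo] --> \int[mu]_(x in D) f x.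
Proof.
move=> mD Dfin mf_ mf ff fM.
have [intf cvgI] := dominated_integral_cvg mD Dfin mf_ mf ff fM.
by apply: fine_cvg; rewrite fineK; [exact: cvgI|exact: integrable_fin_num].
Qed.

Lemma derive_lipschitz (R : realType) (f df : R -> R) (K : R) :
  (forall x : R, is_derive x 1 f (df x)) -> (forall x, `|df x| <= K) ->
  forall x y, `|f x - f y| <= K * `|x - y|.
Proof.
move=> fdf dfK.
have cf : continuous f.
  by move=> x; apply/differentiable_continuous/derivable1_diffP; case: (fdf x).
have main x y : x <= y -> `|f y - f x| <= K * `|y - x|.
  move=> xy; have [|c _ ->] := MVT_segment xy (fun x _ => fdf x).
    exact: continuous_subspaceT.
  by rewrite normrM ler_wpM2r.
move=> x y; have [xy|/ltW yx] := leP x y; last exact: main.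
by rewrite distrC (distrC x); exact: main.
Qed.

Lemma sin_lipschitz (R : realType) (x y : R) : `|sin x - sin y| <= `|x - y|.
Proof.
rewrite -[leRHS]mul1r; apply: (derive_lipschitz (df := cos)) => // z; exact: cos_max.
Qed.

Lemma cos_lipschitz (R : realType) (x y : R) : `|cos x - cos y| <= `|x - y|.
Proof.
rewrite -[leRHS]mul1r; apply: (derive_lipschitz (df := fun x => - sin x)) => // z.
by rewrite normrN; exact: sin_max.
Qed.

Lemma sin_int (R : realType) (x : R) (k : int) : `|sin (x + k%:~R * pi)| = `|sin x|.
Proof.
have sd z : `|sin (z + pi)| = `|sin z :> R| by rewrite sinDpi normrN.
elim/int_ind: k => [|n IH|n IH]; first by rewrite mul0r addr0.
  by rewrite intS rmorphD /= mulrDl mul1r addrCA addrC sd.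
rewrite -IH -[in LHS]sd; congr (`|sin _|).
by rewrite -addn1 PoszD opprD rmorphD rmorphN1 /=; ring.
Qed.

Lemma sin_dist (R : realType) (x : R) :
  exists k : int, `|x - k%:~R * pi| <= 4 * `|sin x|.
Proof.
have pi0 := pi_gt0 R; have pi4 := pihalf_lt2 R.
(* [k] is the integer nearest to [x / pi], so the remainder [d] lies in [[- pi / 2, pi / 2]]. *)
pose k := Num.floor (x / pi + 1 / 2).
have /andP[k1 k2] := floor_itv (x / pi + 1 / 2); rewrite -/k in k1 k2.
exists k; rewrite -(sin_int x (- k)) rmorphN mulNr; set d := x - _.
have dpi : `|d| <= pi / 2.
  have xE : x = x / pi * pi by rewrite divfK// gt_eqF.
  rewrite rmorphD /= in k2.
  by rewrite /d ler_norml [in X in _ <= X - _]xE [in X in X - _ <= _]xE; nra.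
clearbody d; wlog d0 : d dpi / 0 <= d.
  move=> h; have [/h|d0] := leP 0 d; first exact.
  by rewrite -(normrN d) -(normrN (sin d)) -sinN; apply: h; rewrite ?normrN// oppr_ge0 ltW.
rewrite ger0_norm// in dpi *.
have sd0 : 0 <= sin d by apply: sin_ge0_pi; rewrite d0 /=; lra.
rewrite ger0_norm//.
(* Either [sin d >= sqrt 3 / 2], and [d <= pi / 2 < 2] suffices, or the cosine exceeds 1/2 on
   [[0, d]] and the mean value theorem gives [sin d >= d / 2]. *)
have [cd|cd] := leP (cos d) (1 / 2).
  have := cos2Dsin2 d; have : 0 <= cos d by apply: cos_ge0_pihalf; rewrite dpi andbT; lra.
  by nra.
have [c /[!in_itv]/= /andP[c0 cd']] := @MVT_segment R sin cos 0 d d0 (fun x _ => is_derive_sin x)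
  (continuous_subspaceT (@continuous_sin R)).
rewrite sin0 !subr0 => ->.
have : cos d <= cos c.
  move: cd'; rewrite le_eqVlt => /predU1P[->//|cd'].
  by rewrite ltW// ltr_cos// in_itv /=; lra.
by nra.
Qed.

Lemma continuous_pairl (R : realType) (y : R) : continuous (fun x : R => (x, y)).
Proof.
move=> x; apply: (cvg_pair (F := nbhs x) (G := nbhs x) (H := nbhs y)); first exact: cvg_id.
exact: cvg_cst.
Qed.

Lemma continuous_pairr (R : realType) (x : R) : continuous (fun y : R => (x, y)).
Proof.
move=> y; apply: (cvg_pair (F := nbhs y) (G := nbhs x) (H := nbhs y)); last exact: cvg_id.
exact: cvg_cst.
Qed.

(* [phi x = f x + L x] is nondecreasing, its Stieltjes measure is at most [2 L + 1] times the
   Lebesgue measure, and its density is the derivative by the fundamental theorem. *)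
Lemma lipschitz_derivative (R : realType) (f : R -> R) (L a b : R) : a < b ->
  (forall x y, `|f x - f y| <= L * `|x - y|) ->
  exists d : R -> R, [/\ measurable_fun [set: R] d, (forall t, `|d t| <= L),
    {ae lebesgue_measure, forall t : R, a < t < b -> is_derive t 1 f (d t)} &
    forall s t, a <= s -> s <= t -> t <= b ->
      \int[lebesgue_measure]_(x in `[s, t]) d x = f t - f s].
Proof.
move=> ab fL.
have L0 : 0 <= L.
  by have := le_trans (normr_ge0 _) (fL 1 0); rewrite subr0 normr1 mulr1.
pose phi x := f x + L * x.
have phind : {homo phi : x y / x <= y}.
  move=> x y xy; rewrite /phi; have := fL y x.
  by rewrite ler_norml (ger0_norm (_ : 0 <= y - x)) ?subr_ge0// => /andP[? _]; lra.
have phic : right_continuous phi.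
  move=> x; apply: cvg_at_right_filter; apply: cvgD.
    exact: lipschitz_continuous fL x.
  by apply: cvgMr; exact: cvg_id.
pose phi1 := isCumulative.Build _ _ _ phi phind phic.
pose phi' : cumulative R R := HB.pack phi phi1.
pose nu : {measure set (measurableTypeR R) -> \bar R} :=
  lebesgue_stieltjes_measure phi'.
have nuE s t : s <= t -> nu `]s, t]%classic = (phi t - phi s)%:E.
  move=> st; rewrite /nu /= /lebesgue_stieltjes_measure /measure_extension.
  by rewrite measurable_mu_extE/= ?wlength_itv_bnd//; exact: is_ocitv.
have nule A : measurable A -> (nu A <= (2 * L + 1)%:E * lebesgue_measure A)%E.
  apply: measure_le_lebesgue; first by lra.
  move=> s t st; rewrite nuE ?(ltW st)// lee_fin /phi.
  have := fL t s.
  by rewrite ler_norml (ger0_norm (_ : 0 <= t - s)) ?subr_ge0 ?(ltW st)// => /andP[_ ?]; lra.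
have nufin : (nu `]a, b]%classic < +oo)%E by rewrite nuE ?ltry// ltW.
have mab : measurable (`]a, b]%classic : set (measurableTypeR R)) by exact: measurable_itv.
(* Restriction to []a, b]] makes the measure finite, so that its density is integrable on the whole
   line. *)
pose nu1 : {finite_measure set (measurableTypeR R) -> \bar R} :=
  mfrestr (mab : measurable (`]a, b]%classic : set (measurableTypeR R))) nufin.
have nu1_dom : nu1 `<< @lebesgue_measure R.
  apply/null_content_dominatesP => A mA A0; apply/eqP.
  rewrite eq_le measure_ge0 andbT /nu1 /= /mfrestr /mrestr.
  rewrite (le_trans (nule _ _))//; first exact: measurableI.
  rewrite (_ : lebesgue_measure _ = 0%E) ?mule0//.
  by apply: subset_measure0 A0 => //; exact: measurableI.
have [h [h0 hfin hint hE]] := radon_nikodym_sigma_finite nu1_dom.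
pose h1 x : R := fine (h x).
have hE1 : h = EFin \o h1 by apply/funext => x; rewrite /h1 /= fineK.
have mh1 : measurable_fun [set: R] h1.
  by apply/measurable_EFinP; rewrite -hE1; exact: (measurable_int _ hint).
have h1int : (@lebesgue_measure R).-integrable setT (EFin \o h1) by rewrite -hE1.
have h1intS D : measurable D -> (@lebesgue_measure R).-integrable D (EFin \o h1).
  by move=> mD; exact: integrableS h1int.
have FE s t : a <= s -> s <= t -> t <= b ->
    \int[lebesgue_measure]_(x in `]s, t]) h1 x = phi t - phi s.
  move=> as' st tb; have := hE `]s, t]%classic (measurable_itv _).
  rewrite /nu1 /= /mfrestr /mrestr setIidl; last first.
    by apply: subset_itv; rewrite bnd_simp.
  rewrite nuE// => e; rewrite /Rintegral -[RHS]/(fine (phi t - phi s)%:E) e.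
  by rewrite hE1.
have /ae_null[N [mN N0 Nd]] := FTC1 (a := BRight a) (fun y => h1intS _ (measurable_itv _))
  (open_integrable_locally openT h1int).
have fder t : a < t < b -> ~ N t -> is_derive t 1 f (h1 t - L).
  move=> /andP[at_ tb] /Nd /= /(_ at_) [dF F'].
  set F := (fun x => _) in dF F'.
  apply: (@near_eq_is_derive _ _ _ (fun y => F y + phi a - L * y)).
    near=> y; rewrite /F FE.
    - by rewrite /phi; ring.
    - exact: lexx.
    - by apply/ltW; near: y; exact: lt_nbhsr.
    - by apply/ltW; near: y; exact: lt_nbhsl.
  have dF' : is_derive t 1 F (h1 t).
    by split; [exact: dF|rewrite -derive1E; exact: F'].
  have D1 : is_derive t 1 (F + cst (phi a) - (L *: id)) (h1 t + 0 - L *: 1).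
    by apply: is_deriveB.
  rewrite -[X in is_derive _ _ X _]/(F + cst (phi a) - (L *: id)).
  by apply: is_derive_eq D1 _; rewrite addr0 [L *: 1]mulr1.
(* The truncation makes the bound by [L] hold everywhere. It changes nothing where [f] has
   derivative [h1 x - L], since that derivative is bounded by the Lipschitz constant. *)
pose d x := if `|h1 x - L| <= L then h1 x - L else 0.
have md : measurable_fun [set: R] d.
  apply: measurable_fun_ifT => //=.
    apply: measurable_fun_ler => //.
    by apply: measurableT_comp => //; exact: measurable_funB.
  exact: measurable_funB.
have dL t : `|d t| <= L by rewrite /d; case: ifP => // _; rewrite normr0.
have dder t : a < t < b -> ~ N t -> d t = h1 t - L.
  by move=> tab Nt; rewrite /d (lipschitz_derive_le fL (fder t tab Nt)).
exists d; split => //.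
  exists N; split => // t /=; apply: contra_notP => Nt tab.
  by rewrite dder//; exact: fder.
move=> s t as' st tb.
rewrite /Rintegral integral_itv_bndoo; last first.
  exact/measurable_EFinP/measurable_funTS.
rewrite (@ae_eq_integral _ _ _ _ _ (fun x => (h1 x - L)%:E)) //; last 3 first.
- exact/measurable_EFinP/measurable_funTS.
- apply/measurable_EFinP/measurable_funTS; exact: measurable_funB.
- exists N; split => // x /=; apply: contra_notP => Nx; rewrite in_itv /= => /andP[sx xt].
  by rewrite dder// (le_lt_trans as' sx) (lt_le_trans xt tb).
rewrite -(@integral_itv_bndoo _ s t _ false false); last first.
  apply/measurable_EFinP/measurable_funTS; exact: measurable_funB.
rewrite -/(Rintegral _ _ (fun x => h1 x - L)) RintegralB//; last 2 first.
- exact: h1intS.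
- apply: (bounded_integrable (M := L)) => //; last by move=> x _; rewrite ger0_norm.
  by rewrite /= lebesgue_measure_itv /=; case: ifP; rewrite ?ltry// -EFinB ltry.
rewrite FE// Rintegral_cst//= lebesgue_measure_itv/= lte_fin.
rewrite /phi; case: ltP => [st1|ts].
  by rewrite -EFinB /=; ring.
have -> : t = s by apply/eqP; rewrite eq_le ts st.
by rewrite /=; ring.
Unshelve. all: by end_near. Qed.

(** Two derivatives of [f] agree almost everywhere, so [lipschitz_derivative] yields the fundamental
    theorem for any given [d]. Composing [f] with the clamp [c] onto [[a, b]] makes it Lipschitz on
    the whole line without changing it on [[a, b]]. *)
Lemma lipschitz_integral_derive (R : realType) (f d : R -> R) (L a b : R) : a <= b ->
  (forall x y, a <= x <= b -> a <= y <= b -> `|f x - f y| <= L * `|x - y|) ->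
  measurable_fun [set: R] d ->
  {ae lebesgue_measure, forall t : R, a < t < b -> is_derive t 1 f (d t)} ->
  \int[lebesgue_measure]_(x in `[a, b]) d x = f b - f a.
Proof.
rewrite le_eqVlt => /predU1P[<- *|ab fL md fd].
  by rewrite subrr set_itv1 /Rintegral integral_set1.
pose c x := Num.max a (Num.min b x).
have cab x : a <= c x <= b by rewrite /c le_max lexx /= ge_max (ltW ab) ge_min lexx.
have cL x y : `|c x - c y| <= `|x - y|.
  have := ler_norm (x - y); have := ler_norm (y - x); rewrite (distrC y x) ler_norml /c.
  case: (leP b x) => ?; case: (leP b y) => ?; rewrite ?(max_r (ltW ab));
    try case: (leP a x) => ?; try case: (leP a y) => ?; move=> *; apply/andP; split; lra.
have cE x : a < x < b -> c x = x.
  by move=> /andP[ax xb]; rewrite /c (min_r (ltW xb)) max_r// ltW.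
have L0 : 0 <= L.
  have ab0 : 0 < `|a - b| by rewrite normr_gt0 subr_eq0 lt_eqF.
  rewrite -(pmulr_lge0 _ ab0); apply: le_trans (fL a b _ _) => //.
    by rewrite lexx ltW.
  by rewrite lexx ltW.
have gL x y : `|f (c x) - f (c y)| <= L * `|x - y|.
  by rewrite (le_trans (fL _ _ _ _))// ler_wpM2l.
have [d' [md' d'L d'f /(_ a b (lexx a) (ltW ab) (lexx b))]] := lipschitz_derivative ab gL.
have -> : c a = a by rewrite /c (min_idPr (ltW ab)) maxxx.
have -> : c b = b by rewrite /c minxx; apply/max_idPr/ltW.
move=> <-; rewrite /Rintegral.
rewrite integral_itv_bndoo; last exact/measurable_EFinP/measurable_funTS.
rewrite [in RHS]integral_itv_bndoo; last exact/measurable_EFinP/measurable_funTS.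
congr fine; apply: ae_eq_integral => //.
- exact/measurable_EFinP/measurable_funTS.
- exact/measurable_EFinP/measurable_funTS.
move: fd d'f => /ae_null[N [mN N0 Nd]] /ae_null[N' [mN' N'0 N'd]].
exists (N `|` N'); split; [exact: measurableU|exact: null_set_setU|].
move=> t /=; apply: contra_notP => /not_orP[Nt N't]; rewrite in_itv /= => tab; congr EFin.
have [_ <-] := Nd _ Nt tab; have [_ <-] := N'd _ N't tab.
apply: near_eq_derive; near=> x; rewrite cE//; apply/andP; split; near: x.
  by apply: lt_nbhsr; case/andP: tab.
by apply: lt_nbhsl; case/andP: tab.
Unshelve. all: by end_near. Qed.

(** * Wirtinger's inequality *)

(** With [S] and [C] the shifted sine and cosine, this differentiates the regularized [h^2 cot] of
    Wirtinger's inequality. *)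
Lemma is_derive_sqr_ratio (R : realType) (h S C : R -> R) (e t d : R) :
  is_derive t 1 h d -> is_derive t 1 S (C t) -> is_derive t 1 C (- S t) ->
  S t ^+ 2 + e != 0 ->
  is_derive t 1 (fun x => h x ^+ 2 * (S x * C x / (S x ^+ 2 + e)))
   (2 * h t * d * (S t * C t / (S t ^+ 2 + e)) +
    h t ^+ 2 * (((C t ^+ 2 - S t ^+ 2) * (S t ^+ 2 + e) - 2 * S t ^+ 2 * C t ^+ 2) /
                (S t ^+ 2 + e) ^+ 2)).
Proof.
move=> dh dS dC n0.
have dSe : is_derive t 1 (S ^+ 2 + cst e) (2 * S t * C t).
  by apply: is_derive_eq; rewrite /GRing.scale /=; ring.
have dV := @is_deriveV _ (S ^+ 2 + cst e) t (2 * S t * C t) 1 n0 dSe.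
rewrite (_ : (fun x => h x ^+ 2 * (S x * C x / (S x ^+ 2 + e))) =
  h ^+ 2 * (S * C * (fun x => ((S ^+ 2 + cst e) x)^-1))); last by [].
apply: is_derive_eq.
rewrite /= (_ : (S ^+ 2 + cst e) t = S t ^+ 2 + e)// /GRing.scale /=.
rewrite (_ : (h ^+ 2) t = h t ^+ 2)// (_ : (S * C) t = S t * C t)//
 (_ : (S * C * (fun x => ((S ^+ 2 + cst e) x)^-1)) t = S t * C t / (S t ^+ 2 + e))//.
by field.
Qed.

(** Boundedness is included so that the class is closed under products, and under inverses of
    functions bounded away from 0. This makes the regularized [h^2 cot] Lipschitz, as the
    fundamental theorem requires. *)
Definition lipb (R : realType) (f : R -> R) := exists L, exists M,
  (forall x y, `|f x - f y| <= L * `|x - y|) /\ (forall x, `|f x| <= M).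

Lemma lipbM (R : realType) (f g : R -> R) : lipb f -> lipb g -> lipb (fun x => f x * g x).
Proof.
move=> [L [M [fL fM]]] [L' [M' [gL gM]]]; exists (L * M' + M * L'), (M * M'); split.
  move=> x y; rewrite (_ : _ - _ = (f x - f y) * g x + f y * (g x - g y)); last by ring.
  rewrite (le_trans (ler_normD _ _))// !normrM mulrDl lerD//.
    by rewrite mulrAC ler_pM.
  by rewrite -mulrA ler_pM.
by move=> x; rewrite normrM ler_pM.
Qed.

Lemma lipbV (R : realType) (f : R -> R) (e : R) : 0 < e -> (forall x, e <= f x) ->
  lipb f -> lipb (fun x => (f x)^-1).
Proof.
move=> e0 ef [L [M [fL fM]]]; exists (L / (e * e)), e^-1.
have f0 x : 0 < f x by exact: lt_le_trans (ef x).
split=> [x y|x]; last by rewrite ger0_norm ?invr_ge0 ?(ltW (f0 x))// lef_pV2// posrE.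
rewrite (_ : _ - _ = (f y - f x) / (f x * f y)); last first.
  by field; rewrite !gt_eqF.
rewrite normrM normfV (gtr0_norm (mulr_gt0 _ _))// distrC mulrAC ler_pM//.
  by rewrite invr_ge0 mulr_ge0 ?(ltW (f0 _)).
by rewrite lef_pV2 ?posrE ?mulr_gt0// ler_pM ?(ltW e0).
Qed.

(** The difference [f (x + pi) - f x] takes opposite values at [0] and [pi], so it vanishes in
    between. *)
Lemma antiperiodic_zero (R : realType) (f : R -> R) : continuous f ->
  (forall t, f (t + 2 * pi) = f t) -> exists a, f (a + pi) = f a.
Proof.
move=> cf fp; have [||a _ a0] := @IVT R (fun x => f (x + pi) - f x) 0 pi 0 (pi_ge0 R).
- apply: continuous_subspaceT => x; apply: cvgB; last exact: cf.
  by apply: continuous_comp; [apply: cvgD; [exact: cvg_id|exact: cvg_cst]|exact: cf].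
- rewrite add0r (_ : pi + pi = 0 + 2 * pi); last by ring.
  rewrite fp -[f 0 - f pi]opprB; set z := f pi - f 0.
  by rewrite ge_min le_max; have [z0|z0] := leP 0 z; apply/andP; split; apply/orP; lra.
- by exists a; apply/eqP; rewrite -subr_eq0 a0.
Qed.

(* [p] is the common value of [f] at two opposite points [a], [a + pi]. Formally the inequality
   integrates [(h' - h cot)^2 >= 0] for [h = f - p] and [cot = cot (x - a)], since
   [(h^2 cot)' = 2 h h' cot - h^2 (1 + cot^2)]; here [cot] is replaced by
   [sin cos / (sin^2 + e)] and [e] tends to [0]. *)
Lemma wirtinger (R : realType) (f d : R -> R) (L : R) :
  (forall x y, `|f x - f y| <= L * `|x - y|) -> (forall t, f (t + 2 * pi) = f t) ->
  measurable_fun [set: R] d -> (forall t, `|d t| <= L) ->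
  {ae lebesgue_measure, forall t : R, 0 < t < 2 * pi -> is_derive t 1 f (d t)} ->
  exists p, (forall t, `|f t - p| <= 4 * L) /\
   \int[lebesgue_measure]_(x in `[0, 2 * pi]) (f x - p) ^+ 2 <=
   \int[lebesgue_measure]_(x in `[0, 2 * pi]) d x ^+ 2.
Proof.
move=> fL fp md dL fd; have pi0 := pi_gt0 R.
have L0 : 0 <= L by exact: le_trans (dL 0).
have cf : continuous f by exact: lipschitz_continuous fL.
have [a fa] := antiperiodic_zero cf fp.
pose h x := f x - f a.
have hk (k : int) : h (a + k%:~R * pi) = 0.
  suff: h (a + k%:~R * pi) = 0 /\ h (a + (k + 1)%:~R * pi) = 0 by case.
  rewrite /h; elim/int_ind: k => [|n [IH1 IH2]|n [IH1 IH2]].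
  - by split; rewrite ?add0r ?mul1r ?mul0r ?addr0 ?fa subrr.
  - rewrite !rmorphD/= !mulrDl !mul1r intS in IH2 *; split.
      by rewrite -IH2; congr (f _ - _); rewrite rmorphD/=; ring.
    rewrite -IH1 -[in RHS]fp; congr (f _ - _); rewrite rmorphD/=; ring.
  - rewrite intS opprD; split; last first.
      by rewrite -IH1; congr (f (_ + _ * _) - _); rewrite !rmorphD/= rmorphN1; ring.
    by rewrite -IH2 -fp; congr (f _ - _); rewrite !rmorphD/= rmorphN1; ring.
(* Some zero [a + k pi] of [h] lies within [4 |sin (x - a)|] of [x]; hence [h] vanishes at least to
   the order of the sine, which tames the poles of the cotangent. *)
have hsin x : `|h x| <= 4 * L * `|sin (x - a)|.
  have [k xk] := sin_dist (x - a).
  rewrite -[h x]subr0 -(hk k) /h opprB addrA subrK.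
  rewrite (le_trans (fL _ _))// [4 * L]mulrC -mulrA ler_wpM2l//.
  by rewrite opprD addrA.
have hM x : `|h x| <= 4 * L.
  by rewrite (le_trans (hsin x))// ler_piMr ?mulr_ge0// sin_max.
exists (f a); split => //.
have mh : measurable_fun [set: R] h.
  by apply: measurable_funB => //; exact: continuous_measurable_fun.
pose mu := @lebesgue_measure R; pose I := `[0, 2 * pi]%classic : set R.
have Ifin : (mu I < +oo)%E.
  by rewrite /mu /I lebesgue_measure_itv/=; case: ifP; rewrite ?ltry// -EFinB ltry.
have mI : measurable I by exact: measurable_itv.
pose S x := sin (x - a); pose C x := cos (x - a).
have SL x y : `|S x - S y| <= 1 * `|x - y|.
  by rewrite mul1r (le_trans (sin_lipschitz _ _))// opprB addrA subrK.
have S2 x : S x ^+ 2 <= 1 by have := cos2Dsin2 (x - a); rewrite -/(S x); have := sqr_ge0 (cos (x - a)); lra.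
have CS x : C x ^+ 2 = 1 - S x ^+ 2 by rewrite /C cos2sin2.
(* [(1 + e) * r e] is exactly the error caused by replacing [cot] with [sin cos / (sin^2 + e)]. *)
pose r e x := e * h x ^+ 2 / (S x ^+ 2 + e) ^+ 2.
have mr (e : R) : 0 < e -> measurable_fun [set: R] (r e).
  move=> e0; rewrite /r.
  rewrite (_ : (fun x => _) = fun x => e * h x ^+ 2 * ((S x ^+ 2 + e)^-1) ^+ 2); last first.
    by apply/funext => x; rewrite exprVn.
  apply: measurable_funM; first by apply: measurable_funM => //; exact: measurable_funX.
  apply: measurable_funX; apply: continuous_measurable_fun => x.
  apply: cvgV; first by rewrite gt_eqF// ltr_wpDl ?sqr_ge0.
  apply: cvgD; last exact: cvg_cst.
  apply: cvgM; exact: lipschitz_continuous SL x.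
have ineq (e : R) : 0 < e ->
    \int[mu]_(x in I) h x ^+ 2 - (1 + e) * \int[mu]_(x in I) r e x <=
    \int[mu]_(x in I) d x ^+ 2.
  move=> e0.
  have Se x : 0 < S x ^+ 2 + e by rewrite ltr_wpDl ?sqr_ge0.
  have Se0 x : S x ^+ 2 + e != 0 by rewrite gt_eqF.
  have dsa (t : R) : is_derive t 1 (fun x => x - a) 1.
    by have := is_derive_shift t 1 (- a).
  have dS (t : R) : is_derive t 1 S (C t).
    by apply: is_derive_eq (is_derive1_comp (is_derive_sin _) (dsa t)) _; rewrite mulr1.
  have dC (t : R) : is_derive t 1 C (- S t).
    by apply: is_derive_eq (is_derive1_comp (is_derive_cos _) (dsa t)) _; rewrite mulr1.
  pose c x := S x * C x / (S x ^+ 2 + e).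
  (* [E] is the derivative of [c]: the identity [cot' = - 1 - cot^2] with a correction of
     [e (1 + e) / (S^2 + e)^2]. *)
  pose E t := e * (1 + e) * ((S t ^+ 2 + e)^-1) ^+ 2 - 1 - c t ^+ 2.
  pose w x := h x ^+ 2 * c x.
  pose dw t := 2 * h t * d t * c t + h t ^+ 2 * E t.
  have lS : lipb S.
    by exists 1, 1; split=> // x; exact: sin_max.
  have lC : lipb C.
    exists 1, 1; split=> [x y|x]; last exact: cos_max.
    by rewrite mul1r (le_trans (cos_lipschitz _ _))// opprB addrA subrK.
  have lh : lipb h.
    exists L, (4 * L); split=> // x y; rewrite /h opprB addrA subrK.
    exact: fL.
  have lSe : lipb (fun x => (S x ^+ 2 + e)^-1).
    apply: (lipbV e0) => [x|]; first by rewrite lerDr sqr_ge0.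
    have [L' [M' [SL' SM]]] := lipbM lS lS.
    exists L', (M' + e); split => [x y|x].
      by rewrite opprD addrACA subrr addr0; exact: SL'.
    by rewrite (le_trans (ler_normD _ _))// lerD ?SM// gtr0_norm.
  have lw : lipb w by apply: (lipbM (lipbM lh lh)); apply: lipbM => //; exact: lipbM.
  have cS : continuous S by case: lS => ? [? [/lipschitz_continuous]].
  have cC : continuous C by case: lC => ? [? [/lipschitz_continuous]].
  have mS : measurable_fun [set: R] S by exact: continuous_measurable_fun.
  have mC : measurable_fun [set: R] C by exact: continuous_measurable_fun.
  have mSe : measurable_fun [set: R] (fun x => (S x ^+ 2 + e)^-1).
    by case: lSe => ? [? [/lipschitz_continuous ? _]]; exact: continuous_measurable_fun.
  have mc : measurable_fun [set: R] c by apply: measurable_funM => //; exact: measurable_funM.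
  have mE : measurable_fun [set: R] E.
    apply: measurable_funB; last exact: measurable_funX.
    by apply: measurable_funB => //; apply: measurable_funM => //; exact: measurable_funX.
  have mdw : measurable_fun [set: R] dw.
    apply: measurable_funD; apply: measurable_funM => //; last exact: measurable_funX.
    by do 2 apply: measurable_funM => //.
  have wder : {ae lebesgue_measure, forall t : R, 0 < t < 2 * pi -> is_derive t 1 w (dw t)}.
    move: fd; apply: filterS; first exact: (ae_filter_ringOfSetsType mu).
    move=> t + t0 => /(_ t0) ft.
    have dh : is_derive t 1 h (d t) by rewrite -[d t]subr0; exact: is_deriveB.
    apply: is_derive_eq (is_derive_sqr_ratio dh (dS t) (dC t) (Se0 t)) _.
    rewrite /dw /E /c; congr (_ + _ * _).
    rewrite exprMn [in X in _ = X](_ : (S t * C t) ^+ 2 = S t ^+ 2 * (1 - S t ^+ 2)) ?exprMn ?CS//.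
    by field.
  have [Lw [Mw [wL wM]]] := lw.
  (* [w] takes equal values at [0] and [2 pi], so its derivative integrates to 0 and may be added to
     the integrand for free. *)
  have := @lipschitz_integral_derive R w dw Lw 0 (2 * pi) _ (fun x y _ _ => wL x y) mdw wder.
  have -> : w (2 * pi) = w 0.
    rewrite /w /c /S /C /h -[2 * pi]add0r fp; have -> : 0 + 2 * pi - a = 0 - a + pi *+ 2 by ring.
    by rewrite sinD2pi cosD2pi.
  rewrite subrr => /(_ (mulr_ge0 (ler0n _ _) (ltW pi0))) Iw.
  pose bd (q : R -> R) := exists K, forall x, `|q x| <= K.
  have bdD p q : bd p -> bd q -> bd (fun x => p x + q x).
    by move=> [K pK] [K' qK]; exists (K + K') => x; rewrite (le_trans (ler_normD _ _))// lerD.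
  have bdM p q : bd p -> bd q -> bd (fun x => p x * q x).
    by move=> [K pK] [K' qK]; exists (K * K') => x; rewrite normrM ler_pM.
  have bdX p : bd p -> bd (fun x => p x ^+ 2) by move=> bp; exact: bdM.
  have bdN p : bd p -> bd (fun x => - p x).
    by move=> [K pK]; exists K => x; rewrite normrN.
  have bdk k : bd (fun=> k) by exists `|k|.
  have bdl p : lipb p -> bd p by move=> [_ [M [_ pM]]]; exists M.
  have bdd : bd d by exists L.
  have bdh : bd h by exact: bdl.
  have bdc : bd c by apply: bdl; apply: lipbM => //; exact: lipbM.
  have bdS : bd (fun x => (S x ^+ 2 + e)^-1) by exact: bdl.
  have Fint (q : R -> R) : measurable_fun [set: R] q -> bd q -> mu.-integrable I (EFin \o q).
    move=> mq [K qK]; apply: (bounded_integrable (M := K)) => //.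
    exact: measurable_funTS.
  have ih2 : mu.-integrable I (EFin \o (fun x => h x ^+ 2)).
    by apply: Fint; [exact: measurable_funX|exact: bdX].
  have id2 : mu.-integrable I (EFin \o (fun x => d x ^+ 2)).
    by apply: Fint; [exact: measurable_funX|exact: bdX].
  have rE : r e = fun x => e * h x ^+ 2 * ((S x ^+ 2 + e)^-1) ^+ 2.
    by apply/funext => x; rewrite /r exprVn.
  have mre := mr e e0.
  have br : bd (r e) by rewrite rE; apply: (bdM _ _); [apply: (bdM _ _) => //|]; exact: bdX.
  have ir : mu.-integrable I (EFin \o r e) by exact: Fint.
  have irZ : mu.-integrable I (EFin \o (fun x => (1 + e) * r e x)).
    by apply: Fint; [exact: measurable_funM|exact: bdM].
  have bdw : bd dw.
    apply: (bdD _ _); apply: (bdM _ _) => //; last 2 first.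
    - exact: bdX.
    - apply: (bdD _ _); last by apply: (bdN _); exact: bdX.
      by apply: (bdD _ _) => //; apply: (bdM _ _) => //; exact: bdX.
    by do 2 apply: (bdM _ _) => //.
  have idw : mu.-integrable I (EFin \o dw) by exact: Fint.
  rewrite -[leLHS]addr0 -Iw -RintegralZl// -RintegralB//.
  have ihr : mu.-integrable I (EFin \o (fun x => h x ^+ 2 - (1 + e) * r e x)).
    apply: Fint; [apply: measurable_funB; [exact: measurable_funX|exact: measurable_funM]|].
    by apply: (bdD _ _); [exact: bdX|apply: (bdN _); exact: bdM].
  rewrite -RintegralD//; apply: le_Rintegral => //.
    apply: Fint; [apply: measurable_funD => //; apply: measurable_funB; [exact: measurable_funX|exact: measurable_funM]|].
    apply: (bdD _ _); last exact: bdw.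
    by apply: (bdD _ _); [exact: bdX|apply: (bdN _); exact: bdM].
  move=> x _; rewrite rE /dw /E.
  have := sqr_ge0 (d x - h x * c x); set i := _^-1; set z := c x; lra.
have rlim : (\int[mu]_(x in I) r (n.+1%:R^-1) x) @[n --> \oo] --> (0 : R).
  rewrite -[X in _ --> X](_ : \int[mu]_(x in I) (cst 0 x) = 0); last by rewrite Rintegral_cst ?mul0r.
  (* The bound combines [h^2 <= 16 L^2 S^2] with [4 e S^2 <= (S^2 + e)^2]. Pointwise, [r e] is of
     order [e] where [S] does not vanish and is 0 where it does, since [h] vanishes there too. *)
  apply: (dominated_Rintegral_cvg (M := 4 * L ^+ 2)) => //.
  - by move=> n; apply: measurable_funTS; apply: mr; rewrite invr_gt0.
  - apply: aeW => x _; have [S0|S0] := eqVneq (S x) 0.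
      have h0 : h x = 0 by apply/normr0_eq0/le_anti; rewrite normr_ge0 andbT (le_trans (hsin x))// -/(S x) S0 normr0 mulr0.
      by rewrite (_ : (fun n => _) = cst 0); [exact: cvg_cst|apply/funext => n; rewrite /r h0 expr0n mulr0 mul0r].
    have S20 : 0 < S x ^+ 2 by rewrite lt_neqAle sqr_ge0 andbT eq_sym expf_neq0.
    apply: (@squeeze_cvgr _ _ _ _ (cst 0) (fun n => n.+1%:R^-1 * (h x ^+ 2 / (S x ^+ 2) ^+ 2))).
    + near=> n; rewrite /= /r.
      have n0 : 0 < n.+1%:R^-1 :> R by rewrite invr_gt0.
      apply/andP; split.
        by apply: divr_ge0; [apply: mulr_ge0; [exact: ltW|exact: sqr_ge0]|exact: sqr_ge0].
      rewrite -mulrA ler_wpM2l ?(ltW n0)//.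
      have q1 : 0 < (S x ^+ 2) ^+ 2 by rewrite exprn_gt0.
      have q2 : 0 < (S x ^+ 2 + n.+1%:R^-1) ^+ 2 by rewrite exprn_gt0// addr_gt0.
      rewrite ler_wpM2l ?sqr_ge0// lef_pV2 ?posrE//.
      by rewrite lerXn2r ?nnegrE ?addr_ge0 ?(ltW S20) ?(ltW n0)// lerDl ltW.
    + exact: cvg_cst.
    + rewrite -[X in _ --> X](mul0r (h x ^+ 2 / (S x ^+ 2) ^+ 2)).
      by apply: cvgMl; exact: cvg_harmonic.
  - move=> n x _; rewrite /r; set e := _^-1.
    have e0 : 0 < e by rewrite invr_gt0.
    have q0 : 0 < (S x ^+ 2 + e) ^+ 2 by rewrite exprn_gt0// ltr_wpDl// sqr_ge0.
    have r0 : 0 <= e * h x ^+ 2 / (S x ^+ 2 + e) ^+ 2.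
      by apply: divr_ge0; [apply: mulr_ge0; [exact: ltW|exact: sqr_ge0]|exact: sqr_ge0].
    rewrite (ger0_norm r0) ler_pdivrMr//.
    have : h x ^+ 2 <= 16 * L ^+ 2 * S x ^+ 2.
      rewrite -[leLHS]real_normK ?num_real// (_ : 16 * L ^+ 2 * S x ^+ 2 = (4 * L * `|S x|) ^+ 2).
        by rewrite lerXn2r ?nnegrE ?mulr_ge0//; exact: hsin.
      by rewrite !exprMn real_normK ?num_real//; ring.
    move=> /(ler_wpM2l (ltW e0)) /le_trans; apply.
    have := mulr_ge0 (sqr_ge0 L) (sqr_ge0 (S x ^+ 2 - e)); lra.
rewrite -[leLHS]subr0 -[X in _ - X](mulr0 (1 + 0)).
have lim : (fun n => \int[mu]_(x in I) h x ^+ 2 -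
    (1 + n.+1%:R^-1) * \int[mu]_(x in I) r (n.+1%:R^-1) x) @ \oo -->
    \int[mu]_(x in I) h x ^+ 2 - (1 + 0) * 0.
  apply: cvgB; first exact: cvg_cst.
  apply: cvgM => //; apply: cvgD; first exact: cvg_cst.
  exact: cvg_harmonic.
rewrite -(cvg_lim _ lim)//; apply: limr_le; first by apply/cvg_ex; eexists; exact: lim.
by near=> n; apply: ineq; rewrite invr_gt0.
Unshelve. all: by end_near. Qed.

(** * Bernstein polynomials *)

Section bernstein_weights.
Context {R : realType}.
Implicit Types (n i j k : nat) (x y : R).

(* The Bernstein weights and nodes of [[0, 1]], transported to [[-1, 1]]. *)
Definition bweight n i x : R :=
  'C(n, i)%:R * (((1 + x) / 2) ^+ i * ((1 - x) / 2) ^+ (n - i)).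

Definition bnode n i : R := 2 * i%:R / n%:R - 1.

(** The central moments of the binomial law with parameter [(1 + x) / 2], rescaled to [[-1, 1]]. *)
Definition bmoment n k x : R := \sum_(i < n.+1) bweight n i x * (bnode n i - x) ^+ k.

Lemma bweight_ge0 n i x : -1 <= x <= 1 -> 0 <= bweight n i x.
Proof.
move=> /andP[x1 x2]; rewrite /bweight mulr_ge0// mulr_ge0// exprn_ge0//; lra.
Qed.

Lemma sum_bweight n x : \sum_(i < n.+1) bweight n i x = 1.
Proof.
transitivity (((1 - x) / 2 + (1 + x) / 2) ^+ n); last by rewrite (_ : _ + _ = 1) ?expr1n//; field.
rewrite exprDn; apply: eq_bigr => i _; rewrite /bweight -mulr_natl; ring.
Qed.

Lemma bmoment0 n x : bmoment n 0 x = 1.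
Proof. by rewrite -(sum_bweight n x); apply: eq_bigr => i _; rewrite expr0 mulr1. Qed.

(** The logarithmic derivative of a binomial weight is proportional to [bnode n i - x]. In this form
    derivatives of Bernstein polynomials are again weighted means, and the moments satisfy a
    recursion. *)
Lemma is_derive_bweight n i x : (i <= n)%N -> (0 < n)%N -> -1 < x < 1 ->
  is_derive x 1 (bweight n i) (n%:R / (1 - x ^+ 2) * (bnode n i - x) * bweight n i x).
Proof.
move=> iin n0 /andP[x1 x2].
pose p : R -> R := 2^-1 *: (cst 1 + id); pose q : R -> R := 2^-1 *: (cst 1 - id).
rewrite (_ : bweight n i = 'C(n, i)%:R *: (p ^+ i * q ^+ (n - i))); last first.
  apply/funext => z; rewrite /bweight /p /q !fctE /=.
  by congr (_ * (_ ^+ _ * _ ^+ _)); rewrite /GRing.scale /= mulrC.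
have dp : is_derive x 1 p 2^-1.
  by apply: is_derive_eq; rewrite /GRing.scale /= add0r mulr1.
have dq : is_derive x 1 q (- 2^-1).
  by apply: is_derive_eq; rewrite /GRing.scale /= add0r mulrN mulr1.
apply: is_derive_eq.
rewrite !fctE /bweight /GRing.scale /=.
have -> : p x = (1 + x) / 2 by rewrite mulrC.
have -> : q x = (1 - x) / 2 by rewrite mulrC.
set P := (1 + x) / 2; set Q := (1 - x) / 2.
have P0 : P != 0 by rewrite gt_eqF// /P; lra.
have Q0 : Q != 0 by rewrite gt_eqF// /Q; lra.
have Pi : i%:R * P ^+ i.-1 = i%:R * P ^+ i / P.
  by case: (i) => [|k] /=; rewrite ?mul0r// exprSr mulrA mulfK.
have Qi : (n - i)%:R * Q ^+ (n - i).-1 = (n%:R - i%:R) * Q ^+ (n - i) / Q.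
  rewrite -natrB//; case: (n - i)%N => [|k] /=; rewrite ?mul0r// exprSr mulrA mulfK//.
rewrite Pi Qi.
have n0' : n%:R != 0 :> R by rewrite pnatr_eq0 -lt0n.
have xx : 1 - x ^+ 2 = 4 * P * Q by rewrite /P /Q; field.
have xP : x = 2 * P - 1 by rewrite /P; field.
have QP : Q = 1 - P by rewrite /P /Q; field.
move: (P ^+ i) (Q ^+ (n - i)) => A B.
clearbody P Q; rewrite xx /bnode xP QP; rewrite QP in Q0.
by field; rewrite P0 n0' Q0.
Qed.

Lemma is_derive_bmoment n k x : (0 < n)%N -> -1 < x < 1 ->
  is_derive x 1 (bmoment n k)
    (n%:R / (1 - x ^+ 2) * bmoment n k.+1 x - k%:R * bmoment n k.-1 x).
Proof.
move=> n0 x1.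
rewrite (_ : bmoment n k = \sum_(i < n.+1) (bweight n i * (cst (bnode n i) - id) ^+ k)); last first.
  by apply/funext => z; rewrite fct_sumE; apply: eq_bigr => i _; rewrite !fctE.
have dw (i : 'I_n.+1) := is_derive_bweight (leq_ord i) n0 x1.
have dn (i : 'I_n.+1) : is_derive x 1 (cst (bnode n i) - id) (-1).
  by apply: is_derive_eq; rewrite sub0r.
have H := is_derive_sum (fun i : 'I_n.+1 => is_deriveM (dw i) (is_deriveX k (dn i))).
apply: (is_derive_eq H); clear H.
rewrite /bmoment mulr_sumr mulr_sumr -sumrB; apply: eq_bigr => i _.
rewrite !fctE /GRing.scale /=; case: k => [|k] /=; first by rewrite expr0 expr1; ring.
set b := bnode n i - x; rewrite !exprS; ring.
Qed.

(** Solving the derivative formula for the highest moment gives a recursion, so a closed form on the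
    open interval propagates from one moment to the next by differentiation. *)
Lemma bmoment_next n k (q : R -> R) dq x : (0 < n)%N -> -1 < x < 1 ->
  (forall z, -1 < z < 1 -> bmoment n k z = q z) -> is_derive x 1 q dq ->
  bmoment n k.+1 x = (1 - x ^+ 2) / n%:R * (dq + k%:R * bmoment n k.-1 x).
Proof.
move=> n0 x1 mq [_ dqE].
have [_ dm] := is_derive_bmoment k n0 x1.
have e : 'D_1 (bmoment n k) x = 'D_1 q x.
  case/andP: x1 => x1 x2.
  apply: near_eq_derive; near=> z; apply: mq; apply/andP; split; near: z.
    exact: lt_nbhsr.
  exact: lt_nbhsl.
rewrite dm dqE in e; rewrite -e subrK.
have n0' : n%:R != 0 :> R by rewrite pnatr_eq0 -lt0n.
have xx : 1 - x ^+ 2 != 0 by case/andP: x1 => ? ?; rewrite gt_eqF//; nra.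
by field; rewrite n0' xx.
Unshelve. all: by end_near. Qed.

Lemma bmoment1 n x : (0 < n)%N -> -1 < x < 1 -> bmoment n 1 x = 0.
Proof.
move=> n0 x1; have -> := bmoment_next n0 x1 (fun z _ => bmoment0 n z) (is_derive_cst (1 : R) (x : R) (1 : R)).
by rewrite mul0r addr0 mulr0.
Qed.

Lemma bmoment2 n x : (0 < n)%N -> -1 < x < 1 -> bmoment n 2 x = (1 - x ^+ 2) / n%:R.
Proof.
move=> n0 x1; have -> := bmoment_next n0 x1 (fun z => @bmoment1 n z n0) (is_derive_cst (0 : R) (x : R) (1 : R)).
by rewrite bmoment0 add0r !mulr1.
Qed.

Lemma bmoment3 n x : (0 < n)%N -> -1 < x < 1 ->
  bmoment n 3 x = (1 - x ^+ 2) / n%:R * (- 2 * x / n%:R).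
Proof.
move=> n0 x1.
have dq : is_derive x 1 (fun z => (1 - z ^+ 2) / n%:R) (- 2 * x / n%:R).
  rewrite (_ : (fun z => _) = n%:R^-1 *: (cst 1 - id ^+ 2)); last first.
    by apply/funext => z; rewrite !fctE mulrC.
  by apply: is_derive_eq; rewrite /GRing.scale /=; ring.
by rewrite (bmoment_next n0 x1 (fun z => @bmoment2 n z n0) dq) bmoment1// mulr0 addr0.
Qed.

(** Here 7 is [4 + 3], from crude bounds of the two terms of the recursion. What matters is the
    order [n^-2]: it beats the factor [n] in the gradient and so controls the nodes far from the
    point in [bernstein_d1_cvg]. *)
Lemma bmoment4 n x : (0 < n)%N -> -1 < x < 1 -> bmoment n 4 x <= 7 / n%:R ^+ 2.
Proof.
move=> n0 x1.
have n0' : n%:R != 0 :> R by rewrite pnatr_eq0 -lt0n.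
have dq : is_derive x 1 (fun z => (1 - z ^+ 2) / n%:R * (- 2 * z / n%:R))
    ((- 2 + 6 * x ^+ 2) / n%:R ^+ 2).
  rewrite (_ : (fun z => _) = (- 2 / n%:R ^+ 2) *: (id - id ^+ 3)); last first.
    by apply/funext => z; rewrite !fctE /GRing.scale /=; field.
  by apply: is_derive_eq; rewrite /GRing.scale /=; field.
rewrite (bmoment_next n0 x1 (fun z => @bmoment3 n z n0) dq) bmoment2//.
have n1 : 1 <= n%:R :> R by rewrite ler1n.
set N := n%:R in n1 n0' *; set y := x ^+ 2.
have y01 : 0 <= y < 1 by rewrite sqr_ge0 /y; case/andP: x1 => ? ?; nra.
have -> : (1 - y) / N * ((- 2 + 6 * y) / N ^+ 2 + 3 * ((1 - y) / N)) =
    (1 - y) * ((- 2 + 6 * y) / N + 3 * (1 - y)) / N ^+ 2 by field.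
rewrite ler_pM2r; last by rewrite invr_gt0 exprn_gt0//; lra.
have : (- 2 + 6 * y) / N <= 4.
  by rewrite ler_pdivrMr; case/andP: y01 => ? ?; lra.
by case/andP: y01 => ? ? ?; nra.
Qed.

(** The endpoints are needed for convergence up to the boundary of the square, hence for the trace.
    The recursion does not reach them, but there all the weight sits on the node equal to [x]. *)
Lemma bmoment2_le n x : (0 < n)%N -> -1 <= x <= 1 -> bmoment n 2 x <= n%:R^-1.
Proof.
move=> n0 /andP[x1 x2].
have n0' : n%:R != 0 :> R by rewrite pnatr_eq0 -lt0n.
have [->|xn1] := eqVneq x 1.
  rewrite /bmoment big1 ?invr_ge0// => -[i /=]; rewrite ltnS leq_eqVlt => /predU1P[->|iin] _.
    by rewrite /bnode mulfK// (_ : 2 - 1 - 1 = 0) ?expr0n ?mulr0//; ring.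
  by rewrite /bweight subrr mul0r expr0n subn_eq0 leqNgt iin/= !mulr0 mul0r.
have [->|xnN1] := eqVneq x (-1).
  rewrite /bmoment big1 ?invr_ge0// => -[[|i] /= iin] _.
    by rewrite /bnode mulr0 mul0r sub0r subrr expr0n mulr0.
  by rewrite /bweight subrr mul0r expr0n/= mul0r mulr0 mul0r.
rewrite bmoment2// ?lt_neqAle ?x1 ?x2 ?xn1 1?eq_sym ?xnN1//.
by rewrite ler_piMl ?invr_ge0//; have := sqr_ge0 x; lra.
Qed.

End bernstein_weights.

Section bernstein_operator.
Context {R : realType}.
Implicit Types (f : R * R -> R) (u v : R * R).

Definition bernstein n f u : R := \sum_(i < n.+1) \sum_(j < n.+1)
  f (bnode n i, bnode n j) * (bweight n i u.1 * bweight n j u.2).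

Definition bernstein_d1 n f u : R := \sum_(i < n.+1) \sum_(j < n.+1)
  f (bnode n i, bnode n j) *
    (n%:R / (1 - u.1 ^+ 2) * (bnode n i - u.1) * bweight n i u.1 * bweight n j u.2).

(** Exchanging the variables lets every estimate of the gradient be made once, for the first partial
    derivative. *)
Definition bernstein_d2 n f u : R := bernstein_d1 n (fun p => f (p.2, p.1)) (u.2, u.1).

Lemma bernsteinC n f u : bernstein n f u = bernstein n (fun p => f (p.2, p.1)) (u.2, u.1).
Proof.
rewrite /bernstein exchange_big /=; apply: eq_bigr => i _; apply: eq_bigr => j _.
by rewrite [in RHS](mulrC (bweight n i _)).
Qed.

Lemma sum_bweight2 n k l (x y c : R) :
  \sum_(i < n.+1) \sum_(j < n.+1) (c * (bnode n i - x) ^+ k * (bnode n j - y) ^+ l) *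
    (bweight n i x * bweight n j y) = c * bmoment n k x * bmoment n l y.
Proof.
rewrite /bmoment -mulrA big_distrlr /= mulr_sumr; apply: eq_bigr => i _.
by rewrite mulr_sumr; apply: eq_bigr => j _; ring.
Qed.

Lemma bernstein_mean_le n (x y : R) (F G : nat -> nat -> R) :
  -1 <= x <= 1 -> -1 <= y <= 1 -> (forall i j, F i j <= G i j) ->
  \sum_(i < n.+1) \sum_(j < n.+1) F i j * (bweight n i x * bweight n j y) <=
  \sum_(i < n.+1) \sum_(j < n.+1) G i j * (bweight n i x * bweight n j y).
Proof.
move=> x1 y1 FG; apply: ler_sum => i _; apply: ler_sum => j _.
by rewrite ler_wpM2r// mulr_ge0// bweight_ge0.
Qed.

Lemma bernstein_mean_norm n (x y : R) (F : nat -> nat -> R) :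
  -1 <= x <= 1 -> -1 <= y <= 1 ->
  `|\sum_(i < n.+1) \sum_(j < n.+1) F i j * (bweight n i x * bweight n j y)| <=
  \sum_(i < n.+1) \sum_(j < n.+1) `|F i j| * (bweight n i x * bweight n j y).
Proof.
move=> x1 y1; rewrite (le_trans (ler_norm_sum _ _ _))//; apply: ler_sum => i _.
rewrite (le_trans (ler_norm_sum _ _ _))//; apply: ler_sum => j _.
by rewrite normrM (ger0_norm (mulr_ge0 _ _))// bweight_ge0.
Qed.

Context f (L : R) (fL : forall u v, `|f u - f v| <= L * (`|u.1 - v.1| + `|u.2 - v.2|)).

Let L0 : 0 <= L.
Proof.
have := le_trans (normr_ge0 _) (fL (1, 0) (0, 0)).
by rewrite /= subr0 subrr normr1 normr0 addr0 mulr1.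
Qed.

(** The inequality [|z| <= d + z^2 / d] replaces absolute values by second moments, so near and far
    nodes need not be separated; [d] is left free to be optimized. *)
Lemma bernstein_dist n u (d : R) : (0 < n)%N -> -1 <= u.1 <= 1 -> -1 <= u.2 <= 1 ->
  0 < d -> `|bernstein n f u - f u| <= 2 * L * (d + d^-1 / n%:R).
Proof.
move=> n0 u1 u2 d0; case: u u1 u2 => x y /= x1 y1.
have -> : bernstein n f (x, y) - f (x, y) = \sum_(i < n.+1) \sum_(j < n.+1)
    (f (bnode n i, bnode n j) - f (x, y)) * (bweight n i x * bweight n j y).
  have := sum_bweight2 n 0 0 x y (f (x, y)).
  rewrite !bmoment0 !mulr1 => {1}<-; rewrite /bernstein -sumrB.
  apply: eq_bigr => i _; rewrite -sumrB; apply: eq_bigr => j _.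
  by rewrite ?expr0 ?mulr1 mulrBl.
rewrite (le_trans (bernstein_mean_norm n (fun i j => f (bnode n i, bnode n j) - f (x, y)) x1 y1))//.
have abs z : `|z| <= d + d^-1 * z ^+ 2 :> R.
  rewrite -(real_normK (num_real z)); set t := `|z|.
  have -> : d + d^-1 * t ^+ 2 = (d ^+ 2 + t ^+ 2) / d by field; rewrite gt_eqF.
  by rewrite ler_pdivlMr//; have := sqr_ge0 (d - t); have := sqr_ge0 d; have := sqr_ge0 t; lra.
pose G i j := (2 * L * d) * (bnode n i - x) ^+ 0 * (bnode n j - y) ^+ 0 +
  ((L / d) * (bnode n i - x) ^+ 2 * (bnode n j - y) ^+ 0 +
  (L / d) * (bnode n i - x) ^+ 0 * (bnode n j - y) ^+ 2).
have := @bernstein_mean_le n x y (fun i j => `|f (bnode n i, bnode n j) - f (x, y)|) G x1 y1.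
have -> : \sum_(i < n.+1) \sum_(j < n.+1) G i j * (bweight n i x * bweight n j y) =
    2 * L * d + (L / d * bmoment n 2 x + L / d * bmoment n 2 y).
  transitivity (2 * L * d * bmoment n 0 x * bmoment n 0 y +
    (L / d * bmoment n 2 x * bmoment n 0 y + L / d * bmoment n 0 x * bmoment n 2 y)); last first.
    by rewrite !bmoment0; ring.
  rewrite -!sum_bweight2 -!big_split /=; apply: eq_bigr => i _.
  by rewrite -!big_split /=; apply: eq_bigr => j _; rewrite /G; ring.
move=> /(_ _)/le_trans; apply => [i j|].
  rewrite (le_trans (fL _ _))// /G /= !expr0 !mulr1.
  have := ler_wpM2l L0 (lerD (abs (bnode n i - x)) (abs (bnode n j - y))).
  by move/le_trans; apply; rewrite le_eqVlt; apply/orP; left; apply/eqP; ring.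
have Ld : 0 <= L / d by rewrite divr_ge0// ltW.
have := ler_wpM2l Ld (bmoment2_le n0 x1); have := ler_wpM2l Ld (bmoment2_le n0 y1).
have -> : 2 * L * (d + d^-1 / n%:R) = 2 * L * d + 2 * (L / d * n%:R^-1) by ring.
lra.
Qed.

Lemma bernstein_cvg u : -1 <= u.1 <= 1 -> -1 <= u.2 <= 1 ->
  bernstein n.+1 f u @[n --> \oo] --> f u.
Proof.
move=> u1 u2; apply/cvgrPdist_le => /= e e0.
pose d := e / (4 * (L + 1)); have d0 : 0 < d by rewrite divr_gt0//; have := L0; lra.
near=> n; rewrite distrC (le_trans (bernstein_dist _ u1 u2 d0))//.
have n1 : d^-1 * n.+1%:R^-1 <= d.
  rewrite mulrC ler_pdivrMr// ltW//; near: n.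
  have dd : 0 < d * d by rewrite mulr_gt0.
  by apply: filterS (near_infty_natSinv_lt (PosNum dd)) => n /=.
have L1 : 0 < L + 1 by have := L0; lra.
have -> : e = 4 * (L + 1) * d by rewrite /d; field; rewrite gt_eqF.
set t := d^-1 * _ in n1 *; have := ler_wpM2l L0 n1; lra.
Unshelve. all: by end_near. Qed.

(** The second moment times [n / (1 - x^2)] is 1. Subtracting [c] from the derivative thus amounts
    to subtracting a linear function of slope [c] from [f]. *)
Lemma bernstein_d1E n u (c : R) : (0 < n)%N -> -1 < u.1 < 1 ->
  bernstein_d1 n f u - c = \sum_(i < n.+1) \sum_(j < n.+1)
   (n%:R / (1 - u.1 ^+ 2) * (bnode n i - u.1) *
     (f (bnode n i, bnode n j) - c * (bnode n i - u.1))) *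
    (bweight n i u.1 * bweight n j u.2).
Proof.
case: u => x y /= n0 x1.
have N0 : n%:R != 0 :> R by rewrite pnatr_eq0 -lt0n.
have X0 : 1 - x ^+ 2 != 0 by case/andP: x1 => ? ?; rewrite gt_eqF//; nra.
have -> : c = \sum_(i < n.+1) \sum_(j < n.+1)
    (n%:R / (1 - x ^+ 2) * c * (bnode n i - x) ^+ 2 * (bnode n j - y) ^+ 0) *
    (bweight n i x * bweight n j y).
  rewrite sum_bweight2 bmoment0 bmoment2// mulr1.
  by field; rewrite N0 X0.
rewrite /bernstein_d1 -sumrB; apply: eq_bigr => i _; rewrite -sumrB; apply: eq_bigr => j _ /=.
rewrite sum_bweight2 bmoment0 bmoment2// mulr1.
by field; rewrite N0 X0.
Qed.

(* As the first moment vanishes, the difference quotients may be taken from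
   (u.1, bnode j), so that only the Lipschitz constant enters. *)
Lemma bernstein_d1_le n u : (0 < n)%N -> -1 < u.1 < 1 -> -1 <= u.2 <= 1 ->
  `|bernstein_d1 n f u| <= L.
Proof.
case: u => x y /= n0 x1 y1.
have x1' : -1 <= x <= 1 by case/andP: x1 => ? ?; apply/andP; split; exact: ltW.
have N0 : n%:R != 0 :> R by rewrite pnatr_eq0 -lt0n.
have X0 : 0 < 1 - x ^+ 2 by case/andP: x1 => ? ?; nra.
have K0 : 0 <= n%:R / (1 - x ^+ 2) by rewrite divr_ge0// ltW.
pose F i j := n%:R / (1 - x ^+ 2) * (bnode n i - x) *
     (f (bnode n i, bnode n j) - f (x, bnode n j)).
have -> : bernstein_d1 n f (x, y) = \sum_(i < n.+1) \sum_(j < n.+1) F i j *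
    (bweight n i x * bweight n j y).
  apply/eqP; rewrite -subr_eq0 /bernstein_d1 -sumrB.
  rewrite (eq_bigr (fun i : 'I_n.+1 => \sum_(j < n.+1) (n%:R / (1 - x ^+ 2) * f (x, bnode n j)
    * bweight n j y) * (bweight n i x * (bnode n i - x) ^+ 1))); last first.
    by move=> i _; rewrite -sumrB; apply: eq_bigr => j _; rewrite /F /= expr1; ring.
  rewrite exchange_big /= big1// => j _.
  by rewrite -mulr_sumr -/(bmoment n 1 x) bmoment1// mulr0.
rewrite (le_trans (bernstein_mean_norm n F x1' y1))//.
have := @bernstein_mean_le n x y (fun i j => `|F i j|)
  (fun i j => n%:R / (1 - x ^+ 2) * L * (bnode n i - x) ^+ 2 * (bnode n j - y) ^+ 0) x1' y1.
rewrite sum_bweight2 bmoment0 bmoment2// mulr1.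
have -> : n%:R / (1 - x ^+ 2) * L * ((1 - x ^+ 2) / n%:R) = L by field; rewrite N0 gt_eqF.
apply => i j; rewrite /F; move: (n%:R / _) K0 => K K0.
rewrite !normrM (ger0_norm K0) expr0 mulr1 -!mulrA ler_wpM2l//.
rewrite -(real_normK (num_real (bnode n i - x))) expr2 mulrCA ler_wpM2l//.
by rewrite (le_trans (fL _ _))//= subrr normr0 addr0.
Qed.

(** Differentiability at the single point [u] suffices. The remainder [g] is small relative to the
    distance near [u], where second moments balance the factor [n]; away from [u] it is at most
    linear, hence dominated by fourth powers, whose moments are of order [n^-2]. *)
Lemma bernstein_d1_cvg u (l1 l2 : R) : -1 < u.1 < 1 -> -1 < u.2 < 1 ->
  (forall e : R, 0 < e -> \forall v \near u,
     `|f v - f u - (l1 * (v.1 - u.1) + l2 * (v.2 - u.2))| <=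
       e * (`|v.1 - u.1| + `|v.2 - u.2|)) ->
  bernstein_d1 n.+1 f u @[n --> \oo] --> l1.
Proof.
case: u => x y /= x1 y1 fd.
have x1' : -1 <= x <= 1 by case/andP: x1 => ? ?; apply/andP; split; exact: ltW.
have y1' : -1 <= y <= 1 by case/andP: y1 => ? ?; apply/andP; split; exact: ltW.
have X0 : 0 < 1 - x ^+ 2 by case/andP: x1 => ? ?; nra.
pose C := L + `|l1| + `|l2|.
have C0 : 0 <= C by rewrite /C; have := normr_ge0 l1; have := normr_ge0 l2; have := L0; lra.
apply/cvgrPdist_le => /= e e0.
(* With this choice each of the two second-moment terms contributes at most [e / 4]. *)
pose e1 := e * (1 - x ^+ 2) / 8; have e10 : 0 < e1 by rewrite divr_gt0// mulr_gt0.
have /nbhs_ballP[d /= d0 fd1] := fd e1 e10.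
pose g v := f v - f (x, y) - (l1 * (v.1 - x) + l2 * (v.2 - y)).
have gC v : `|g v| <= C * (`|v.1 - x| + `|v.2 - y|).
  rewrite /g (le_trans (ler_normB _ _))//.
  rewrite (le_trans (lerD (fL _ _) (ler_normD _ _)))//= !normrM /C.
  have := mulr_ge0 (normr_ge0 l1) (normr_ge0 (v.2 - y)).
  have := mulr_ge0 (normr_ge0 l2) (normr_ge0 (v.1 - x)); lra.
(* Outside the ball of radius [d], with [a] and [b] the coordinate distances,
   [d^2 (a^2 + b^2) <= 2 (a^4 + b^4)]; the other factor 2 comes from
   [a (a + b) <= 2 (a^2 + b^2)]. *)
pose D := 4 * C / d ^+ 2.
have D0 : 0 <= D by apply: divr_ge0; [exact: mulr_ge0|exact: sqr_ge0].
have gle v : `|v.1 - x| * `|g v| <= 2 * e1 * ((v.1 - x) ^+ 2 + (v.2 - y) ^+ 2) +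
    D * ((v.1 - x) ^+ 4 + (v.2 - y) ^+ 4).
  rewrite (exprM _ 2 2) (exprM (v.2 - y) 2 2).
  rewrite -(real_normK (num_real (v.1 - x))) -(real_normK (num_real (v.2 - y))).
  have a0 := normr_ge0 (v.1 - x); have b0 := normr_ge0 (v.2 - y).
  have ab : `|v.1 - x| * (`|v.1 - x| + `|v.2 - y|) <= 2 * (`|v.1 - x| ^+ 2 + `|v.2 - y| ^+ 2).
    by have := sqr_ge0 (`|v.1 - x| - `|v.2 - y|); have := sqr_ge0 (`|v.2 - y|); 
       have := sqr_ge0 (`|v.1 - x|); lra.
  have [vd|vd] := ltP (Num.max `|v.1 - x| `|v.2 - y|) d.
    have gv : `|g v| <= e1 * (`|v.1 - x| + `|v.2 - y|).
      apply: fd1; rewrite /ball /=; split; rewrite /ball /= distrC.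
        by apply: le_lt_trans vd; rewrite le_max lexx.
      by apply: le_lt_trans vd; rewrite le_max lexx orbT.
    have := ler_wpM2l a0 gv; have := ler_wpM2l (ltW e10) ab.
    have : 0 <= D * ((`|v.1 - x| ^+ 2) ^+ 2 + (`|v.2 - y| ^+ 2) ^+ 2).
      by rewrite mulr_ge0// addr_ge0// sqr_ge0.
    set z := D * _; move: (`|g v|) => G; lra.
  have d2 : d ^+ 2 <= `|v.1 - x| ^+ 2 + `|v.2 - y| ^+ 2.
    have := sqr_ge0 `|v.1 - x|; have := sqr_ge0 `|v.2 - y|.
    move: vd; rewrite le_max => /orP[] /(lerXn2r 2); rewrite !nnegrE => /(_ (ltW d0)) h.
      by have := h a0; lra.
    by have := h b0; lra.
  have gv := gC v; move: gv a0 b0 ab d2; move: (`|g v|) (`|v.1 - x|) (`|v.2 - y|) => G a b gv a0 b0 ab d2.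
  have d20 : 0 < d ^+ 2 by rewrite exprn_gt0.
  have q0 : 0 <= a ^+ 2 + b ^+ 2 by rewrite addr_ge0// sqr_ge0.
  have h1 : d ^+ 2 * (a ^+ 2 + b ^+ 2) <= 2 * ((a ^+ 2) ^+ 2 + (b ^+ 2) ^+ 2).
    rewrite (le_trans (ler_wpM2r q0 d2))//.
    by have := sqr_ge0 (a ^+ 2 - b ^+ 2); lra.
  have h2 : C * (2 * (a ^+ 2 + b ^+ 2)) <= D * ((a ^+ 2) ^+ 2 + (b ^+ 2) ^+ 2).
    rewrite /D mulrAC ler_pdivlMr//.
    by have := ler_wpM2l C0 h1; lra.
  have h3 := ler_wpM2l a0 gv; have h4 := ler_wpM2l C0 ab.
  have h5 : 0 <= e1 * (a ^+ 2 + b ^+ 2) by rewrite mulr_ge0// ltW.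
  lra.
have main n : `|bernstein_d1 n.+1 f (x, y) - l1| <= e / 2 + 14 * D / (1 - x ^+ 2) / n.+1%:R.
  rewrite bernstein_d1E//=.
  pose K := n.+1%:R / (1 - x ^+ 2).
  have K0 : 0 <= K by rewrite divr_ge0// ltW.
  pose F i j := K * (bnode n.+1 i - x) * g (bnode n.+1 i, bnode n.+1 j).
  (* The constant [f (x, y)] and the linear term in the second variable may be subtracted, because
     both are multiplied by the vanishing first moment in the first variable. *)
  have -> : \sum_(i < n.+2) \sum_(j < n.+2)
      (n.+1%:R / (1 - x ^+ 2) * (bnode n.+1 i - x) *
        (f (bnode n.+1 i, bnode n.+1 j) - l1 * (bnode n.+1 i - x))) *
      (bweight n.+1 i x * bweight n.+1 j y) =
      \sum_(i < n.+2) \sum_(j < n.+2) F i j * (bweight n.+1 i x * bweight n.+1 j y).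
    apply/eqP; rewrite -subr_eq0 -sumrB.
    have e0' : K * f (x, y) * bmoment n.+1 1 x * bmoment n.+1 0 y +
      K * l2 * bmoment n.+1 1 x * bmoment n.+1 1 y = 0.
      by rewrite (bmoment1 _ x1)// !mulr0 !mul0r addr0.
    rewrite -[X in _ == X]e0'; apply/eqP; rewrite -!sum_bweight2 -big_split /=.
    apply: eq_bigr => i _; rewrite -sumrB -big_split /=; apply: eq_bigr => j _.
    by rewrite /F /g /K /= !expr1 expr0; ring.
  rewrite (le_trans (bernstein_mean_norm n.+1 F x1' y1'))//.
  pose G i j := K * (2 * e1) * (bnode n.+1 i - x) ^+ 2 * (bnode n.+1 j - y) ^+ 0 +
    (K * (2 * e1) * (bnode n.+1 i - x) ^+ 0 * (bnode n.+1 j - y) ^+ 2 +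
    (K * D * (bnode n.+1 i - x) ^+ 4 * (bnode n.+1 j - y) ^+ 0 +
     K * D * (bnode n.+1 i - x) ^+ 0 * (bnode n.+1 j - y) ^+ 4)).
  have := @bernstein_mean_le n.+1 x y (fun i j => `|F i j|) G x1' y1'.
  have -> : \sum_(i < n.+2) \sum_(j < n.+2) G i j * (bweight n.+1 i x * bweight n.+1 j y) =
      K * (2 * e1) * bmoment n.+1 2 x * bmoment n.+1 0 y +
      (K * (2 * e1) * bmoment n.+1 0 x * bmoment n.+1 2 y +
      (K * D * bmoment n.+1 4 x * bmoment n.+1 0 y +
       K * D * bmoment n.+1 0 x * bmoment n.+1 4 y)).
    rewrite -!sum_bweight2 -!big_split /=; apply: eq_bigr => i _.
    by rewrite -!big_split /=; apply: eq_bigr => j _; rewrite /G; ring.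
  move=> /(_ _)/le_trans; apply => [i j|].
    rewrite /F /G; move: K K0 {F G} => K K0; rewrite !normrM (ger0_norm K0) !expr0 -mulrA.
    have := ler_wpM2l K0 (gle (bnode n.+1 i, bnode n.+1 j)); rewrite /=; lra.
  rewrite !bmoment0.
  have N0 : 0 < n.+1%:R :> R by [].
  have k1 := ler_wpM2l (mulr_ge0 K0 (mulr_ge0 (ler0n _ 2) (ltW e10))) (bmoment2_le (ltn0Sn n) x1').
  have k2 := ler_wpM2l (mulr_ge0 K0 (mulr_ge0 (ler0n _ 2) (ltW e10))) (bmoment2_le (ltn0Sn n) y1').
  have k3 := ler_wpM2l (mulr_ge0 K0 D0) (bmoment4 (ltn0Sn n) x1).
  have k4 := ler_wpM2l (mulr_ge0 K0 D0) (bmoment4 (ltn0Sn n) y1).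
  have E1 : K * (2 * e1) * n.+1%:R^-1 = e / 4.
    by rewrite /K /e1; field; rewrite !gt_eqF.
  have E2 : K * D * (7 / n.+1%:R ^+ 2) = 7 * D / (1 - x ^+ 2) / n.+1%:R.
    by rewrite /K; field; rewrite !gt_eqF.
  rewrite E1 in k1 k2; rewrite E2 in k3 k4.
  rewrite (_ : 14 * D / (1 - x ^+ 2) / n.+1%:R = 2 * (7 * D / (1 - x ^+ 2) / n.+1%:R)); last by ring.
  set z := 7 * D / _ / _ in k3 k4 *; lra.
pose B := 14 * D / (1 - x ^+ 2).
have B0 : 0 <= B by apply: divr_ge0; [exact: mulr_ge0|exact: ltW].
near=> n; rewrite distrC (le_trans (main n))// -/B.
have : B * n.+1%:R^-1 <= e / 2.
  have /le_trans : B * n.+1%:R^-1 <= (B + 1) * n.+1%:R^-1 by rewrite ler_wpM2r ?invr_ge0// lerDl.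
  apply; rewrite -ler_pdivlMl ?ltr_wpDl//; apply/ltW; near: n.
  have eB : 0 < (B + 1)^-1 * (e / 2) by rewrite mulr_gt0 ?invr_gt0 ?ltr_wpDl// divr_gt0.
  exact: near_infty_natSinv_lt (PosNum eB).
set z := B * _; lra.
Unshelve. all: by end_near. Qed.

End bernstein_operator.

Lemma cvg_is_derive (R : numFieldType) (V W : normedModType R) (f : V -> W) (a v : V) (d : W) :
  h^-1 *: (f (h *: v + a) - f a) @[h --> 0^'] --> d -> is_derive a v f d.
Proof.
move=> fd; apply: DeriveDef; first by apply/cvg_ex; exists d; exact: fd.
by apply: cvg_lim => //; exact: norm_hausdorff.
Qed.

Lemma cvg_row (R : realType) m T (F : set_system T) {FF : Filter F}
    (phi : T -> 'rV[R]_m) (l : 'rV[R]_m) :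
  (forall i, phi t 0 i @[t --> F] --> l 0 i) -> phi t @[t --> F] --> l.
Proof.
move=> phil; apply/cvg_mx_entourageP => A eA.
have H (j : 'I_m) : \forall t \near F, (l 0 j, phi t 0 j) \in A.
  have : F (fun t => A (l 0 j, phi t 0 j)) := (cvg_entourageP (fmap_filter (fun t => phi t 0 j) FF) _).1 (phil j) A eA.
  by apply: filterS => t At; rewrite inE.
have : \forall t \near F, forall j : 'I_m, (l 0 j, phi t 0 j) \in A.
  by apply: filter_forall => j; exact: H.
by apply: filterS => t Ht i j; rewrite ord1.
Qed.

(** * Polynomial functions of two variables *)

(** This class is closed under directional derivatives, so smoothness of every order follows by
    induction from continuity and derivability. *)
Inductive polyfun2 (R : realType) : (R * R -> R) -> Prop :=
| polyfun2_cst (c : R) : polyfun2 (cst c)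
| polyfun2_fst : polyfun2 fst
| polyfun2_snd : polyfun2 snd
| polyfun2D f g : polyfun2 f -> polyfun2 g -> polyfun2 (f + g)
| polyfun2M f g : polyfun2 f -> polyfun2 g -> polyfun2 (f * g).

Section polyfun2_theory.
Context {R : realType}.
Implicit Types (f g : R * R -> R) (u v : R * R).

Lemma polyfun2X f n : polyfun2 f -> polyfun2 (f ^+ n).
Proof.
move=> pf; elim: n => [|n IH]; first exact: polyfun2_cst 1.
by rewrite exprS; exact: polyfun2M.
Qed.

Lemma polyfun2_sum n (F : 'I_n -> R * R -> R) :
  (forall i, polyfun2 (F i)) -> polyfun2 (\sum_(i < n) F i).
Proof.
move=> pF; apply: big_ind => [|f g|i _]; [exact: polyfun2_cst 0|exact: polyfun2D|exact: pF].
Qed.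

Lemma polyfun2_continuous f : polyfun2 f -> continuous f.
Proof.
elim=> [c|||g h _ cg _ ch|g h _ cg _ ch] u.
- exact: cvg_cst.
- exact: cvg_fst.
- exact: cvg_snd.
- by apply: cvgD; [exact: cg|exact: ch].
- by apply: cvgM; [exact: cg|exact: ch].
Qed.

Lemma is_derive_fst u v : is_derive u v (fst : R * R -> R) v.1.
Proof.
apply: cvg_is_derive; apply: cvg_near_cst; near=> h.
have h0 : h != 0 by near: h; exact: nbhs_dnbhs_neq.
by rewrite /= addrK scalerA mulVf ?scale1r.
Unshelve. all: by end_near. Qed.

Lemma is_derive_snd u v : is_derive u v (snd : R * R -> R) v.2.
Proof.
apply: cvg_is_derive; apply: cvg_near_cst; near=> h.
have h0 : h != 0 by near: h; exact: nbhs_dnbhs_neq.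
by rewrite /= addrK scalerA mulVf ?scale1r.
Unshelve. all: by end_near. Qed.

Lemma polyfun2_derive f v : polyfun2 f ->
  (forall u, derivable f u v) /\ polyfun2 ('D_v f).
Proof.
elim=> [c|||g h pg [dg pdg] ph [dh pdh]|g h pg [dg pdg] ph [dh pdh]].
- split=> [u|]; first exact: derivable_cst.
  by rewrite (_ : 'D_v (cst c) = cst 0); [exact: polyfun2_cst|apply/funext => u; exact: derive_cst].
- have d u := is_derive_fst u v; split=> [u|]; first by case: (d u).
  rewrite (_ : 'D_v fst = cst v.1); first exact: polyfun2_cst.
  by apply/funext => u; case: (d u).
- have d u := is_derive_snd u v; split=> [u|]; first by case: (d u).
  rewrite (_ : 'D_v snd = cst v.2); first exact: polyfun2_cst.
  by apply/funext => u; case: (d u).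
- split=> [u|]; first exact: derivableD.
  rewrite (_ : 'D_v _ = 'D_v g + 'D_v h); first exact: polyfun2D.
  by apply/funext => u; exact: deriveD.
- split=> [u|]; first exact: derivableM.
  rewrite (_ : 'D_v _ = g * 'D_v h + h * 'D_v g); first by apply: polyfun2D; exact: polyfun2M.
  by apply/funext => u; exact: deriveM.
Qed.

Lemma polyfun2_bernstein n f : polyfun2 (bernstein n f).
Proof.
have pw i : polyfun2 (fun u => bweight n i u.1).
  rewrite (_ : (fun u => _) = cst 'C(n, i)%:R * ((cst 1 + fst) * cst 2^-1) ^+ i *
    ((cst 1 + cst (-1) * fst) * cst 2^-1) ^+ (n - i)); last first.
    by apply/funext => u; rewrite /bweight !fctE mulN1r -mulrA.
  apply: polyfun2M; [apply: polyfun2M; first exact: polyfun2_cst|]; apply: polyfun2X;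
    apply: polyfun2M; try exact: polyfun2_cst; apply: polyfun2D; try exact: polyfun2_cst.
    exact: polyfun2_fst.
  by apply: polyfun2M; [exact: polyfun2_cst|exact: polyfun2_fst].
have pw2 i : polyfun2 (fun u => bweight n i u.2).
  rewrite (_ : (fun u => _) = cst 'C(n, i)%:R * ((cst 1 + snd) * cst 2^-1) ^+ i *
    ((cst 1 + cst (-1) * snd) * cst 2^-1) ^+ (n - i)); last first.
    by apply/funext => u; rewrite /bweight !fctE mulN1r -mulrA.
  apply: polyfun2M; [apply: polyfun2M; first exact: polyfun2_cst|]; apply: polyfun2X;
    apply: polyfun2M; try exact: polyfun2_cst; apply: polyfun2D; try exact: polyfun2_cst.
    exact: polyfun2_snd.
  by apply: polyfun2M; [exact: polyfun2_cst|exact: polyfun2_snd].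
rewrite (_ : bernstein n f = \sum_(i < n.+1) \sum_(j < n.+1)
  (cst (f (bnode n i, bnode n j)) * ((fun u => bweight n i u.1) * (fun u => bweight n j u.2)))).
  by apply: polyfun2_sum => i; apply: polyfun2_sum => j;
    apply: polyfun2M; [exact: polyfun2_cst|exact: polyfun2M].
apply/funext => u; rewrite /bernstein fct_sumE; apply: eq_bigr => i _.
by rewrite fct_sumE; apply: eq_bigr => j _.
Qed.

Lemma polyfun2_row_smooth m (phi : R * R -> 'rV[R]_m.+1) :
  (forall i, polyfun2 (fun u => phi u 0 i)) -> smooth_on setT phi.
Proof.
move=> + k; elim: k phi => [|k IH] phi pphi /=.
  by split=> // u _; apply: cvg_row => i; exact: polyfun2_continuous.
split=> [u _|].
  by apply: cvg_row => i; exact: polyfun2_continuous.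
move=> v; split=> [u _|].
  by apply/derivable_mxP => i j; rewrite ord1; case: (polyfun2_derive v (pphi j)).
apply: IH => i.
rewrite (_ : (fun u => _) = 'D_v (fun u => phi u 0 i)).
  by case: (polyfun2_derive v (pphi i)).
apply/funext => u; rewrite derive_mx ?mxE//.
by apply/derivable_mxP => k' j; rewrite ord1; case: (polyfun2_derive v (pphi j)).
Qed.

End polyfun2_theory.

(** * Lipschitz maps are Sobolev maps *)

Lemma is_derive_pair1 (R : realType) (f : R * R -> R) (u : R * R) (d : R) :
  is_derive u.1 1 (fun x => f (x, u.2)) d -> is_derive u (1, 0) f d.
Proof.
move=> [df dE]; apply: cvg_is_derive; rewrite -dE.
apply: cvg_trans (df : _ --> _); apply: near_eq_cvg; near=> h => /=.
rewrite (_ : h *: (1, 0) + u = (h *: 1 + u.1, u.2)) -?surjective_pairing//.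
by case: u {df dE} => x y; congr (_, _); rewrite /= scaler0 add0r.
Unshelve. all: by end_near. Qed.

Lemma is_derive_pair2 (R : realType) (f : R * R -> R) (u : R * R) (d : R) :
  is_derive u.2 1 (fun y => f (u.1, y)) d -> is_derive u (0, 1) f d.
Proof.
move=> [df dE]; apply: cvg_is_derive; rewrite -dE.
apply: cvg_trans (df : _ --> _); apply: near_eq_cvg; near=> h => /=.
rewrite (_ : h *: (0, 1) + u = (u.1, h *: 1 + u.2)) -?surjective_pairing//.
by case: u {df dE} => x y; congr (_, _); rewrite /= scaler0 add0r.
Unshelve. all: by end_near. Qed.

Lemma is_derive_pair1P (R : realType) (f : R * R -> R) (u : R * R) :
  derivable f u (1, 0) -> is_derive u.1 1 (fun x => f (x, u.2)) ('D_(1, 0) f u).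
Proof.
move=> df; apply: cvg_is_derive.
apply: cvg_trans (df : _ --> _); apply: near_eq_cvg; near=> h => /=.
rewrite (_ : h *: (1, 0) + u = (h *: 1 + u.1, u.2)) -?surjective_pairing//.
by case: u {df} => x y; congr (_, _); rewrite /= scaler0 add0r.
Unshelve. all: by end_near. Qed.

Lemma is_derive_pair2P (R : realType) (f : R * R -> R) (u : R * R) :
  derivable f u (0, 1) -> is_derive u.2 1 (fun y => f (u.1, y)) ('D_(0, 1) f u).
Proof.
move=> df; apply: cvg_is_derive.
apply: cvg_trans (df : _ --> _); apply: near_eq_cvg; near=> h => /=.
rewrite (_ : h *: (0, 1) + u = (u.1, h *: 1 + u.2)) -?surjective_pairing//.
by case: u {df} => x y; congr (_, _); rewrite /= scaler0 add0r.
Unshelve. all: by end_near. Qed.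

Lemma is_derive_bernstein1 (R : realType) n (f : R * R -> R) (u : R * R) :
  (0 < n)%N -> -1 < u.1 < 1 ->
  is_derive u (1, 0) (bernstein n f) (bernstein_d1 n f u).
Proof.
move=> n0 u1; apply: is_derive_pair1.
pose H (i j : 'I_n.+1) := (f (bnode n i, bnode n j) * bweight n j u.2) *: bweight n i.
rewrite (_ : (fun x => _) = \sum_(i < n.+1) \sum_(j < n.+1) H i j); last first.
  apply/funext => x; rewrite /bernstein fct_sumE; apply: eq_bigr => i _.
  by rewrite fct_sumE; apply: eq_bigr => j _; rewrite /H /= [RHS]mulrAC mulrA.
have dw (i : 'I_n.+1) := is_derive_bweight (leq_ord i) n0 u1.
apply: (is_derive_eq (is_derive_sum (fun i : 'I_n.+1 => is_derive_sum
  (fun j : 'I_n.+1 => is_deriveZ (f (bnode n i, bnode n j) * bweight n j u.2) (dw i))))).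
apply: eq_bigr => i _; apply: eq_bigr => j _; rewrite /GRing.scale /=; ring.
Qed.

Lemma is_derive_bernstein2 (R : realType) n (f : R * R -> R) (u : R * R) :
  (0 < n)%N -> -1 < u.2 < 1 ->
  is_derive u (0, 1) (bernstein n f) (bernstein_d2 n f u).
Proof.
move=> n0 u2; apply: is_derive_pair2.
have := is_derive_pair1P (u := (u.2, u.1)) (f := bernstein n (fun p => f (p.2, p.1))).
have d := @is_derive_bernstein1 R n (fun p => f (p.2, p.1)) (u.2, u.1) n0 u2.
case: (d) => dd dE /(_ dd); rewrite dE /=.
rewrite (_ : (fun x => bernstein n _ (x, u.1)) = (fun y => bernstein n f (u.1, y)))//.
by apply/funext => x; rewrite bernsteinC.
Qed.

Section disc.
Context {R : realType}.
Notation mT := (measurableTypeR R * measurableTypeR R)%type.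

Lemma open_disc : open (disc R).
Proof.
rewrite (_ : disc R = (fun u : R * R => u.1 ^+ 2 + u.2 ^+ 2) @^-1` `]-oo, 1[%classic); last first.
  by apply/seteqP; split => u /=; rewrite in_itv.
apply: open_comp => [u _|]; last exact: interval_open.
by apply: cvgD; apply: cvgM; (exact: cvg_fst || exact: cvg_snd).
Qed.

Lemma measurable_disc : measurable (disc R : set mT).
Proof. by apply: open_measurable2; exact: open_disc. Qed.

Lemma disc_lt1 (u : R * R) : disc R u -> -1 < u.1 < 1 /\ -1 < u.2 < 1.
Proof.
rewrite /disc /= => u1; have := sqr_ge0 u.1; have := sqr_ge0 u.2.
by split; apply/andP; split; nra.
Qed.

Lemma disc_le1 (u : R * R) : disc R u -> -1 <= u.1 <= 1 /\ -1 <= u.2 <= 1.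
Proof. by case/disc_lt1 => /andP[? ?] /andP[? ?]; split; apply/andP; split; exact: ltW. Qed.

Lemma leb2_disc_fin : (leb2 R (disc R) < +oo)%E.
Proof.
apply: (@le_lt_trans _ _ (leb2 R (`[-1, 1]%classic `*` `[-1, 1]%classic : set mT))).
  apply: le_measure; rewrite ?inE; [exact: measurable_disc|by apply: measurableX; exact: measurable_itv|].
  by move=> u /disc_le1[? ?]; split; rewrite /= in_itv.
have -> : leb2 R (`[-1, 1]%classic `*` `[-1, 1]%classic : set mT) =
    (lebesgue_measure (`[(-1)%R, 1%R]%classic : set R) *
     lebesgue_measure (`[(-1)%R, 1%R]%classic : set R))%E.
  by apply: product_measure1E; exact: measurable_itv.
rewrite /= lebesgue_measure_itv /= lte_fin; case: ifP => _; last by rewrite mule0 ltry.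
by rewrite -EFinB -EFinM ltry.
Qed.

Lemma continuous_bounded_square (f : R * R -> R) : continuous f ->
  exists M : R, forall u : R * R, -1 <= u.1 <= 1 -> -1 <= u.2 <= 1 -> `|f u| <= M.
Proof.
move=> cf; pose Q := `[-1, 1]%classic `*` `[-1, 1]%classic : set (R * R).
have cQ : compact Q by apply: compact_setX; exact: segment_compact.
have /compact_bounded[M [Mr fM]] : compact (f @` Q).
  by apply: continuous_compact => //; exact: continuous_subspaceT.
exists (M + 1) => u u1 u2; apply: (fM (M + 1)); first by rewrite ltrDl.
by exists u => //; split; rewrite /= in_itv.
Qed.

Lemma disc_bounded_integrable (f : R * R -> R) (M : R) :
  measurable_fun (disc R : set mT) f -> (forall u, disc R u -> `|f u| <= M) ->
  (leb2 R).-integrable (disc R) (EFin \o f).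
Proof.
move=> mf fM; apply: (bounded_integrable (M := M)) => //; first exact: measurable_disc.
exact: leb2_disc_fin.
Qed.

Lemma integral_derive_support (g dg : R -> R) : continuous dg ->
  (forall x : R, is_derive x 1 g (dg x)) -> (forall x, ~ (-1 <= x <= 1) -> dg x = 0) ->
  g (-1) = 0 -> g 1 = 0 -> (\int[lebesgue_measure]_x (dg x)%:E = 0)%E.
Proof.
move=> cdg gdg out gN1 g1.
have cg : continuous g.
  by move=> x; apply/differentiable_continuous/derivable1_diffP; case: (gdg x).
transitivity (\int[lebesgue_measure]_(x in `[(-1)%R, 1%R]) (dg x)%:E)%E.
  rewrite [RHS]integral_mkcond; apply: eq_integral => x _.
  rewrite patchE; case: ifPn => // /negP x1; rewrite out// => x1'; apply: x1.
  by rewrite inE /= in_itv.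
rewrite (@continuous_FTC2 _ dg g).
- by rewrite g1 gN1 subee.
- by lra.
- exact: continuous_subspaceT.
- split=> [x _||].
  + by case: (gdg x).
  + by apply: cvg_at_right_filter; exact: cg.
  + by apply: cvg_at_left_filter; exact: cg.
- by move=> x _; rewrite derive1E; case: (gdg x).
Qed.

(** Both functions vanish off the disc, so the integral extends to the plane. By Fubini it is taken
    along lines parallel to [e], on each of which it is a difference of values of [f] at two points
    outside the open disc. *)
Lemma integral_derive_disc (e : R * R) (f df : R * R -> R) : e = (1, 0) \/ e = (0, 1) ->
  continuous df -> (forall u : R * R, is_derive u e f (df u)) ->
  (forall u, ~ disc R u -> f u = 0 /\ df u = 0) ->
  \int[leb2 R]_(u in disc R) df u = 0.
Proof.
move=> e12 cdf fdf f0.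
have [M fM] := continuous_bounded_square cdf.
have idf : (leb2 R).-integrable (disc R) (EFin \o df).
  apply: (disc_bounded_integrable (M := M)).
    by apply: measurable_funTS; exact: continuous_measurable2.
  by move=> u /disc_le1[u1 u2]; exact: fM.
have dfE : df \_ (disc R) = df.
  apply/funext => u; rewrite patchE; case: ifPn => // /negP uB.
  by have [] := f0 u; rewrite ?inE// => h; apply: uB; rewrite inE.
have idfT : (leb2 R).-integrable setT (EFin \o df).
  rewrite -dfE -restrict_EFin.
  exact/(integrable_mkcond _ measurable_disc).
rewrite /Rintegral; have -> : (\int[leb2 R]_(u in disc R) (df u)%:E =
    \int[leb2 R]_u (df u)%:E)%E.
  by rewrite integral_mkcond restrict_EFin dfE.
rewrite -[RHS]/(fine 0%E); congr fine.
case: e12 => ee; rewrite ee in fdf.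
  rewrite -(integral21_prod_meas1 idfT); apply: integral0_eq => y _ /=.
  apply: (@integral_derive_support (fun x => f (x, y)) (fun x => df (x, y))).
  - move=> x; apply: (@continuous_comp _ _ _ (fun x => (x, y)) df); last exact: cdf.
    exact: continuous_pairl.
  - move=> x; have := is_derive_pair1P (u := (x, y)) (f := f); rewrite /=.
    by case: (fdf (x, y)) => dd -> /(_ dd).
  - by move=> x x1; apply: (f0 _ _).2 => /disc_le1[].
  - by apply: (f0 _ _).1; rewrite /disc /=; have := sqr_ge0 y; lra.
  - by apply: (f0 _ _).1; rewrite /disc /=; have := sqr_ge0 y; lra.
rewrite -(integral12_prod_meas1 idfT); apply: integral0_eq => x _ /=.
apply: (@integral_derive_support (fun y => f (x, y)) (fun y => df (x, y))).
- move=> y; apply: (@continuous_comp _ _ _ (fun y => (x, y)) df); last exact: cdf.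
  exact: continuous_pairr.
- move=> y; have := is_derive_pair2P (u := (x, y)) (f := f); rewrite /=.
  by case: (fdf (x, y)) => dd -> /(_ dd).
- by move=> y y1; apply: (f0 _ _).2 => /disc_le1[].
- by apply: (f0 _ _).1; rewrite /disc /=; have := sqr_ge0 x; lra.
- by apply: (f0 _ _).1; rewrite /disc /=; have := sqr_ge0 x; lra.
Qed.

Lemma test_function_C1 (phi : R * R -> R) (e : R * R) : test_function phi ->
  [/\ continuous phi, continuous ('D_e phi), forall u, derivable phi u e &
   forall u, ~ disc R u -> phi u = 0 /\ 'D_e phi u = 0].
Proof.
move=> [sphi _ supp].
have [cphi /(_ e) [dphi [cdphi _]]] := sphi 1%N.
split.
- by move=> u; exact: cphi.
- by move=> u; exact: cdphi.
- by move=> u; exact: dphi.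
move=> u uB; have uc : ~ closure [set u | phi u != 0] u by move=> /supp.
split.
  by apply/eqP; apply: contrapT => /negP phiu; apply/uc/subset_closure.
rewrite -(@derive_cst _ _ _ (0 : R) u e); apply: near_eq_derive.
have : nbhs u (~` closure [set u | phi u != 0]).
  by apply: open_nbhs_nbhs; split=> //; apply: closed_openC; exact: closed_closure.
apply: filterS => v vc; apply/eqP; apply: contrapT => /negP phiv.
by apply/vc/subset_closure.
Qed.

(** Integration by parts holds for the smooth approximations. Bounds uniform in [n] carry both sides
    to the limit by dominated convergence, so the gradients need only converge almost everywhere. *)
Lemma weak_derivative_limit (e : R * R) (p dp : nat -> R * R -> R) (f D : R * R -> R) (M : R) :
  e = (1, 0) \/ e = (0, 1) -> (forall n, polyfun2 (p n)) ->
  (forall n u, disc R u -> is_derive u e (p n) (dp n u)) ->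
  (forall n u, disc R u -> `|p n u| <= M) -> (forall n u, disc R u -> `|dp n u| <= M) ->
  (forall u, disc R u -> p n u @[n --> \oo] --> f u) ->
  {ae leb2 R, forall u, disc R u -> dp n u @[n --> \oo] --> D u} ->
  measurable_fun (disc R : set mT) f -> measurable_fun (disc R : set mT) D ->
  weak_derivative e f D.
Proof.
move=> e12 pp dpE pM dpM pf dpD mf mD phi /(test_function_C1 e)[cphi cdphi dphi phi0].
have [Mphi phiM] := continuous_bounded_square cphi.
have [Mdphi dphiM] := continuous_bounded_square cdphi.
pose q n := 'D_e (p n).
have dpq n u : derivable (p n) u e by exact: (polyfun2_derive e (pp n)).1.
have cp n : continuous (p n) by exact: polyfun2_continuous.
have cq n : continuous (q n) by apply: polyfun2_continuous; exact: (polyfun2_derive e (pp n)).2.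
have qE n u : disc R u -> q n u = dp n u by move=> /(dpE n)[].
have mc (g : R * R -> R) : continuous g -> measurable_fun (disc R : set mT) g.
  by move=> cg; apply: measurable_funTS; exact: continuous_measurable2.
have M0 : 0 <= M.
  by apply: le_trans (pM 0%N (0, 0) _); rewrite // /disc /= expr0n addr0.
have bM (a b A B : R) : `|a| <= A -> `|b| <= B -> `|a * b| <= A * B.
  by move=> aA bB; rewrite normrM ler_pM.
have ibp n : \int[leb2 R]_(u in disc R) (p n u * 'D_e phi u) =
    - \int[leb2 R]_(u in disc R) (q n u * phi u).
  apply/eqP; rewrite -subr_eq0 opprK; apply/eqP.
  rewrite -RintegralD; last 3 first.
  - exact: measurable_disc.
  - apply: (disc_bounded_integrable (M := M * Mdphi)).
      by apply: measurable_funM; exact: mc.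
    by move=> u Bu; apply: bM; [exact: pM|have [? ?] := disc_le1 Bu; exact: dphiM].
  - apply: (disc_bounded_integrable (M := M * Mphi)).
      by apply: measurable_funM; exact: mc.
    by move=> u Bu; rewrite qE//; apply: bM; [exact: dpM|have [? ?] := disc_le1 Bu; exact: phiM].
  apply: (integral_derive_disc (f := p n * phi) e12).
  - by move=> u; apply: cvgD; apply: cvgM; [exact: cp|exact: cdphi|exact: cq|exact: cphi].
  - move=> u.
    have d1 : is_derive u e (p n) (q n u) by exact: DeriveDef.
    have d2 : is_derive u e phi ('D_e phi u) by exact: DeriveDef.
    by apply: is_derive_eq; rewrite /GRing.scale /= (mulrC (phi u)).
  - by move=> u /phi0[p0 dp0]; rewrite fctE p0 dp0 !mulr0 addr0.
have lim1 : \int[leb2 R]_(u in disc R) (p n u * 'D_e phi u) @[n --> \oo] -->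
    \int[leb2 R]_(u in disc R) (f u * 'D_e phi u).
  apply: (dominated_Rintegral_cvg (M := M * Mdphi)).
  - exact: measurable_disc.
  - exact: leb2_disc_fin.
  - by move=> n; apply: measurable_funM; exact: mc.
  - by apply: measurable_funM => //; exact: mc.
  - by apply: aeW => u Bu; apply: cvgMl; exact: pf.
  - by move=> n u Bu; apply: bM; [exact: pM|have [? ?] := disc_le1 Bu; exact: dphiM].
have lim2 : \int[leb2 R]_(u in disc R) (q n u * phi u) @[n --> \oo] -->
    \int[leb2 R]_(u in disc R) (D u * phi u).
  apply: (dominated_Rintegral_cvg (M := M * Mphi)).
  - exact: measurable_disc.
  - exact: leb2_disc_fin.
  - by move=> n; apply: measurable_funM; exact: mc.
  - by apply: measurable_funM => //; exact: mc.
  - move: dpD; apply: filterS; first exact: (ae_filter_ringOfSetsType (leb2 R)).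
    move=> u h Bu; apply: cvgMl.
    rewrite (_ : (fun n => q n u) = (fun n => dp n u)); first exact: h.
    by apply/funext => n; exact: qE.
  - by move=> n u Bu; rewrite qE//; apply: bM; [exact: dpM|have [? ?] := disc_le1 Bu; exact: phiM].
apply: (cvg_unique _ lim1); first exact: Rhausdorff.
by rewrite (funext ibp); exact: cvgN.
Qed.

End disc.

Lemma lipschitz1_continuous (R : realType) (f : R * R -> R) (L : R) :
  (forall u v, `|f u - f v| <= L * (`|u.1 - v.1| + `|u.2 - v.2|)) -> continuous f.
Proof.
move=> fL; apply: (@lipschitz_continuous R (R * R)%type f (2 * `|L|)) => u v.
rewrite (le_trans (fL u v))// (@le_trans _ _ (`|L| * (`|u.1 - v.1| + `|u.2 - v.2|)))//.
  by rewrite ler_wpM2r ?ler_norm// addr_ge0.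
rewrite [2 * `|L|]mulrC -mulrA ler_wpM2l//.
have -> : `|u - v| = Num.max `|u.1 - v.1| `|u.2 - v.2| by [].
have [?|?] := leP `|u.1 - v.1| `|u.2 - v.2|; lra.
Qed.

Lemma enorm_sqr (R : realType) n (x : 'rV[R]_n) : enorm x ^+ 2 = \sum_(i < n) x 0 i ^+ 2.
Proof.
rewrite /enorm /dotp sqr_sqrtr; last by apply: sumr_ge0 => i _; rewrite -expr2 sqr_ge0.
by apply: eq_bigr => i _; rewrite expr2.
Qed.

Lemma cvg_sum (R : realType) (I T : Type) (F : set_system T) (FF : Filter F) (r : seq I)
    (f : I -> T -> R) (a : I -> R) :
  (forall i, f i x @[x --> F] --> a i) -> \sum_(i <- r) f i x @[x --> F] --> \sum_(i <- r) a i.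
Proof. by move=> fa; apply: cvg_big => //; exact: add_continuous. Qed.

Lemma enorm_row_sqr3 (R : realType) n (a b c a' b' c' : 'I_n -> R) :
  enorm (\row_i a i - \row_i a' i) ^+ 2 + enorm (\row_i b i - \row_i b' i) ^+ 2 +
    enorm (\row_i c i - \row_i c' i) ^+ 2 =
  \sum_(i < n) ((a i - a' i) ^+ 2 + (b i - b' i) ^+ 2 + (c i - c' i) ^+ 2).
Proof.
by rewrite !big_split !enorm_sqr; congr (_ + _ + _); apply: eq_bigr => i _; rewrite !mxE.
Qed.

Section W12_of_lipschitz.
Context {R : realType}.
Notation mT := (measurableTypeR R * measurableTypeR R)%type.
Variables (f D1 D2 : 'I_3 -> R * R -> R) (L M : R).
Hypothesis fL : forall i u v, `|f i u - f i v| <= L * (`|u.1 - v.1| + `|u.2 - v.2|).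
Hypothesis mD1 : forall i, measurable_fun (disc R : set mT) (D1 i).
Hypothesis mD2 : forall i, measurable_fun (disc R : set mT) (D2 i).
Hypothesis D1M : forall i u, `|D1 i u| <= M.
Hypothesis D2M : forall i u, `|D2 i u| <= M.
Hypothesis fD : {ae leb2 R, forall u, disc R u -> forall i (e : R), 0 < e ->
  \forall v \near u, `|f i v - f i u - (D1 i u * (v.1 - u.1) + D2 i u * (v.2 - u.2))| <=
       e * (`|v.1 - u.1| + `|v.2 - u.2|)}.

Let p i n := bernstein n.+1 (f i).

Let cf i : continuous (f i). Proof. exact: lipschitz1_continuous (@fL i). Qed.

Let L0 : 0 <= L.
Proof.
have := le_trans (normr_ge0 _) (fL ord0 (1, 0) (0, 0)).
by rewrite /= subr0 subrr normr1 normr0 addr0 mulr1.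
Qed.

Let p_close i n u : -1 <= u.1 <= 1 -> -1 <= u.2 <= 1 -> `|p i n u - f i u| <= 4 * L.
Proof.
(* With [d = 1] the general estimate is [2 L (1 + 1 / n)], whence [4 L]. *)
move=> u1 u2; have := bernstein_dist (@fL i) (ltn0Sn n) u1 u2 (@ltr01 R).
rewrite invr1 mul1r => /le_trans; apply.
have : n.+1%:R^-1 <= 1 :> R by rewrite invf_le1// ler1n.
by move: (n.+1%:R^-1) => t /(ler_wpM2l L0); lra.
Qed.

Let fswapL i u v : `|(fun p => f i (p.2, p.1)) u - (fun p => f i (p.2, p.1)) v| <=
  L * (`|u.1 - v.1| + `|u.2 - v.2|).
Proof. by rewrite (le_trans (fL _ _ _))//= addrC. Qed.

Let dp1_le i n u : disc R u -> `|bernstein_d1 n.+1 (f i) u| <= L.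
Proof. by move=> Bu; apply: bernstein_d1_le => //; [exact: (disc_lt1 Bu).1|exact: (disc_le1 Bu).2]. Qed.

Let dp2_le i n u : disc R u -> `|bernstein_d2 n.+1 (f i) u| <= L.
Proof.
move=> Bu; apply: (bernstein_d1_le (@fswapL i)) => //=;
  [exact: (disc_lt1 Bu).2|exact: (disc_le1 Bu).1].
Qed.

Let dp1_cvg : {ae leb2 R, forall u, disc R u -> forall i,
  bernstein_d1 n.+1 (f i) u @[n --> \oo] --> D1 i u}.
Proof.
move: fD; apply: filterS; first exact: (ae_filter_ringOfSetsType (leb2 R)).
move=> u h Bu i; apply: (bernstein_d1_cvg (@fL i) (l2 := D2 i u)).
- exact: (disc_lt1 Bu).1.
- exact: (disc_lt1 Bu).2.
- exact: h.
Qed.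

Let dp2_cvg : {ae leb2 R, forall u, disc R u -> forall i,
  bernstein_d2 n.+1 (f i) u @[n --> \oo] --> D2 i u}.
Proof.
move: fD; apply: filterS; first exact: (ae_filter_ringOfSetsType (leb2 R)).
move=> u h Bu i; apply: (bernstein_d1_cvg (@fswapL i) (l2 := D1 i u)) => /=.
- exact: (disc_lt1 Bu).2.
- exact: (disc_lt1 Bu).1.
move=> e e0; have /nbhs_ballP[d d0 hd] := h Bu i e e0.
apply/nbhs_ballP; exists d => // v [v1 v2].
have := hd (v.2, v.1) (conj v2 v1); rewrite /= -surjective_pairing.
by rewrite [D1 i u * _ + _]addrC [`|v.2 - _| + _]addrC.
Qed.

Let Bd : exists K, forall i n u, -1 <= u.1 <= 1 -> -1 <= u.2 <= 1 ->
  [/\ `|f i u| <= K, `|p i n u| <= K & L <= K].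
Proof.
have [K0 h0] := continuous_bounded_square (@cf 0).
have [K1 h1] := continuous_bounded_square (@cf 1).
have [K2 h2] := continuous_bounded_square (@cf 2).
exists (`|K0| + `|K1| + `|K2| + 4 * L + L) => i n u u1 u2.
have fK : `|f i u| <= `|K0| + `|K1| + `|K2|.
  have a0 := normr_ge0 K0; have a1 := normr_ge0 K1; have a2 := normr_ge0 K2.
  case: i => -[|[|[|//]]] i3.
  - rewrite (_ : Ordinal i3 = 0); last exact: val_inj.
    by have := le_trans (h0 u u1 u2) (ler_norm _); lra.
  - rewrite (_ : Ordinal i3 = 1); last exact: val_inj.
    by have := le_trans (h1 u u1 u2) (ler_norm _); lra.
  - rewrite (_ : Ordinal i3 = 2); last exact: val_inj.
    by have := le_trans (h2 u u1 u2) (ler_norm _); lra.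
have := p_close i n u1 u2; have := L0.
have := ler_normD (p i n u - f i u) (f i u); rewrite subrK.
have := normr_ge0 K0; have := normr_ge0 K1; have := normr_ge0 K2.
by split; lra.
Qed.

Let mf i : measurable_fun (disc R : set mT) (f i).
Proof. by apply: measurable_funTS; exact: continuous_measurable2. Qed.

Let L2_bounded (g : R * R -> R) K : measurable_fun (disc R : set mT) g ->
  (forall u, disc R u -> `|g u| <= K) -> L2_disc g.
Proof.
move=> mg gK; split => //.
have : (leb2 R).-integrable (disc R) (EFin \o (fun u => g u ^+ 2)).
  apply: (disc_bounded_integrable (M := K ^+ 2)); first exact: measurable_funX.
  move=> u Bu; have gu := gK u Bu.
  by rewrite normrX lerXn2r ?nnegrE//; exact: le_trans gu.
by move=> /(integrable_lty measurable_disc).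
Qed.

Let wd1 i : weak_derivative (1, 0) (f i) (D1 i).
Proof.
have [K hK] := Bd.
apply: (@weak_derivative_limit R _ (p i) (fun n => bernstein_d1 n.+1 (f i)) _ _ K) => //.
- by left.
- by move=> n; exact: polyfun2_bernstein.
- by move=> n u Bu; apply: is_derive_bernstein1 => //; exact: (disc_lt1 Bu).1.
- by move=> n u Bu; have [? ?] := disc_le1 Bu; case: (hK i n u).
- move=> n u Bu; have [? ?] := disc_le1 Bu; apply: (le_trans (dp1_le i n Bu)).
  by case: (hK i n u).
- move=> u Bu; have [? ?] := disc_le1 Bu; exact: (bernstein_cvg (@fL i)).
- move: dp1_cvg; apply: filterS; first exact: (ae_filter_ringOfSetsType (leb2 R)).
  by move=> u h Bu; exact: h.
Qed.

Let wd2 i : weak_derivative (0, 1) (f i) (D2 i).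
Proof.
have [K hK] := Bd.
apply: (@weak_derivative_limit R _ (p i) (fun n => bernstein_d2 n.+1 (f i)) _ _ K) => //.
- by right.
- by move=> n; exact: polyfun2_bernstein.
- by move=> n u Bu; apply: is_derive_bernstein2 => //; exact: (disc_lt1 Bu).2.
- by move=> n u Bu; have [? ?] := disc_le1 Bu; case: (hK i n u).
- move=> n u Bu; have [? ?] := disc_le1 Bu; apply: (le_trans (dp2_le i n Bu)).
  by case: (hK i n u).
- move=> u Bu; have [? ?] := disc_le1 Bu; exact: (bernstein_cvg (@fL i)).
- move: dp2_cvg; apply: filterS; first exact: (ae_filter_ringOfSetsType (leb2 R)).
  by move=> u h Bu; exact: h.
Qed.

Let rowE (g : 'I_3 -> R * R -> R) i : (fun u => (\row_j g j u : 'rV[R]_3) 0 i) = g i.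
Proof. by apply/funext => u; rewrite mxE. Qed.

(** The same Bernstein polynomials yield the weak derivatives, the approximation in [W^{1,2}] and
    the trace, each time by dominated convergence. Differentiability almost everywhere is the
    hypothesis [fD], verified by hand for cones. *)
Lemma W12_of_lipschitz : exists X : W12 R,
  [/\ W12_fun X = (fun u => \row_i f i u), W12_d1 X = (fun u => \row_i D1 i u),
      W12_d2 X = (fun u => \row_i D2 i u) &
      is_trace X (fun t => \row_i f i (cos t, sin t))].
Proof.
have h1 i : L2_disc (fun u => (\row_j f j u : 'rV[R]_3) 0 i).
  rewrite rowE; have [K hK] := Bd; apply: (@L2_bounded _ K) => // u Bu.
  by have [? ?] := disc_le1 Bu; case: (hK i 0%N u).
have h2 i : L2_disc (fun u => (\row_j D1 j u : 'rV[R]_3) 0 i).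
  by rewrite rowE; exact: (@L2_bounded _ M).
have h3 i : L2_disc (fun u => (\row_j D2 j u : 'rV[R]_3) 0 i).
  by rewrite rowE; exact: (@L2_bounded _ M).
have h4 i : weak_derivative (1, 0) (fun u => (\row_j f j u : 'rV[R]_3) 0 i)
    (fun u => (\row_j D1 j u : 'rV[R]_3) 0 i) by rewrite !rowE.
have h5 i : weak_derivative (0, 1) (fun u => (\row_j f j u : 'rV[R]_3) 0 i)
    (fun u => (\row_j D2 j u : 'rV[R]_3) 0 i) by rewrite !rowE.
have [X [XE X1 X2]] : exists X : W12 R, [/\ W12_fun X = (fun u => \row_i f i u),
    W12_d1 X = (fun u => \row_i D1 i u) & W12_d2 X = (fun u => \row_i D2 i u)].
  by exists (MkW12 h1 h2 h3 h4 h5).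
exists X; split => //.
pose phi n u : 'rV[R]_3 := \row_i p i n u.
have pp i n : polyfun2 (p i n) by exact: polyfun2_bernstein.
have phiE i n : (fun u => phi n u 0 i) = p i n by apply/funext => u; rewrite mxE.
have dphi e n u : 'D_e (phi n) u = \row_i 'D_e (p i n) u.
  rewrite derive_mx; first by apply/rowP => i; rewrite !mxE phiE.
  by apply/derivable_mxP => i j; rewrite ord1 phiE; exact: (polyfun2_derive e (pp j n)).1.
have [K hK] := Bd.
have K0 : 0 <= K by case: (hK 0 0%N (0, 0)) => /=; try lra; move=> _ _; exact: le_trans.
exists phi; split.
- by move=> n; apply: polyfun2_row_smooth => i; rewrite phiE.
- pose g n u : R := \sum_(i < 3) ((f i u - p i n u) ^+ 2 + (D1 i u - 'D_(1, 0) (p i n) u) ^+ 2 +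
    (D2 i u - 'D_(0, 1) (p i n) u) ^+ 2).
  have gE n : W12_dist2 X (phi n) =
      (\int[leb2 R]_(u in disc R) (g n u)%:E)%E.
    rewrite /W12_dist2 XE X1 X2; apply: eq_integral => u _.
    by congr EFin; rewrite 2!dphi; exact: enorm_row_sqr3.
  rewrite (funext gE).
  have [] := @dominated_integral_cvg _ _ _ (leb2 R) (disc R) g (cst 0)
    (3 * ((2 * K) ^+ 2 + (M + K) ^+ 2 + (M + K) ^+ 2)) measurable_disc leb2_disc_fin.
  + move=> n; apply: measurable_sum => i.
    have mp : measurable_fun (disc R : set mT) (p i n).
      by apply: measurable_funTS; apply: continuous_measurable2; exact: polyfun2_continuous.
    have mdp e : measurable_fun (disc R : set mT) ('D_e (p i n)).
      apply: measurable_funTS; apply: continuous_measurable2; apply: polyfun2_continuous.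
      exact: (polyfun2_derive e (pp i n)).2.
    by apply: measurable_funD; [apply: measurable_funD|]; apply: measurable_funX;
      exact: measurable_funB.
  + exact: measurable_cst.
  + apply: (@filterS2 _ _ (ae_filter_ringOfSetsType (leb2 R)) _ _ _ _ dp2_cvg dp1_cvg).
    move=> u d2 d1 Bu; have [u1 u2] := disc_le1 Bu.
    have lim0 (a : R) (b : R^nat) : b @ \oo --> a -> ((a - b n) ^+ 2) @[n --> \oo] --> (0 : R).
      move=> ba; rewrite [X in _ --> X](_ : 0 = (a - a) ^+ 2); last by rewrite subrr expr0n.
      by apply: cvgM; apply: cvgB => //; exact: cvg_cst.
    rewrite [X in _ --> X](_ : cst 0 u = \sum_(i < 3) (0 + 0 + 0)); last first.
      by rewrite big1// => i _; rewrite !addr0.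
    apply: cvg_sum => i; apply: cvgD; [apply: cvgD|]; apply: lim0.
    * exact: (bernstein_cvg (@fL i)).
    * rewrite (_ : (fun n => _) = (fun n => bernstein_d1 n.+1 (f i) u)); first exact: d1.
      apply/funext => n; have [_ ->] // := @is_derive_bernstein1 R n.+1 (f i) u (ltn0Sn n) (disc_lt1 Bu).1.
    * rewrite (_ : (fun n => _) = (fun n => bernstein_d2 n.+1 (f i) u)); first exact: d2.
      apply/funext => n; have [_ ->] // := @is_derive_bernstein2 R n.+1 (f i) u (ltn0Sn n) (disc_lt1 Bu).2.
  + move=> n u Bu; have [u1 u2] := disc_le1 Bu.
    rewrite ger0_norm; last by apply: sumr_ge0 => i _; rewrite !addr_ge0// sqr_ge0.
    have sq (a A : R) : `|a| <= A -> a ^+ 2 <= A ^+ 2.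
      move=> aA; rewrite -real_normK ?num_real// lerXn2r ?nnegrE//; exact: le_trans aA.
    rewrite (@le_trans _ _ (\sum_(i < 3) ((2 * K) ^+ 2 + (M + K) ^+ 2 + (M + K) ^+ 2)))//.
      apply: ler_sum => i _; have [fK pK LK] := hK i n u u1 u2.
      rewrite !lerD//; apply: sq; rewrite (le_trans (ler_normB _ _))//.
      * by rewrite mulr_natl mulr2n lerD.
      * rewrite lerD//; have [_ ->] := @is_derive_bernstein1 R n.+1 (f i) u (ltn0Sn n) (disc_lt1 Bu).1.
        by rewrite (le_trans _ LK)// dp1_le.
      * rewrite lerD//; have [_ ->] := @is_derive_bernstein2 R n.+1 (f i) u (ltn0Sn n) (disc_lt1 Bu).2.
        by rewrite (le_trans _ LK)// dp2_le.
    by rewrite sumr_const card_ord [leRHS]mulr_natl.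
  by move=> _; rewrite integral0_eq//; exact.
(* The circle lies in the closed square, where the Bernstein polynomials converge and stay within
   [4 L] of [f]. *)
pose g n (t : R) : R := \sum_(i < 3) (p i n (cos t, sin t) - f i (cos t, sin t)) ^+ 2.
have gE n : (\int[@lebesgue_measure R]_(t in `[0%R, (2 * pi)%R])
    (enorm (phi n (cos t, sin t) - \row_i f i (cos t, sin t)) ^+ 2)%:E)%E =
  (\int[lebesgue_measure]_(t in `[0%R, (2 * pi)%R]) (g n t)%:E)%E.
  apply: eq_integral => t _; congr EFin.
  by rewrite enorm_sqr; apply: eq_bigr => i _; rewrite !mxE.
rewrite (funext gE).
have cs1 (t : R) : -1 <= cos t <= 1 by rewrite cos_geN1 cos_le1.
have sn1 (t : R) : -1 <= sin t <= 1 by rewrite sin_geN1 sin_le1.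
have ccs : continuous (fun t : R => (cos t, sin t)).
  by move=> t; apply: (cvg_pair (F := nbhs t) (G := nbhs (cos t)) (H := nbhs (sin t)));
    [exact: continuous_cos|exact: continuous_sin].
have mcs (h : R * R -> R) : continuous h -> measurable_fun `[0%R, (2 * pi)%R] (fun t => h (cos t, sin t)).
  move=> ch; apply: measurable_funTS; apply: continuous_measurable_fun => t.
  by apply: (@continuous_comp _ _ _ (fun t : R => (cos t, sin t)) h); [exact: ccs|exact: ch].
have [] := @dominated_integral_cvg _ _ _ (@lebesgue_measure R) `[0%R, (2 * pi)%R]%classic g (cst 0)
    (3 * (4 * L) ^+ 2).
- exact: measurable_itv.
- by rewrite /= lebesgue_measure_itv/=; case: ifP; rewrite ?ltry// -EFinB ltry.
- move=> n; apply: measurable_sum => i; apply: measurable_funX; apply: measurable_funB; apply: mcs => //.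
  exact: polyfun2_continuous.
- exact: measurable_cst.
- apply: aeW => t _; have c1 := cs1 t; have s1 := sn1 t.
  rewrite [X in _ --> X](_ : cst 0 t = \sum_(i < 3) 0); last by rewrite big1.
  apply: cvg_sum => i; rewrite [X in _ --> X](_ : 0 = (f i (cos t, sin t) - f i (cos t, sin t)) ^+ 2).
    by apply: cvgM; (apply: cvgB; [exact: (bernstein_cvg (@fL i))|exact: cvg_cst]).
  by rewrite subrr expr0n.
- move=> n t _; rewrite ger0_norm; last by apply: sumr_ge0 => i _; rewrite sqr_ge0.
  rewrite (@le_trans _ _ (\sum_(i < 3) (4 * L) ^+ 2))//; last by rewrite sumr_const card_ord [leRHS]mulr_natl.
  apply: ler_sum => i _; rewrite -real_normK ?num_real// lerXn2r ?nnegrE ?mulr_ge0//.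
  by apply: p_close; [exact: cs1|exact: sn1].
by move=> _; rewrite integral0_eq//; exact.
Qed.

End W12_of_lipschitz.

(** * Polar coordinates and cones *)

Lemma periodic_int (R : realType) (f : R -> R) (T : R) : (forall t, f (t + T) = f t) ->
  forall (k : int) t, f (t + k%:~R * T) = f t.
Proof.
move=> fT k t; elim/int_ind: k => [|n IH|n IH]; first by rewrite mul0r addr0.
  by rewrite -[RHS]IH -[RHS]fT intS rmorphD /=; congr f; ring.
by rewrite -[RHS]IH -[LHS]fT intS opprD rmorphD rmorphN1 /=; congr f; ring.
Qed.

Definition rad (R : realType) (u : R * R) : R := Num.sqrt (u.1 ^+ 2 + u.2 ^+ 2).

(* The argument in [[0, 2 pi[]; off the first axis [atan] measures it from the second axis.
   At the origin the value is [0]. *)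
Definition ang (R : realType) (u : R * R) : R :=
  if 0 < u.2 then pi / 2 - atan (u.1 / u.2)
  else if u.2 < 0 then 3 * (pi / 2) - atan (u.1 / u.2)
  else if u.1 < 0 then pi else 0.

(** The positively homogeneous extension of degree one of a function on the circle; the vertex of
    the cone has been moved to the origin. *)
Definition cone (R : realType) (h : R -> R) (u : R * R) : R := rad u * h (ang u).

Section polar_coordinates.
Context {R : realType}.
Implicit Types u v : R * R.

Lemma rad_ge0 u : 0 <= rad u. Proof. exact: sqrtr_ge0. Qed.

Lemma polarE u : u.1 = rad u * cos (ang u) /\ u.2 = rad u * sin (ang u).
Proof.
case: u => x y; rewrite /ang /rad /=.
have atanE (z : R) : cos (atan z) = (Num.sqrt (1 + z ^+ 2))^-1 /\
    sin (atan z) = z * (Num.sqrt (1 + z ^+ 2))^-1.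
  split; first exact: cos_atan.
  rewrite -cos_atan -{2}(atanK z) /tan divfK//.
  by rewrite cos_atan invr_neq0// sqrtr_eq0 -ltNge ltr_pwDl// sqr_ge0.
have sq0 (z : R) : Num.sqrt (1 + z ^+ 2) != 0.
  by rewrite sqrtr_eq0 -ltNge ltr_pwDl// sqr_ge0.
have rE : y != 0 -> Num.sqrt (x ^+ 2 + y ^+ 2) = `|y| * Num.sqrt (1 + (x / y) ^+ 2).
  move=> y0; rewrite -sqrtr_sqr -sqrtrM ?sqr_ge0//; congr Num.sqrt; field.
  exact: y0.
have [cA sA] := atanE (x / y).
have cph (z : R) : cos (pi / 2 - z) = sin z /\ sin (pi / 2 - z) = cos z.
  rewrite -[pi / 2 - z]opprB cosN sinN cosBpihalf sinBpihalf opprK.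
  by [].
case: ltP => y0.
  rewrite rE ?gt_eqF// gtr0_norm//.
  have [-> ->] := cph (atan (x / y)); rewrite sA cA.
  by split; field; rewrite ?sq0 ?(gt_eqF y0).
case: ltP => y1.
  rewrite rE ?lt_eqF// ltr0_norm//.
  have -> : 3 * (pi / 2) - atan (x / y) = (pi / 2 - atan (x / y)) + pi by lra.
  rewrite cosDpi sinDpi; have [-> ->] := cph (atan (x / y)); rewrite sA cA.
  by split; field; rewrite ?sq0 ?(lt_eqF y1).
have -> : y = 0 by apply/le_anti; rewrite y0 y1.
rewrite expr0n /= addr0 sqrtr_sqr; case: ltP => x0.
  by rewrite cospi sinpi mulr0 mulrN1 ltr0_norm// opprK.
by rewrite cos0 sin0 mulr0 mulr1 ger0_norm.
Qed.

Lemma ang_itv u : 0 <= ang u < 2 * pi.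
Proof.
have pi0 := pi_gt0 R.
rewrite /ang; have := atan_gtNpi2 (u.1 / u.2); have := atan_ltpi2 (u.1 / u.2).
by move=> a1 a2; case: ifPn => _; [|case: ifPn => _; [|case: ifPn => _]]; lra.
Qed.

(** Both vectors are projected on the direction of [u]: the projection of [u] is [rad u], that of
    [v] is [rad v] times a cosine. *)
Lemma rad_lip u v : rad u - rad v <= `|u.1 - v.1| + `|u.2 - v.2|.
Proof.
have [u1 u2] := polarE u; have [v1 v2] := polarE v.
have c1 := cos_max (ang u); have s1 := sin_max (ang u).
have ru : rad u = u.1 * cos (ang u) + u.2 * sin (ang u).
  by rewrite {1}u1 {1}u2 -!mulrA -!expr2 -mulrDr cos2Dsin2 mulr1.
have rv : v.1 * cos (ang u) + v.2 * sin (ang u) <= rad v.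
  rewrite {1}v1 {1}v2 -!mulrA -mulrDr -cosB ler_piMr ?rad_ge0//; exact: cos_le1.
have : rad u - rad v <= (u.1 - v.1) * cos (ang u) + (u.2 - v.2) * sin (ang u) by lra.
move=> /le_trans; apply; apply: lerD; rewrite (le_trans (ler_norm _))// normrM.
  by rewrite ler_piMr.
by rewrite ler_piMr.
Qed.

Lemma rad_lipschitz u v : `|rad u - rad v| <= `|u.1 - v.1| + `|u.2 - v.2|.
Proof.
rewrite ler_norml rad_lip andbT lerNl opprB.
by rewrite (distrC u.1) (distrC u.2) rad_lip.
Qed.

(** The chord between two points of the unit circle has length [2 |sin ((a - b) / 2)|], so
    [sin_dist] controls the difference of the angles modulo [2 pi]. *)
Lemma chord_angle (a b : R) : exists k : int,
  `|a - b - k%:~R * (2 * pi)| <= 4 * (`|cos a - cos b| + `|sin a - sin b|).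
Proof.
have [k hk] := sin_dist ((a - b) / 2); exists k.
have -> : a - b - k%:~R * (2 * pi) = 2 * ((a - b) / 2 - k%:~R * pi) by field.
rewrite normrM gtr0_norm//.
suff : 2 * `|sin ((a - b) / 2)| <= `|cos a - cos b| + `|sin a - sin b| by lra.
rewrite -(@ler_pXn2r _ 2) ?nnegrE ?addr_ge0 ?mulr_ge0//.
rewrite exprMn real_normK ?num_real//.
have -> : 2 ^+ 2 * sin ((a - b) / 2) ^+ 2 = (cos a - cos b) ^+ 2 + (sin a - sin b) ^+ 2.
  have [c cE abE] : exists2 c, (a - b) / 2 = c & a - b = c *+ 2.
    by exists ((a - b) / 2) => //; rewrite -mulr_natr divfK.
  have := cosB a b; rewrite cE abE cos_mulr2n cos2sin2.
  by have := cos2Dsin2 a; have := cos2Dsin2 b; lra.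
rewrite -(real_normK (num_real (cos a - cos b))) -(real_normK (num_real (sin a - sin b))).
have := normr_ge0 (cos a - cos b); have := normr_ge0 (sin a - sin b); nra.
Qed.

(** The radius turns unit chords into differences of coordinates, up to a change of radius: [12] is
    the 4 of [chord_angle] times 3. A single [k] serves both radii because [cone_derive] uses the
    two bounds together. *)
Lemma ang_dist u v : exists k : int,
  rad u * `|ang v - ang u - k%:~R * (2 * pi)| <= 12 * (`|v.1 - u.1| + `|v.2 - u.2|) /\
  rad v * `|ang v - ang u - k%:~R * (2 * pi)| <= 12 * (`|v.1 - u.1| + `|v.2 - u.2|).
Proof.
have [k hk] := chord_angle (ang v) (ang u); exists k.
have [u1 u2] := polarE u; have [v1 v2] := polarE v.
have rl := rad_lipschitz v u.
have c1 := cos_max (ang v); have s1 := sin_max (ang v).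
have c2 := cos_max (ang u); have s2 := sin_max (ang u).
have nr (r x : R) : 0 <= r -> r * `|x| = `|r * x| by move=> r0; rewrite normrM ger0_norm.
split.
  rewrite (le_trans (ler_wpM2l (rad_ge0 u) hk))// mulrCA.
  have a1 : rad u * `|cos (ang v) - cos (ang u)| <= `|rad v - rad u| + `|v.1 - u.1|.
    rewrite nr ?rad_ge0//.
    have -> : rad u * (cos (ang v) - cos (ang u)) = - ((rad v - rad u) * cos (ang v)) + (v.1 - u.1).
      by rewrite {1}v1 {1}u1; ring.
    rewrite (le_trans (ler_normD _ _))// normrN normrM lerD2r; rewrite ler_piMr//.
  have a2 : rad u * `|sin (ang v) - sin (ang u)| <= `|rad v - rad u| + `|v.2 - u.2|.
    rewrite nr ?rad_ge0//.
    have -> : rad u * (sin (ang v) - sin (ang u)) = - ((rad v - rad u) * sin (ang v)) + (v.2 - u.2).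
      by rewrite {1}v2 {1}u2; ring.
    by rewrite (le_trans (ler_normD _ _))// normrN normrM lerD2r ler_piMr//.
  lra.
rewrite (le_trans (ler_wpM2l (rad_ge0 v) hk))// mulrCA.
have a1 : rad v * `|cos (ang v) - cos (ang u)| <= `|rad v - rad u| + `|v.1 - u.1|.
  rewrite nr ?rad_ge0//.
  have -> : rad v * (cos (ang v) - cos (ang u)) = - ((rad v - rad u) * cos (ang u)) + (v.1 - u.1).
    by rewrite {1}v1 {1}u1; ring.
  by rewrite (le_trans (ler_normD _ _))// normrN normrM lerD2r ler_piMr//.
have a2 : rad v * `|sin (ang v) - sin (ang u)| <= `|rad v - rad u| + `|v.2 - u.2|.
  rewrite nr ?rad_ge0//.
  have -> : rad v * (sin (ang v) - sin (ang u)) = - ((rad v - rad u) * sin (ang u)) + (v.2 - u.2).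
    by rewrite {1}v2 {1}u2; ring.
  by rewrite (le_trans (ler_normD _ _))// normrN normrM lerD2r ler_piMr//.
lra.
Qed.

Lemma angZ (t : R) : rad (cos t, sin t) = 1 /\ cos (ang (cos t, sin t)) = cos t /\
  sin (ang (cos t, sin t)) = sin t.
Proof.
have r1 : rad (cos t, sin t) = 1 by rewrite /rad /= cos2Dsin2 sqrtr1.
by have [] := polarE (cos t, sin t); rewrite r1 !mul1r /=.
Qed.

End polar_coordinates.

Section cone.
Context {R : realType}.
Variables (h : R -> R) (K H : R).
Hypothesis hK : forall x y, `|h x - h y| <= K * `|x - y|.
Hypothesis hp : forall t, h (t + 2 * pi) = h t.
Hypothesis hH : forall t, `|h t| <= H.
Implicit Types u v : R * R.

Let K0 : 0 <= K.
Proof. by have := le_trans (normr_ge0 _) (hK 1 0); rewrite subr0 normr1 mulr1. Qed.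

Lemma cone_circle (t : R) : cone h (cos t, sin t) = h t.
Proof.
have [r1 [c1 s1]] := angZ t; rewrite /cone r1 mul1r.
have [k] := chord_angle (ang (cos t, sin t)) t; rewrite c1 s1 !subrr normr0 addr0 mulr0.
rewrite normr_le0 subr_eq0 => /eqP e.
by rewrite -(periodic_int hp k t) -e addrC subrK.
Qed.

(** The difference splits into a change of radius, weighted by the bound [H], and a change of angle.
    The jump of [ang] across the first axis is absorbed by the periodicity of [h]. *)
Lemma cone_lipschitz u v :
  `|cone h u - cone h v| <= (H + 12 * K) * (`|u.1 - v.1| + `|u.2 - v.2|).
Proof.
have [k [_ hk]] := ang_dist v u.
rewrite /cone (_ : _ - _ = (rad u - rad v) * h (ang v) + rad u * (h (ang u) - h (ang v))); last by ring.
rewrite (le_trans (ler_normD _ _))// [leRHS]mulrDl lerD// normrM.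
  rewrite mulrC ler_pM//; exact: rad_lipschitz.
rewrite (ger0_norm (rad_ge0 u)) -(periodic_int hp k (ang v)).
rewrite (le_trans (ler_wpM2l (rad_ge0 u) (hK _ _)))// mulrCA [12 * K]mulrC -mulrA ler_wpM2l//.
by rewrite opprD addrA.
Qed.

Lemma is_derive_approx (g : R -> R) (a e : R) : is_derive a 1 g 0 -> 0 < e ->
  exists2 eta, 0 < eta & forall x, `|x - a| < eta -> `|g x - g a| <= e * `|x - a|.
Proof.
move=> [dg dg0] e0.
have D : z^-1 *: (g (z *: 1 + a) - g a) @[z --> 0^'] --> 'D_1 g a by exact: dg.
rewrite dg0 in D; have /cvgrPdist_le/(_ e e0) := D.
rewrite /= => /nbhs_ballP[eta /= eta0 he]; exists eta => // x xa.
have [->|xa0] := eqVneq x a; first by rewrite !subrr normr0 mulr0.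
have := he (x - a); rewrite /ball /= sub0r normrN subr_eq0 => /(_ xa xa0).
rewrite sub0r normrN normrZ normfV [(x - a) *: 1]mulr1 subrK.
by rewrite mulrC ler_pdivrMr// normr_gt0 subr_eq0.
Qed.

(** The cone over [h th cos (x - th) + d sin (x - th)] is linear, with exactly the stated gradient.
    Subtracting it leaves the cone over [G], which vanishes at [th] together with its derivative. *)
Lemma cone_derive u (d : R) : 0 < rad u -> is_derive (ang u) 1 h d ->
  forall e : R, 0 < e -> \forall v \near u,
    `|cone h v - cone h u - ((cos (ang u) * h (ang u) - sin (ang u) * d) * (v.1 - u.1) +
       (sin (ang u) * h (ang u) + cos (ang u) * d) * (v.2 - u.2))| <=
    e * (`|v.1 - u.1| + `|v.2 - u.2|).
Proof.
move=> ru dh e e0; set th := ang u in dh *.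
pose G x := h x - (h th * cos (x - th) + d * sin (x - th)).
have dG : is_derive th 1 G 0.
  have ds : is_derive th 1 (fun x => x - th) 1 by have := is_derive_shift th 1 (- th).
  have dc : is_derive th 1 (cos \o (fun x => x - th)) 0.
    by apply: is_derive_eq (is_derive1_comp (is_derive_cos _) ds) _; rewrite subrr sin0 oppr0 mul0r.
  have dsn : is_derive th 1 (sin \o (fun x => x - th)) 1.
    by apply: is_derive_eq (is_derive1_comp (is_derive_sin _) ds) _; rewrite subrr cos0 mul1r.
  have D1 : is_derive th 1 (h - (h th *: (cos \o (fun x => x - th)) + d *: (sin \o (fun x => x - th))))
      (d - (h th *: 0 + d *: 1)).
    by apply: is_deriveB.
  rewrite -[G]/(h - (h th *: (cos \o (fun x => x - th)) + d *: (sin \o (fun x => x - th)))).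
  by apply: is_derive_eq D1 _; rewrite scaler0 add0r [d *: 1]mulr1 subrr.
have e12 : 0 < e / 12 by rewrite divr_gt0.
have [eta eta0 Gle] := is_derive_approx dG e12.
have G0 : G th = 0 by rewrite /G subrr cos0 sin0 mulr1 mulr0 addr0 subrr.
(* In this ball the sum [s] of the coordinate differences is below [rad u * eta / 12], so [ang_dist]
   keeps the angle within [eta] of [th]. *)
have rho0 : 0 < rad u * eta / 24 by rewrite divr_gt0// mulr_gt0.
apply/nbhs_ballP; exists (rad u * eta / 24) => //= v [v1 v2].
rewrite /ball /= in v1 v2; rewrite (distrC u.1) in v1; rewrite (distrC u.2) in v2.
have [k [hk1 hk2]] := ang_dist u v.
set s := `|v.1 - u.1| + `|v.2 - u.2| in hk1 hk2 *.
pose ph := ang v - k%:~R * (2 * pi).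
have phE : ang v - ang u - k%:~R * (2 * pi) = ph - th by rewrite /ph /th; ring.
rewrite phE in hk1 hk2.
have hph : h (ang v) = h ph by rewrite -(periodic_int hp k ph) /ph subrK.
have phth : `|ph - th| < eta.
  rewrite -(ltr_pM2l ru); apply: (le_lt_trans hk1).
  by rewrite /s; lra.
have [cv sv] : cos ph = cos (ang v) /\ sin ph = sin (ang v).
  split; rewrite -[LHS](@periodic_int R _ (2 * pi) _ k) /ph ?subrK// => t.
    by rewrite mulr_natl cosD2pi.
  by rewrite mulr_natl sinD2pi.
have [u1 u2] := polarE u; have [v1E v2E] := polarE v.
have := Gle ph phth; rewrite G0 subr0 => Gph.
rewrite (_ : _ - _ = rad v * G ph).
  rewrite normrM (ger0_norm (rad_ge0 v)) (le_trans (ler_wpM2l (rad_ge0 v) Gph))//.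
  by rewrite mulrCA; have := ler_wpM2l (ltW e12) hk2; lra.
rewrite /cone hph /G cosB sinB cv sv -/th.
rewrite -/th in u1 u2; rewrite {1}v1E {1}v2E {1}u1 {1}u2.
have cs := cos2Dsin2 th.
have -> : rad u * h th = rad u * h th * (cos th ^+ 2 + sin th ^+ 2) by rewrite cs mulr1.
ring.
Qed.

End cone.

(** * Area of angular sectors of the disc *)

Section polar_measure.
Context {R : realType}.
Notation mT := (measurableTypeR R * measurableTypeR R)%type.
Notation mu := (@lebesgue_measure R).
Implicit Types (u : R * R).

Lemma measurable_inv : measurable_fun [set: R] (fun x : R => x^-1).
Proof.
have m0 : measurable [set~ (0 : R)] by apply: measurableC; exact: measurable_set1.
rewrite -(setUv [set (0 : R)]); apply/measurable_funU => //.
split; first exact: measurable_fun_set1.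
apply: open_continuous_measurable_fun; first by apply: closed_openC; apply: compact_closed; [exact: Rhausdorff|exact: compact_set1].
by move=> x; rewrite inE /= => /eqP x0; apply: cvgV => //; exact: cvg_id.
Qed.

Lemma measurable_ang : measurable_fun (setT : set mT) (@ang R).
Proof.
have mf : measurable_fun (setT : set mT) (fst : R * R -> R) by exact: measurable_fst.
have ms : measurable_fun (setT : set mT) (snd : R * R -> R) by exact: measurable_snd.
have ma : measurable_fun (setT : set mT) (fun u : R * R => atan (u.1 / u.2)).
  apply: (measurableT_comp (f := atan)).
    by apply: continuous_measurable_fun => x; exact: continuous_atan.
  apply: measurable_funM => //; apply: (measurableT_comp measurable_inv ms).
rewrite /ang; apply: measurable_fun_ifT => //=.
- exact: measurable_fun_ltr.
- exact: measurable_funB.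
- apply: measurable_fun_ifT => //=.
  + exact: measurable_fun_ltr.
  + exact: measurable_funB.
  + by apply: measurable_fun_ifT => //=; exact: measurable_fun_ltr.
Qed.

Lemma tan_lt (a b : R) : - (pi / 2) < a -> a <= b -> b < pi / 2 -> tan a <= tan b.
Proof.
move=> a1; rewrite le_eqVlt => /predU1P[->//|ab] b1.
by rewrite ltW// ltr_tan// in_itv /= ?a1 ?b1 ?(lt_trans a1 ab) ?(lt_trans ab b1).
Qed.

(* The slice at height [eta] is the image under [x = eta * tan alpha] of the angles
   seen from the origin, measured from the vertical axis. *)
Lemma sector_slice (P : set (measurableTypeR R)) (eta a1 a2 : R) :
  measurable P -> 0 < eta < 1 -> - (pi / 2) <= a1 -> a2 <= pi / 2 ->
  (forall x, P x -> x ^+ 2 + eta ^+ 2 < 1 /\ a1 <= atan (x / eta) <= a2) ->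
  (mu P <=
   \int[mu]_(a in `[a1, a2]) ((if (eta <= cos a)%R then eta / cos a ^+ 2 else 0)%R%:E))%E.
Proof.
move=> mP /andP[eta0 eta1] a1pi a2pi PE.
have pi0 := pi_gt0 R.
have eta11 : -1 <= eta <= 1 by apply/andP; split; lra.
(* From the origin, the chord of the disc at height [eta] is seen under angles of modulus less than
   [A]; the cut-off [eta <= cos a] in the integrand expresses this. *)
pose A := acos eta.
have cA : cos A = eta by apply: acosK; rewrite in_itv.
have A0 : 0 <= A by exact: acos_ge0.
have A2 : A < pi / 2.
  have : cos (pi / 2) < cos A by rewrite cos_pihalf cA.
  have Api : A <= pi by exact: acos_lepi.
  by rewrite ltr_cos ?in_itv /= ?A0 ?Api//; lra.
have PA x : P x -> - A < atan (x / eta) < A.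
  move=> /PE[x1 _]; set al := atan (x / eta).
  have xE : x = eta * tan al by rewrite atanK mulrC divfK// gt_eqF.
  have al1 : - (pi / 2) < al by exact: atan_gtNpi2.
  have al2 : al < pi / 2 by exact: atan_ltpi2.
  have cal : 0 < cos al by apply: cos_gt0_pihalf; rewrite al1.
  have : eta ^+ 2 < cos al ^+ 2.
    have := cos2_tan2 (lt0r_neq0 cal); rewrite -exprVn => e.
    have c2 : 0 < cos al ^+ 2 by rewrite exprn_gt0.
    have : eta ^+ 2 * (cos al)^-1 ^+ 2 < 1 by rewrite e; move: x1; rewrite xE; lra.
    by rewrite exprVn ltr_pdivrMr// mul1r.
  rewrite ltr_pXn2r ?nnegrE ?ltW// -cA => cc.
  have : `|al| < A.
    have Api : A <= pi by exact: acos_lepi.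
    have alpi : `|al| <= pi by rewrite ler_norml; lra.
    have : cos A < cos `|al| by rewrite cos_norm.
    by rewrite ltr_cos ?in_itv /= ?A0 ?Api ?normr_ge0.
  by rewrite ltr_norml.
pose b1 := Num.max a1 (- A); pose b2 := Num.min a2 A.
have Pb x : P x -> b1 <= atan (x / eta) <= b2.
  move=> Px; have /andP[? ?] := PA x Px; have [_ /andP[? ?]] := PE x Px.
  by rewrite /b1 /b2 ge_max le_min; do ![apply/andP; split] => //; exact: ltW.
have mb : measurable_fun [set: R] (fun a : R => if eta <= cos a then eta / cos a ^+ 2 else 0).
  have mc : measurable_fun [set: R] (@cos R) by apply: continuous_measurable_fun; exact: continuous_cos.
  apply: measurable_fun_ifT => //=; first exact: measurable_fun_ler.
  apply: measurable_funM => //; apply: (measurableT_comp measurable_inv); exact: measurable_funX.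
have a2b2 : b2 <= a2 by rewrite /b2 ge_min lexx.
have a1b1 : a1 <= b1 by rewrite /b1 le_max lexx.
have Ab1 : - A <= b1 by rewrite /b1 le_max lexx orbT.
have Ab2 : b2 <= A by rewrite /b2 ge_min lexx orbT.
(* If [b2 <= b1], at most one angle remains and [P] is contained in a single point. *)
have [b12|b21] := ltP b1 b2; last first.
  rewrite (@le_trans _ _ 0%E)//; last first.
    by apply: integral_ge0 => a _; case: ifP => // _; rewrite lee_fin divr_ge0 ?sqr_ge0// ltW.
  have : P `<=` [set eta * tan b1].
    move=> x Px; have /andP[h1 h2] := Pb x Px.
    have e : atan (x / eta) = b1 by apply/le_anti; rewrite h1 (le_trans h2 b21).
    by rewrite /= -e atanK mulrC divfK// gt_eqF.
  move=> /(le_measure mu); rewrite !inE => /(_ mP (measurable_set1 _))/le_trans; apply.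
  by have := lebesgue_measure_set1 (eta * tan b1); rewrite /= => ->.
have cosb a : b1 <= a <= b2 -> eta <= cos a.
  move=> /andP[h1 h2].
  have : `|a| <= A by rewrite ler_norml; lra.
  have Api : A <= pi by exact: acos_lepi.
  rewrite -cA -(cos_norm a) le_eqVlt => /predU1P[->//|aA].
  by rewrite ltW// ltr_cos ?in_itv /= ?normr_ge0 ?A0 ?Api ?(le_trans (ltW aA)).
have cos0' a : b1 <= a <= b2 -> cos a != 0.
  by move=> /cosb h; rewrite gt_eqF// (lt_le_trans eta0).
have c1 : {within `[b1, b2], continuous (fun a => eta / cos a ^+ 2)}.
  apply: continuous_in_subspaceT => a; rewrite inE /= in_itv /= => /cos0' ca.
  apply: cvgMr; apply: cvgV; first by rewrite expf_neq0.
  by apply: cvgM; exact: continuous_cos.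
have ct a : cos a != 0 -> {for a, continuous (fun a => eta * tan a)}.
  by move=> ca; apply: cvgMr; exact: continuous_tan.
have FTC : (\int[mu]_(a in `[b1, b2]) (eta / cos a ^+ 2)%:E =
   (eta * tan b2)%:E - (eta * tan b1)%:E)%E.
  apply: (@continuous_FTC2 _ (fun a => eta / cos a ^+ 2) (fun a => eta * tan a)) => //.
    split=> [a||].
    - rewrite in_itv /= => /andP[h1 h2]; apply: derivableM; first exact: derivable_cst.
      by apply: derivable_tan; apply: cos0'; rewrite !ltW.
    - by apply: cvg_at_right_filter; apply: ct; apply: cos0'; rewrite lexx ltW.
    - by apply: cvg_at_left_filter; apply: ct; apply: cos0'; rewrite lexx ltW.
  move=> a; rewrite in_itv /= => /andP[h1 h2].
  have ca : cos a != 0 by apply: cos0'; rewrite !ltW.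
  rewrite derive1E; have [_ dt] := is_derive_tan ca.
  have := @deriveZ _ _ _ tan eta a 1 (derivable_tan ca); rewrite dt => ->.
  by [].
have b1pi : - (pi / 2) < b1 by lra.
have b2pi : b2 < pi / 2 by lra.
have PI : P `<=` `[eta * tan b1, eta * tan b2]%classic.
  move=> x Px; have /andP[h1 h2] := Pb x Px.
  have xE : x = eta * tan (atan (x / eta)) by rewrite atanK mulrC divfK// gt_eqF.
  rewrite /= in_itv /= {1 2}xE !ler_pM2l//.
  by rewrite !tan_lt ?atan_gtNpi2 ?atan_ltpi2.
have := le_measure mu; move=> /(_ _ _ _ _ PI); rewrite !inE => /(_ mP (measurable_itv _))/le_trans; apply.
rewrite /= lebesgue_measure_itv /= lte_fin.
rewrite (@le_trans _ _ (\int[mu]_(a in `[b1, b2]) (eta / cos a ^+ 2)%:E)%E)//.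
  case: ifPn => // _; first by rewrite FTC.
  by apply: integral_ge0 => a _; rewrite lee_fin divr_ge0 ?sqr_ge0// ltW.
have -> : (\int[mu]_(a in `[b1, b2]) (eta / cos a ^+ 2)%:E =
    \int[mu]_(a in `[b1, b2]) ((if (eta <= cos a)%R then eta / cos a ^+ 2 else 0)%R%:E))%E.
  by apply: eq_integral => a; rewrite inE /= in_itv /= => /cosb ->.
apply: ge0_subset_integral => //=; first exact/measurable_EFinP/measurable_funTS.
- by move=> a _; case: ifP => // _; rewrite lee_fin divr_ge0 ?sqr_ge0// ltW.
- by apply: subset_itv; rewrite bnd_simp.
Qed.

End polar_measure.

Section polar_integral.
Context {R : realType}.
Notation mT := (measurableTypeR R * measurableTypeR R)%type.
Notation mu := (@lebesgue_measure R).
Implicit Types (u : R * R).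

(** For positive [y], the derivative in [a] of the abscissa [y tan a], cut off where the point
    [(y tan a, y)] leaves the closed disc. *)
Let kern (y a : R) : R := if y <= cos a then y / cos a ^+ 2 else 0.

Let measurable_kern :
  measurable_fun (setT : set mT) (fun p : R * R => kern `|p.1| p.2).
Proof.
have mc : measurable_fun (setT : set mT) (fun p : R * R => cos p.2).
  apply: (measurableT_comp (f := @cos R)); last exact: measurable_snd.
  by apply: continuous_measurable_fun; exact: continuous_cos.
have mn : measurable_fun (setT : set mT) (fun p : R * R => `|p.1|).
  by apply: measurableT_comp => //; exact: measurable_fst.
apply: measurable_fun_ifT => //=; first exact: measurable_fun_ler.
apply: measurable_funM => //; apply: (measurableT_comp measurable_inv).
exact: measurable_funX.
Qed.

Let kern_ge0 (y a : R) : 0 <= kern `|y| a.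
Proof. by rewrite /kern; case: ifP => // _; rewrite divr_ge0// sqr_ge0. Qed.

Let half (b : bool) : set R := if b then `]0, 1[%classic else `]-1, 0[%classic.

Let measurable_half b : measurable (half b : set (measurableTypeR R)).
Proof. by case: b; exact: measurable_itv. Qed.

Let integral_linear (s a b : R) : a < b ->
  (\int[mu]_(y in `[a, b]) (s * y)%R%:E = (s * (b ^+ 2 - a ^+ 2) / 2)%R%:E)%E.
Proof.
move=> ab; have d (y : R) : is_derive y 1 ((s / 2) *: (id ^+ 2)) (s * y).
  by apply: is_derive_eq; rewrite /GRing.scale /=; field.
have cF : continuous ((s / 2) *: (id ^+ 2) : R -> R).
  by move=> y; apply/differentiable_continuous/derivable1_diffP; case: (d y).
rewrite (@continuous_FTC2 R (fun y => s * y) ((s / 2) *: (id ^+ 2))) //.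
- by rewrite -EFinB !fctE /GRing.scale /=; congr EFin; field.
- by apply: continuous_subspaceT => y; apply: cvgMr; exact: cvg_id.
- split=> [y _||]; first by case: (d y).
    by apply: cvg_at_right_filter; exact: cF.
  by apply: cvg_at_left_filter; exact: cF.
- by move=> y _; rewrite derive1E; case: (d y).
Qed.

Let measurable_patch (D : set (measurableTypeR R)) (g : R -> \bar R) : measurable D ->
  measurable_fun [set: R] g -> measurable_fun [set: R] (g \_ D).
Proof. by move=> mD mg; apply/(measurable_restrictT _ mD); exact: measurable_funTS. Qed.

Let half_abs b (c : R) : 0 <= c ->
  (\int[mu]_(y in half b) (if (`|y| <= c)%R then `|y| else 0)%R%:E <= (c ^+ 2 / 2)%:E)%E.
Proof.
rewrite le_eqVlt => /predU1P[<-|c0].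
  rewrite expr0n /= mul0r integral0_eq// => y _.
  by case: ifPn => //; rewrite normr_le0 => /eqP ->; rewrite normr0.
have mn : measurable_fun [set: R] (fun y : R => if `|y| <= c then `|y| else 0).
  by apply: measurable_fun_ifT => //=; apply: measurable_fun_ler.
pose I := if b then `[0, c]%classic else `[-c, 0]%classic : set R.
have mI : measurable (I : set (measurableTypeR R)) by rewrite /I; case: (b); exact: measurable_itv.
apply: (@le_trans _ _ (\int[mu]_(y in I) (`|y|)%:E)%E).
  rewrite [leLHS]integral_mkcond [leRHS]integral_mkcond.
  apply: ge0_le_integral => //=.
  - by move=> y _; rewrite patchE; case: ifP => // _; case: ifP.
  - by apply: measurable_patch => //; exact/measurable_EFinP.
  - by apply: measurable_patch => //; exact/measurable_EFinP.
  move=> y _; rewrite !patchE; case: ifPn => yh; last by case: ifP => // _; rewrite lee_fin.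
  case: ifPn => yc; last by case: ifP => // _; rewrite lee_fin.
  rewrite ifT//; move: yh yc; rewrite /half /I !inE; case: (b) => /=; rewrite !in_itv /=.
    by move=> /andP[y0 _]; rewrite gtr0_norm// => ->; rewrite ltW.
  by move=> /andP[_ y0]; rewrite ltr0_norm// lerNl => ->; rewrite ltW.
rewrite /I; case: (b).
  have -> : (\int[mu]_(y in `[0%R, c]) (`|y|)%:E = \int[mu]_(y in `[0%R, c]) (1 * y)%R%:E)%E.
    by apply: eq_integral => y; rewrite inE /= in_itv /= => /andP[y0 _]; rewrite ger0_norm// mul1r.
  by rewrite integral_linear// expr0n /= subr0 mul1r.
have -> : (\int[mu]_(y in `[(- c)%R, 0%R]) (`|y|)%:E = \int[mu]_(y in `[(- c)%R, 0%R]) (-1 * y)%R%:E)%E.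
  by apply: eq_integral => y; rewrite inE /= in_itv /= => /andP[_ y0]; rewrite ler0_norm// mulN1r.
by rewrite integral_linear ?oppr_lt0// expr0n /= sqrrN sub0r mulN1r opprK.
Qed.

(** After exchanging the integrals, the inner one is at most that of [y / cos^2 a] over heights up
    to [cos a], which is 1/2 whatever the angle. The maximum with 0 admits empty ranges of
    angles. *)
Lemma sector_integral b (a1 a2 : R) :
  (\int[mu]_(y in half b) \int[mu]_(a in `[a1, a2]) (kern `|y| a)%:E <=
   (Num.max 0 (a2 - a1) / 2)%:E)%E.
Proof.
pose f (p : R * R) : \bar R := ((\1_(half b `*` `[a1, a2]) p) * kern `|p.1| p.2)%:E.
have mbox : measurable (half b `*` `[a1, a2]%classic : set mT).
  by apply: measurableX => //; exact: measurable_itv.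
have mf : measurable_fun (setT : set mT) f.
  by apply/measurable_EFinP; apply: measurable_funM; [exact: measurable_indic|exact: measurable_kern].
have f0 p : (0 <= f p)%E by rewrite lee_fin mulr_ge0.
have -> : (\int[mu]_(y in half b) \int[mu]_(a in `[a1, a2]) (kern `|y| a)%:E =
    \int[mu]_y \int[mu]_a f (y, a))%E.
  rewrite integral_mkcond; apply: eq_integral => y _; rewrite patchE; case: ifPn => yh.
    rewrite integral_mkcond; apply: eq_integral => a _; rewrite patchE /f indicE /= in_setX yh /=.
    by case: ifP => _; rewrite ?mul1r ?mul0r.
  by rewrite integral0_eq// => a _; rewrite /f indicE in_setX (negbTE yh) mul0r.
rewrite fubini_tonelli//.
have mG := measurable_fun_fubini_tonelli_G (m1 := mu) f mf f0.
apply: (@le_trans _ _ (\int[mu]_(a in `[a1, a2]) (2^-1)%:E)%E); last first.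
  rewrite integral_cst//= lebesgue_measure_itv /= lte_fin -(subr_gt0 a1).
  case: ltP => _; last by rewrite mule0 mul0r.
  by rewrite -EFinB -EFinM lee_fin mulrC.
rewrite [leRHS]integral_mkcond; apply: ge0_le_integral => //=.
- by move=> a _; apply: integral_ge0.
- by apply: measurable_patch => //; exact: measurable_itv.
move=> a _; rewrite patchE; case: ifPn => aI; last first.
  by rewrite integral0_eq// => y _; rewrite /f indicE in_setX (negbTE aI) andbF mul0r.
have [ca|ca] := leP (cos a) 0.
  rewrite integral0_eq// => y _; rewrite /f /kern /=; case: ifPn => yc; last by rewrite mulr0.
  have -> : `|y| = 0 by apply/le_anti; rewrite normr_ge0 (le_trans yc ca).
  by rewrite mul0r mulr0.
have c2 : 0 < cos a ^+ 2 by rewrite exprn_gt0.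
apply: (@le_trans _ _ (\int[mu]_(y in half b) (((cos a ^+ 2)^-1)%R%:E *
    (if (`|y| <= cos a)%R then `|y| else 0)%R%:E))%E).
  rewrite [leRHS]integral_mkcond le_eqVlt; apply/orP; left; apply/eqP.
  apply: eq_integral => y _; rewrite patchE /f indicE in_setX aI andbT.
  case: ifPn => yh; last by rewrite mul0r.
  by rewrite /= mul1r /kern; case: ifP => _; [rewrite mulrC EFinM|rewrite mule0].
have mn : measurable_fun [set: R] (fun y : R => if `|y| <= cos a then `|y| else 0).
  by apply: measurable_fun_ifT => //=; apply: measurable_fun_ler.
rewrite ge0_integralZl//.
- apply: (@le_trans _ _ (((cos a ^+ 2)^-1)%R%:E * (cos a ^+ 2 / 2)%R%:E)%E).
    by apply: lee_wpmul2l; [rewrite lee_fin invr_ge0 ltW|exact: half_abs (ltW ca)].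
  by rewrite -EFinM lee_fin mulrA mulVf ?mul1r// gt_eqF.
- apply/measurable_EFinP; exact: measurable_funTS.
- by move=> y _; case: ifP.
- by rewrite lee_fin invr_ge0 ltW.
Qed.

(** The disc is sliced horizontally, the upper and lower halves being treated by the two branches of
    [ang]. An upper bound suffices, since [measure_le_lebesgue] extends it from intervals to
    measurable sets of angles. *)
Lemma ang_sector (a b : R) : a < b ->
  (leb2 R (disc R `&` @ang R @^-1` `]a, b]) <= ((b - a) / 2)%:E)%E.
Proof.
move=> ab; have pi0 := pi_gt0 R.
set S := _ `&` _.
have mS : measurable (S : set mT).
  apply: measurableI; first exact: measurable_disc.
  by rewrite -[X in measurable X]setTI; apply: measurable_ang => //; exact: measurable_itv.
have mind : measurable_fun (setT : set mT) (fun u : R * R => (\1_S u)%:E : \bar R).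
  by apply/measurable_EFinP; exact: measurable_indic.
have ind0 (u : R * R) : (0 <= (\1_S u)%:E :> \bar R)%E by [].
have -> : leb2 R S = (\int[mu]_y \int[mu]_x (\1_S (x, y))%:E)%E.
  have := integral_indic (leb2 R) measurableT mS; rewrite setIT => <-.
  by rewrite -(fubini_tonelli _ mind)//; exact: fubini_tonelli1.
(* These delimit [atan (x / |y|)] on the parts of []a, b]] belonging to the upper and the lower half
   disc. Clipped at 0, the two lengths add up to at most [b - a]. *)
pose u1 := pi / 2 - Num.min b pi; pose u2 := pi / 2 - Num.max a 0.
pose l1 := Num.max a pi - 3 * (pi / 2); pose l2 := Num.min b (2 * pi) - 3 * (pi / 2).
have mG := measurable_fun_fubini_tonelli_G (m1 := mu) _ mind ind0.
pose J (c d y : R) : \bar R := (\int[mu]_(a in `[c, d]) (kern `|y| a)%:E)%E.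
have J0 (c d y : R) : (0 <= J c d y)%E by apply: integral_ge0 => al _; rewrite lee_fin.
have mJ (c d : R) : measurable_fun [set: R] (J c d).
  pose f (p : R * R) : \bar R := ((\1_(setT `*` `[c, d]) p) * kern `|p.1| p.2)%:E.
  have mbox : measurable (setT `*` `[c, d]%classic : set mT).
    by apply: measurableX => //; exact: measurable_itv.
  have mf : measurable_fun (setT : set mT) f.
    by apply/measurable_EFinP; apply: measurable_funM; [exact: measurable_indic|exact: measurable_kern].
  have f0 p : (0 <= f p)%E by rewrite lee_fin mulr_ge0.
  have := measurable_fun_fubini_tonelli_F (m2 := mu) f mf f0.
  congr measurable_fun; apply/funext => y; rewrite /fubini_F /J [RHS]integral_mkcond.
  apply: eq_integral => al _; rewrite patchE /f indicE in_setX in_setT /=.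
  by case: ifP => _; rewrite ?mul1r ?mul0r.
pose B (y : R) := ((J u1 u2 \_ (half true)) y + (J l1 l2 \_ (half false)) y)%E.
apply: (@le_trans _ _ (\int[mu]_y B y)%E).
  apply: ae_ge0_le_integral => //.
  - by move=> y _; apply: integral_ge0.
  - by move=> y _; apply: adde_ge0; rewrite patchE; case: ifP.
  - by apply: emeasurable_funD; apply: measurable_patch => //.
  (* Height 0, where [ang] is not given by the arctangent, is a null set of heights. *)
  exists [set 0]; split; [exact: measurable_set1|exact: lebesgue_measure_set1|].
  move=> y /=; apply: contra_notP => y0 _.
  have slice : (\int[mu]_x (\1_S (x, y))%:E = mu (ysection S y))%E.
    have := integral_indic mu measurableT (measurable_ysection y mS); rewrite setIT => <-.
    by apply: eq_integral => x _; rewrite !indicE mem_ysection.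
  have mSy := measurable_ysection y mS.
  rewrite slice /B !patchE /half !mem_setE /=.
  have SE x : ysection S y x -> [/\ x ^+ 2 + y ^+ 2 < 1, a < ang (x, y) & ang (x, y) <= b].
    by rewrite /ysection /= inE => -[h] /=; rewrite in_itv /= => /andP[].
  have Sy x : ysection S y x -> -1 < y < 1.
    by case/SE => h _ _; have := sqr_ge0 x; move=> ?; apply/andP; split; nra.
  have [y1|y1] := ltP 0 y.
    rewrite !in_itv /= y1 (lt_gtF y1) andbF /= adde0; case: ifPn => [y2|y2]; last first.
      rewrite (_ : ysection S y = set0) ?measure0//; apply/seteqP; split => // x /Sy/andP[_ h].
      by rewrite h in y2.
    rewrite /J gtr0_norm//; apply: sector_slice => //.
    - by rewrite y1.
    - by rewrite /u1; have [?|?] := leP b pi; lra.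
    - by rewrite /u2; have [?|?] := leP a 0; lra.
    move=> x /SE[h1 h2 h3]; split => //.
    move: h2 h3; rewrite /ang /= y1 /u1 /u2.
    have := atan_gtNpi2 (x / y); have := atan_ltpi2 (x / y).
    by have [?|?] := leP b pi; have [?|?] := leP a 0; move=> ? ? ? ?; apply/andP; split; lra.
  have y2 : y < 0 by rewrite lt_neqAle y1 andbT; apply/eqP.
  rewrite !in_itv /= (lt_gtF y2) /= add0e y2 andbT; case: ifPn => [y3|y3]; last first.
    rewrite (_ : ysection S y = set0) ?measure0//; apply/seteqP; split => // x /Sy/andP[h _].
    by rewrite h in y3.
  rewrite /J ltr0_norm//; apply: sector_slice => //.
  - by rewrite oppr_gt0 y2 /= ltrNl.
  - by rewrite /l1; have [?|?] := leP a pi; lra.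
  - by rewrite /l2; have [?|?] := leP b (2 * pi); lra.
  move=> x /SE[h1 h2 h3]; rewrite sqrrN; split => //.
  move: h2 h3; rewrite /ang /= (lt_gtF y2) y2 /l1 /l2 invrN mulrN atanN.
  have := atan_gtNpi2 (x / y); have := atan_ltpi2 (x / y).
  by have [?|?] := leP b (2 * pi); have [?|?] := leP a pi; move=> ? ? ? ?; apply/andP; split; lra.
rewrite ge0_integralD//.
- rewrite -!integral_mkcond (le_trans (leeD (sector_integral _ _ _) (sector_integral _ _ _)))//.
  rewrite -EFinD lee_fin -mulrDl ler_pM2r ?invr_gt0//.
  rewrite /u1 /u2 /l1 /l2.
  rewrite /Order.max /Order.min.
  by repeat (case: ifPn; rewrite -?leNgt => ?); lra.
- by move=> y _; rewrite patchE; case: ifP.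
- by apply: measurable_patch => //.
- by move=> y _; rewrite patchE; case: ifP.
- by apply: measurable_patch => //.
Qed.

End polar_integral.

Section lower_integral.
Context d (T : measurableType d) (R : realType) (mu : {measure set T -> \bar R}).
Import HBNNSimple.

(* The integral of a nonnegative function is a supremum over simple minorants, so it is monotone
   without any measurability. *)
Lemma le_integral_minorant D (f g : T -> \bar R) : (forall x, D x -> (0 <= f x <= g x)%E) ->
  (\int[mu]_(x in D) f x <= \int[mu]_(x in D) g x)%E.
Proof.
move=> fg; rewrite !ge0_integralE; last 2 first.
- by move=> x /fg/andP[/le_trans]; exact.
- by move=> x /fg/andP[].
apply: ge_ereal_sup => _ [h hf <-]; apply: le_ereal_sup_tmp; exists (sintegral mu h) => //.
exists h => // x; rewrite (le_trans (hf x))// /patch; case: ifPn => //.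
by rewrite inE => /fg/andP[].
Qed.

(** A simple minorant of [f] cut off to [D] vanishes outside [D], so its integral is the same for
    the restricted measure. [f] itself may be non-measurable. *)
Lemma le_integral_mrestr D (mD : measurable D) (f : T -> \bar R) : (forall x, (0 <= f x)%E) ->
  (\int[mu]_(x in D) f x <= \int[mrestr mu mD]_x f x)%E.
Proof.
move=> f0; rewrite ge0_integralE// ge0_integralTE//.
apply: ge_ereal_sup => _ [h hf <-]; apply: le_ereal_sup_tmp.
exists (sintegral (mrestr mu mD) h).
  by exists h => // x; rewrite (le_trans (hf x))// /patch; case: ifP.
rewrite !sintegralEnnsfun le_eqVlt; apply/orP; left; apply/eqP.
apply: eq_fsbigr => r; rewrite inE /= => r0; congr (_ * _)%E; rewrite /mrestr; congr (mu _).
apply/seteqP; split => [x /= xr|x []//]; split => //; apply: contrapT => xD.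
have := hf x; rewrite /patch memNset// lee_fin xr leNgt r0 //.
Qed.

End lower_integral.

Section polar_pushforward.
Context {R : realType}.
Notation mT := (measurableTypeR R * measurableTypeR R)%type.
Notation mu := (@lebesgue_measure R).

Let measurable_ang' : measurable_fun (setT : set mT) (@ang R : mT -> measurableTypeR R).
Proof. exact: measurable_ang. Qed.

Let nu : {measure set (measurableTypeR R) -> \bar R} :=
  measure_function_pushforward__canonical__measure_function_Measure
    (mrestr (leb2 R) (@measurable_disc R)) measurable_ang'.

Let nuE A : nu A = leb2 R (disc R `&` @ang R @^-1` A).
Proof. by rewrite /nu /= /pushforward /mrestr setIC. Qed.

Lemma ang_pushforward_le A : measurable A -> (nu A <= (2^-1)%:E * mu A)%E.
Proof.
apply: measure_le_lebesgue; first by rewrite invr_gt0.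
by move=> a b ab; rewrite nuE (le_trans (ang_sector ab))// mulrC.
Qed.

(** The distribution of the angle is absolutely continuous; this carries differentiability almost
    everywhere from the curve to its cone. *)
Lemma ang_null (N : set R) : measurable N -> mu N = 0%E ->
  {ae leb2 R, forall u, disc R u -> ~ N (ang u)}.
Proof.
move=> mN N0; exists (disc R `&` @ang R @^-1` N); split.
- apply: measurableI; first exact: measurable_disc.
  by rewrite -[X in measurable X]setTI; exact: measurable_ang.
- apply/eqP; rewrite eq_le measure_ge0 andbT -nuE.
  by rewrite (le_trans (ang_pushforward_le mN))// N0 mule0.
by move=> u /= /not_implyP[Bu /contrapT].
Qed.

(** The integrand does not depend on the radius, so the radial integral of [r dr] contributes the
    factor 1/2. *)
Lemma polar_integral_le (f : R -> R) : measurable_fun [set: R] f -> (forall t, 0 <= f t) ->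
  (\int[leb2 R]_(u in disc R) (f (ang u))%:E <=
   (2^-1)%:E * \int[mu]_(t in `[0%R, (2 * pi)%R]) (f t)%:E)%E.
Proof.
move=> mf f0.
have mI : measurable (`[0%R, (2 * pi)%R]%classic : set (measurableTypeR R)) by exact: measurable_itv.
have mfE : measurable_fun [set: R] (fun t => (f t)%:E) by exact/measurable_EFinP.
pose m : {measure set mT -> \bar R} := mrestr (leb2 R) (@measurable_disc R).
have E := @ge0_integral_pushforward _ _ mT (measurableTypeR R) R (@ang R) measurable_ang' m _
  (fun t => (f t)%:E) mI (measurable_funTS mfE).
apply: (@le_trans _ _ (\int[nu]_(t in `[0%R, (2 * pi)%R]) (f t)%:E)%E).
  rewrite E; last by move=> t _; rewrite lee_fin.
  rewrite (_ : @ang R @^-1` _ = setT); last first.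
    apply/seteqP; split => // u _ /=; rewrite in_itv /=.
    by have /andP[-> /ltW ->] := ang_itv u.
  by apply: le_integral_mrestr => u; rewrite lee_fin.
have c0 : 0 <= 2^-1 :> R by rewrite invr_ge0.
pose c : {nonneg R} := NngNum c0.
apply: (@le_trans _ _ (\int[mscale c mu]_(t in `[0%R, (2 * pi)%R]) (f t)%:E)%E).
  by apply: ge0_le_measure_integral => // A mA; exact: ang_pushforward_le.
rewrite ge0_integral_mscale//; last by move=> t _; rewrite lee_fin.
exact: measurable_funTS.
Qed.

End polar_pushforward.

(** * The conical competitor *)

Lemma sum_ord3 (V : nmodType) (F : 'I_3 -> V) : \sum_(i < 3) F i = F 0 + F 1 + F 2.
Proof.
rewrite !big_ord_recl big_ord0 addr0 addrA.
by congr (F _ + F _ + F _); apply: val_inj.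
Qed.

(** Lagrange's identity; sums of indices are taken modulo 3. *)
Lemma sqr_enorm_cross (R : realType) (x y : 'rV[R]_3) :
  enorm (cross x y) ^+ 2 = enorm x ^+ 2 * enorm y ^+ 2 - dotp x y ^+ 2.
Proof.
rewrite !enorm_sqr /dotp !sum_ord3 /cross !mxE.
have -> : (0 : 'I_3) + 1 = 1 by exact: val_inj.
have -> : (0 : 'I_3) + 2 = 2 by exact: val_inj.
have -> : (1 : 'I_3) + 1 = 2 by exact: val_inj.
have -> : (1 : 'I_3) + 2 = 0 by exact: val_inj.
have -> : (2 : 'I_3) + 1 = 0 by exact: val_inj.
have -> : (2 : 'I_3) + 2 = 1 by exact: val_inj.
ring.
Qed.

Lemma enorm_ge0 (R : realType) n (x : 'rV[R]_n) : 0 <= enorm x.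
Proof. exact: sqrtr_ge0. Qed.

Lemma enorm_cross_le (R : realType) (x y : 'rV[R]_3) :
  enorm (cross x y) <= (enorm x ^+ 2 + enorm y ^+ 2) / 2.
Proof.
have : enorm (cross x y) <= enorm x * enorm y.
  rewrite -(@ler_pXn2r _ 2) ?nnegrE ?mulr_ge0 ?enorm_ge0// sqr_enorm_cross exprMn.
  by rewrite gerBl sqr_ge0.
by have := sqr_ge0 (enorm x - enorm y); lra.
Qed.

Lemma ae_forall_ord d (T : measurableType d) (R : realType) (nu : {measure set T -> \bar R}) n
    (P : 'I_n -> T -> Prop) :
  (forall i, {ae nu, forall t, P i t}) -> {ae nu, forall t, forall i, P i t}.
Proof.
move=> aeP; have h k : {ae nu, forall t, forall i : 'I_n, val i = k -> P i t}.
  have [kn|nk] := ltnP k n; last first.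
    by apply: aeW => t i ik; have := ltn_ord i; rewrite ltnNge -[X in (n <= X)%N]/(val i) ik nk.
  have := aeP (Ordinal kn); apply: filterS.
  by move=> t Pt i ik; rewrite (_ : i = Ordinal kn)//; exact: val_inj.
have := ae_foralln h; apply: filterS.
by move=> t Pt i; exact: Pt.
Qed.

Section cone_competitor.
Context {R : realType}.
Notation mT := (measurableTypeR R * measurableTypeR R)%type.
Notation mu := (@lebesgue_measure R).
Variables (g : 'I_3 -> R -> R) (K : R).
Hypothesis K0 : 0 <= K.
Hypothesis gK : forall s t, \sum_(i < 3) (g i s - g i t) ^+ 2 <= (K * (s - t)) ^+ 2.
Hypothesis gp : forall i t, g i (t + 2 * pi) = g i t.

Let gL i s t : `|g i s - g i t| <= K * `|s - t|.
Proof.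
rewrite -(@ler_pXn2r _ 2) ?nnegrE ?mulr_ge0// exprMn !real_normK ?num_real// -exprMn.
apply: le_trans (gK s t); rewrite (bigD1 i)//= lerDl.
by apply: sumr_ge0 => j _; exact: sqr_ge0.
Qed.

(** The difference quotients are bounded in Euclidean norm, and so is their limit. Bounding the
    coordinates separately would lose a factor 3 and spoil the sharp constant. *)
Lemma sqr_derive_le (d : 'I_3 -> R) (t : R) : (forall i, is_derive t 1 (g i) (d i)) ->
  \sum_(i < 3) d i ^+ 2 <= K ^+ 2.
Proof.
move=> gd.
have D i : h^-1 *: (g i (h *: 1 + t) - g i t) @[h --> 0^'] --> d i.
  by have [dg <-] := gd i; exact: dg.
have lim : \sum_(i < 3) (h^-1 *: (g i (h *: 1 + t) - g i t)) ^+ 2 @[h --> 0^'] -->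
    \sum_(i < 3) d i ^+ 2.
  by apply: cvg_sum => i; apply: cvgM.
rewrite -(cvg_lim _ lim)//; apply: limr_le; first by apply/cvg_ex; eexists; exact: lim.
near=> h.
have h0 : 0 < h ^+ 2.
  by rewrite lt_neqAle sqr_ge0 andbT eq_sym expf_neq0//; near: h; exact: nbhs_dnbhs_neq.
under eq_bigr do rewrite exprMn exprVn.
rewrite -mulr_sumr ler_pdivrMl// mulrC.
by have := gK (h *: 1 + t) t; rewrite addrK [h *: 1]mulr1 exprMn.
Unshelve. all: by end_near. Qed.

Lemma periodic_lipschitz_derivative : exists d : 'I_3 -> R -> R,
  [/\ forall i, measurable_fun [set: R] (d i), forall t, \sum_(i < 3) d i t ^+ 2 <= K ^+ 2 &
   {ae mu, forall t : R, 0 < t < 2 * pi -> forall i, is_derive t 1 (g i) (d i t)}].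
Proof.
have tp : 0 < 2 * pi :> R by rewrite mulr_gt0// pi_gt0.
have hd' i := lipschitz_derivative tp (@gL i).
have /choice[d hd] := hd'.
(* Where the Euclidean bound fails the derivative is reset to 0; by [sqr_derive_le] this happens
   only where some coordinate lacks the derivative [d i t]. *)
pose ok t := \sum_(i < 3) d i t ^+ 2 <= K ^+ 2.
exists (fun i t => if ok t then d i t else 0); split.
- move=> i; have [mdi _ _ _] := hd i; apply: measurable_fun_ifT => //=.
  apply: measurable_fun_ler => //; apply: measurable_sum => j.
  by have [mdj _ _ _] := hd j; exact: measurable_funX.
- move=> t; have [okt|_] := boolP (ok t); first exact: okt.
  by rewrite big1 ?sqr_ge0// => i _; exact: expr0n.
have ae i : {ae mu, forall t : R, 0 < t < 2 * pi -> is_derive t 1 (g i) (d i t)}.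
  by have [] := hd i.
have := ae_forall_ord ae; apply: filterS.
move=> t all t0; have der i := all i t0.
by move=> i; rewrite [ok t](sqr_derive_le der).
Qed.

(** [f] is half of [|g - p|^2 + K^2] as a function of the angle. Summed over the coordinates,
    Wirtinger's inequality bounds the integral of [|g - p|^2] by that of the squared speed, hence by
    [2 pi K^2]. *)
Lemma cone_competitor : exists X : W12 R, exists f : R -> R,
  [/\ is_trace X (fun t => \row_i g i t),
      measurable_fun [set: R] f, (forall t, 0 <= f t),
      (forall u, enorm (cross (W12_d1 X u) (W12_d2 X u)) <= f (ang u)) &
      (\int[mu]_(t in `[0%R, (2 * pi)%R]) (f t)%:E <= (2 * pi * K ^+ 2)%:E)%E].
Proof.
have pi0 := pi_gt0 R; have tp : 0 < 2 * pi :> R by rewrite mulr_gt0.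
have [d [md dK dg]] := periodic_lipschitz_derivative.
have diK i t : `|d i t| <= K.
  rewrite -(@ler_pXn2r _ 2) ?nnegrE// real_normK ?num_real//.
  apply: le_trans (dK t); rewrite (bigD1 i)//= lerDl.
  by apply: sumr_ge0 => j _; exact: sqr_ge0.
have dgi i : {ae mu, forall t : R, 0 < t < 2 * pi -> is_derive t 1 (g i) (d i t)}.
  by move: dg; apply: filterS; [exact: (ae_filter_ringOfSetsType mu)|move=> t h /h].
have hp' i := wirtinger (@gL i) (@gp i) (md i) (diK i) (dgi i).
(* The coordinates [p i] form the vertex; each comes from its own pair of opposite points. *)
have /choice[p hp] := hp'.
pose h i t := g i t - p i.
have hL i s t : `|h i s - h i t| <= K * `|s - t| by rewrite /h opprB addrA subrK; exact: gL.
have hper i t : h i (t + 2 * pi) = h i t by rewrite /h gp.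
have h4 i t : `|h i t| <= 4 * K by have [H _] := hp i; exact: H.
pose F i u := p i + cone (h i) u.
pose D1 i u := cos (ang u) * h i (ang u) - sin (ang u) * d i (ang u).
pose D2 i u := sin (ang u) * h i (ang u) + cos (ang u) * d i (ang u).
have FL i u v : `|F i u - F i v| <= (4 * K + 12 * K) * (`|u.1 - v.1| + `|u.2 - v.2|).
  by rewrite /F opprD addrACA subrr add0r; exact: (cone_lipschitz (hL i) (hper i) (h4 i)).
have mh i : measurable_fun [set: R] (h i).
  by apply: continuous_measurable_fun; exact: lipschitz_continuous (hL i).
have mang (q : R -> R) : measurable_fun [set: R] q -> measurable_fun (setT : set mT) (fun u => q (ang u)).
  by move=> mq; apply: (measurableT_comp mq); exact: measurable_ang.
have mcos : measurable_fun [set: R] (@cos R) by apply: continuous_measurable_fun; exact: continuous_cos.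
have msin : measurable_fun [set: R] (@sin R) by apply: continuous_measurable_fun; exact: continuous_sin.
have mD1 i : measurable_fun (disc R : set mT) (D1 i).
  by apply: measurable_funTS; apply: measurable_funB; apply: measurable_funM; exact: mang.
have mD2 i : measurable_fun (disc R : set mT) (D2 i).
  by apply: measurable_funTS; apply: measurable_funD; apply: measurable_funM; exact: mang.
have tri (c s a b : R) : `|c| <= 1 -> `|s| <= 1 -> `|a| <= 4 * K -> `|b| <= K ->
    `|c * a| + `|s * b| <= 5 * K.
  move=> c1 s1 a1 b1; rewrite !normrM.
  have := ler_piMl (normr_ge0 a) c1; have := ler_piMl (normr_ge0 b) s1; lra.
have D1M i u : `|D1 i u| <= 5 * K.
  by rewrite (le_trans (ler_normB _ _))// tri ?cos_max ?sin_max.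
have D2M i u : `|D2 i u| <= 5 * K.
  by rewrite (le_trans (ler_normD _ _))// tri ?cos_max ?sin_max.
have FD : {ae leb2 R, forall u, disc R u -> forall i (e : R), 0 < e ->
  \forall v \near u, `|F i v - F i u - (D1 i u * (v.1 - u.1) + D2 i u * (v.2 - u.2))| <=
       e * (`|v.1 - u.1| + `|v.2 - u.2|)}.
  have /ae_null[N [mN N0 Ng]] := dg.
  (* Angle 0 is discarded too: the derivative of the curve is controlled only inside []0, 2 pi[],
     and the origin, where the cone need not be differentiable, has angle 0. *)
  have mN' : measurable (N `|` [set 0] : set (measurableTypeR R)) by apply: measurableU.
  have N'0 : mu (N `|` [set 0]) = 0%E.
    by apply: null_set_setU => //; exact: lebesgue_measure_set1.
  have := ang_null mN' N'0; apply: filterS; first exact: (ae_filter_ringOfSetsType (leb2 R)).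
  move=> u hu Bu i e e0; have /not_orP[Nu /= u0] := hu Bu.
  have /andP[a0 a1] := ang_itv u.
  have a0' : 0 < ang u by rewrite lt_neqAle a0 andbT eq_sym; apply/eqP.
  have der : is_derive (ang u) 1 (h i) (d i (ang u)).
    rewrite -[d i _]subr0; apply: is_deriveB; apply: (Ng _ Nu); by rewrite a0'.
  have ru : 0 < rad u.
    rewrite lt_neqAle rad_ge0 andbT eq_sym; apply/eqP => r0; apply: u0.
    have [u1 u2] := polarE u; rewrite r0 !mul0r in u1 u2.
    by rewrite /ang u1 u2 ltxx.
  have := cone_derive (hper i) ru der e0; apply: filterS => v.
  have -> : F i v - F i u = cone (h i) v - cone (h i) u by rewrite /F; ring.
  by [].
have [X [_ X1 X2 Xtr]] := W12_of_lipschitz FL mD1 mD2 D1M D2M FD.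
exists X, (fun t => (\sum_(i < 3) h i t ^+ 2 + K ^+ 2) / 2); split.
- move: Xtr; congr is_trace; apply/funext => t; apply/rowP => i; rewrite !mxE.
  by rewrite /F (cone_circle (hper i)) /h addrC subrK.
- apply: measurable_funM => //; apply: measurable_funD => //; apply: measurable_sum => i.
  exact: measurable_funX.
- by move=> t; rewrite divr_ge0// addr_ge0 ?sqr_ge0// sumr_ge0// => i _; exact: sqr_ge0.
- move=> u; rewrite X1 X2; set t := ang u.
  pose H : 'rV[R]_3 := \row_i h i t; pose D : 'rV[R]_3 := \row_i d i t.
  (* The two partial derivatives arise from the pair [(H, D)] by a rotation through [t], which
     preserves the cross product. *)
  have -> : cross (\row_i D1 i u) (\row_i D2 i u) = cross H D.
    apply/rowP => k; rewrite /cross !mxE /D1 /D2 -/t.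
    transitivity ((cos t ^+ 2 + sin t ^+ 2) * (h (k + 1) t * d (k + 2) t - h (k + 2) t * d (k + 1) t)).
      by ring.
    by rewrite cos2Dsin2 mul1r.
  rewrite (le_trans (enorm_cross_le _ _))// ler_pM2r ?invr_gt0// !enorm_sqr.
  apply: lerD; last first.
    by apply: le_trans (dK t); apply: ler_sum => i _; rewrite mxE.
  by apply: ler_sum => i _; rewrite mxE.
pose I := `[0%R, (2 * pi)%R]%classic : set (measurableTypeR R).
have mI : measurable I by exact: measurable_itv.
have muI : mu I = (2 * pi)%:E by rewrite /I lebesgue_measure_itv/= lte_fin tp sube0.
have Ifin : (mu I < +oo)%E by rewrite muI ltry.
have ih i : mu.-integrable I (EFin \o (fun t => h i t ^+ 2)).
  apply: (bounded_integrable (M := (4 * K) ^+ 2)) => //; first by apply: measurable_funTS; apply: measurable_funX; exact: mh.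
  by move=> t _; rewrite normrX lerXn2r ?nnegrE ?mulr_ge0//.
have id' i : mu.-integrable I (EFin \o (fun t => d i t ^+ 2)).
  apply: (bounded_integrable (M := K ^+ 2)) => //; first by apply: measurable_funTS; apply: measurable_funX; exact: md.
  by move=> t _; rewrite normrX lerXn2r ?nnegrE.
have sumI (q : 'I_3 -> R -> R) : (forall i, mu.-integrable I (EFin \o q i)) ->
    mu.-integrable I (EFin \o (fun t => \sum_(i < 3) q i t)) /\
    \int[mu]_(t in I) (\sum_(i < 3) q i t) = \sum_(i < 3) \int[mu]_(t in I) q i t.
  move=> iq; have -> : (fun t => \sum_(i < 3) q i t) = (fun t => q 0 t + q 1 t + q 2 t).
    by apply/funext => t; rewrite sum_ord3.
  have i01 : mu.-integrable I (EFin \o (fun t => q 0 t + q 1 t)) by have := integrableD mI (iq 0) (iq 1); exact.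
  split; first exact: (integrableD mI i01 (iq 2)).
  by rewrite sum_ord3 (RintegralD mI i01 (iq 2)) (RintegralD mI (iq 0) (iq 1)).
have [isH sH] := sumI _ ih; have [isD sD] := sumI _ id'.
have ic (c : R) : mu.-integrable I (EFin \o cst c).
  by apply: (bounded_integrable (M := `|c|)).
have RI (c : R) : \int[mu]_(t in I) c = c * (2 * pi).
  by rewrite Rintegral_cst//; congr (_ * _); exact: (congr1 fine muI).
have iHK := integrableD mI isH (ic (K ^+ 2)).
have iF : mu.-integrable I (EFin \o (fun t => (\sum_(i < 3) h i t ^+ 2 + K ^+ 2) / 2)).
  by have := integrableZr mI 2^-1 iHK; exact.
rewrite -[leLHS](@fineK R); last exact: integrable_fin_num.
rewrite lee_fin -/(Rintegral _ _ _).
have -> : \int[mu]_(t in I) ((\sum_(i < 3) h i t ^+ 2 + K ^+ 2) / 2) =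
    (\sum_(i < 3) \int[mu]_(t in I) (h i t ^+ 2) + K ^+ 2 * (2 * pi)) / 2.
  rewrite RintegralZr// (RintegralD mI isH (ic (K ^+ 2))) sH.
  by rewrite (RI (K ^+ 2)).
have le1 : \sum_(i < 3) \int[mu]_(t in I) (h i t ^+ 2) <= \sum_(i < 3) \int[mu]_(t in I) (d i t ^+ 2).
  by apply: ler_sum => i _; have [_ H] := hp i; exact: H.
have le2 : \int[mu]_(t in I) (\sum_(i < 3) d i t ^+ 2) <= K ^+ 2 * (2 * pi).
  by rewrite -RI; apply: le_Rintegral => //; exact: (ic (K ^+ 2)).
rewrite -sD in le1.
by rewrite ler_pdivrMr//; have := le_trans le1 le2; lra.
Qed.

End cone_competitor.

(** * Parametrization by arc length *)

Lemma cauchy_schwarz3 (R : realType) (x y : 'I_3 -> R) (A B : R) : 0 <= A -> 0 <= B ->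
  \sum_(i < 3) x i ^+ 2 <= A ^+ 2 -> \sum_(i < 3) y i ^+ 2 <= B ^+ 2 ->
  \sum_(i < 3) x i * y i <= A * B.
Proof.
move=> A0 B0 xA yB; have [|s0] := leP (\sum_(i < 3) x i * y i) 0.
  by move/le_trans; apply; exact: mulr_ge0.
rewrite -(@ler_pXn2r _ 2) ?nnegrE ?mulr_ge0// ?(ltW s0)// exprMn.
have sqs (z : 'I_3 -> R) : 0 <= \sum_(i < 3) z i ^+ 2 by apply: sumr_ge0 => i _; exact: sqr_ge0.
apply: le_trans (ler_pM (sqs x) (sqs y) xA yB); rewrite !sum_ord3 -subr_ge0.
have -> : (x 0 ^+ 2 + x 1 ^+ 2 + x 2 ^+ 2) * (y 0 ^+ 2 + y 1 ^+ 2 + y 2 ^+ 2) -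
    (x 0 * y 0 + x 1 * y 1 + x 2 * y 2) ^+ 2 =
  (x 0 * y 1 - x 1 * y 0) ^+ 2 + (x 1 * y 2 - x 2 * y 1) ^+ 2 + (x 2 * y 0 - x 0 * y 2) ^+ 2 by ring.
by rewrite !addr_ge0// sqr_ge0.
Qed.

Lemma minkowski3 (R : realType) (x y : 'I_3 -> R) (A B : R) : 0 <= A -> 0 <= B ->
  \sum_(i < 3) x i ^+ 2 <= A ^+ 2 -> \sum_(i < 3) y i ^+ 2 <= B ^+ 2 ->
  \sum_(i < 3) (x i + y i) ^+ 2 <= (A + B) ^+ 2.
Proof.
move=> A0 B0 xA yB; have := cauchy_schwarz3 A0 B0 xA yB; move: xA yB.
by rewrite !sum_ord3; lra.
Qed.

Lemma floor_shift (R : realType) (P t : R) : 0 < P ->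
  0 <= t - (Num.floor (t / P))%:~R * P < P.
Proof.
move=> P0; have /andP[] := floor_itv (t / P).
rewrite ler_pdivlMr// ltr_pdivrMr// rmorphD /= mulrDl mul1r => ? ?.
by apply/andP; split; lra.
Qed.

Lemma measurable_speed (R : realType) (d : 'I_3 -> R -> R) :
  (forall i, measurable_fun [set: R] (d i)) ->
  measurable_fun [set: R] (fun t => Num.sqrt (\sum_(i < 3) d i t ^+ 2)).
Proof.
move=> md; apply: (@measurableT_comp _ _ _ _ _ _ (@Num.sqrt R)).
  by apply: continuous_measurable_fun; exact: sqrt_continuous.
by apply: measurable_sum => i; exact: measurable_funX.
Qed.

Lemma speed_le (R : realType) (d : 'I_3 -> R) (L : R) : (forall i, `|d i| <= L) ->
  Num.sqrt (\sum_(i < 3) d i ^+ 2) <= Num.sqrt (3 * L ^+ 2).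
Proof.
move=> dL; apply: ler_wsqrtr; rewrite sum_ord3.
have H i : d i ^+ 2 <= L ^+ 2.
  by rewrite -real_normK ?num_real// lerXn2r ?nnegrE ?(le_trans (normr_ge0 _) (dL i)).
by have := H 0; have := H 1; have := H 2; lra.
Qed.

Section arc_length.
Context {R : realType}.
Notation mu := (@lebesgue_measure R).
Variables (gam d : 'I_3 -> R -> R) (T L e : R).
Hypothesis T0 : 0 < T.
Hypothesis gp : forall i t, gam i (t + T) = gam i t.
Hypothesis ginj : forall s t, 0 <= s < T -> 0 <= t < T -> (forall i, gam i s = gam i t) -> s = t.
Hypothesis md : forall i, measurable_fun [set: R] (d i).
Hypothesis dL : forall i t, `|d i t| <= L.
Hypothesis dI : forall i s t, 0 <= s -> s <= t -> t <= T ->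
  \int[mu]_(x in `[s, t]) d i x = gam i t - gam i s.
Hypothesis e0 : 0 < e.

Let v t := Num.sqrt (\sum_(i < 3) d i t ^+ 2).
(* Adding [e] makes the arc length strictly increasing even where the velocity vanishes. *)
Let w t := v t + e.

Let v0 t : 0 <= v t. Proof. exact: sqrtr_ge0. Qed.

Let mv : measurable_fun [set: R] v.
Proof. exact: measurable_speed. Qed.

Let mw : measurable_fun [set: R] w.
Proof. by apply: measurable_funD. Qed.

Let vL t : v t <= Num.sqrt (3 * L ^+ 2).
Proof. by apply: speed_le => i; exact: dL. Qed.

Let wint a b : mu.-integrable `[a, b] (EFin \o w).
Proof.
apply: (bounded_integrable (M := Num.sqrt (3 * L ^+ 2) + e)) => //.
- by rewrite /= lebesgue_measure_itv/=; case: ifP; rewrite ?ltry// -EFinB ltry.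
- exact: measurable_funTS.
by move=> t _; rewrite ger0_norm ?addr_ge0 ?(ltW e0)// lerD2r.
Qed.

Let S s t := \int[mu]_(x in `[s, t]) w x.

Let S_add a b c : a <= b -> b <= c -> S a c = S a b + S b c.
Proof.
move=> ab bc; rewrite /S -(@Rintegral_itv_obnd_cbnd _ b); last first.
  by apply: integrableS (wint b c) => //; apply: subset_itvr; rewrite bnd_simp.
by rewrite -(Rintegral_itvB (wint a c)) ?bnd_simp// addrC subrK.
Qed.

Let S_ge a b : a <= b -> e * (b - a) <= S a b.
Proof.
move=> ab; have -> : e * (b - a) = \int[mu]_(x in `[a, b]) e.
  rewrite Rintegral_cst//; congr (_ * _).
  by rewrite /= lebesgue_measure_itv/=; case: ifP; rewrite ?lte_fin//= -?EFinB//; move: ab; lra.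
apply: le_Rintegral => //.
  apply: (bounded_integrable (M := `|e|)) => //.
  by rewrite /= lebesgue_measure_itv/=; case: ifP; rewrite ?ltry// -EFinB ltry.
by move=> t _; rewrite lerDr.
Qed.

(** The squared length of the chord vector [a] is the integral of its scalar product with the
    velocity, hence at most [|a|] times the arc length. *)
Let S_chord s t : 0 <= s -> s <= t -> t <= T ->
  \sum_(i < 3) (gam i t - gam i s) ^+ 2 <= S s t ^+ 2.
Proof.
move=> s0 st tT; pose a i := gam i t - gam i s; pose A := Num.sqrt (\sum_(i < 3) a i ^+ 2).
have sq0 : 0 <= \sum_(i < 3) a i ^+ 2 by apply: sumr_ge0 => i _; exact: sqr_ge0.
have AA : A ^+ 2 = \sum_(i < 3) a i ^+ 2 by rewrite sqr_sqrtr.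
have A0 : 0 <= A by exact: sqrtr_ge0.
have Sst : 0 <= S s t by apply: le_trans (S_ge st); rewrite mulr_ge0 ?subr_ge0 ?(ltW e0).
rewrite -/(a _) -AA lerXn2r ?nnegrE//.
have mst : measurable (`[s, t]%classic : set (measurableTypeR R)) by exact: measurable_itv.
have fin : (mu `[s, t] < +oo)%E.
  by rewrite /= lebesgue_measure_itv/=; case: ifP; rewrite ?ltry// -EFinB ltry.
have id i : mu.-integrable `[s, t] (EFin \o d i).
  by apply: (bounded_integrable (M := L)) => //; exact: measurable_funTS (md i).
have iad i : mu.-integrable `[s, t] (EFin \o (fun x => a i * d i x)).
  by have := integrableZl mst (a i) (id i); exact.
have E : A ^+ 2 = \int[mu]_(x in `[s, t]) (a 0 * d 0 x + a 1 * d 1 x + a 2 * d 2 x).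
  have i01 : mu.-integrable `[s, t] (EFin \o (fun x => a 0 * d 0 x + a 1 * d 1 x)).
    by have := integrableD mst (iad 0) (iad 1); exact.
  rewrite (RintegralD mst i01 (iad 2)) (RintegralD mst (iad 0) (iad 1)).
  by rewrite !RintegralZl// !dI// AA sum_ord3 !expr2.
have le : A ^+ 2 <= A * S s t.
  rewrite {1}E /S -RintegralZl//; apply: le_Rintegral => //.
  - have i01 : mu.-integrable `[s, t] (EFin \o (fun x => a 0 * d 0 x + a 1 * d 1 x)).
      by have := integrableD mst (iad 0) (iad 1); exact.
    by have := integrableD mst i01 (iad 2); exact.
  - by have := integrableZl mst A (wint s t); exact.
  move=> x _; rewrite -(sum_ord3 (fun i => a i * d i x)).
  apply: cauchy_schwarz3 => //; first by rewrite addr_ge0// ltW.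
    by rewrite AA.
  rewrite (@le_trans _ _ (v x ^+ 2))//.
    by rewrite sqr_sqrtr// sumr_ge0// => i _; exact: sqr_ge0.
  by rewrite lerXn2r ?nnegrE ?addr_ge0 ?(ltW e0)// lerDl ltW.
have [->//|An] := eqVneq A 0.
by move: le; rewrite expr2 ler_pM2l// lt_neqAle eq_sym An.
Qed.

Let Len := \int[mu]_(t in `[0, T]) v t + e * T.

Let LenE : S 0 T = Len.
Proof.
have fin : (mu `[0%R, T] < +oo)%E.
  by rewrite /= lebesgue_measure_itv/=; case: ifP; rewrite ?ltry// -EFinB ltry.
rewrite /S /Len RintegralD//.
- rewrite Rintegral_cst//; congr (_ + e * _).
  by rewrite /= lebesgue_measure_itv/= lte_fin T0 -EFinB/= subr0.
- apply: (bounded_integrable (M := Num.sqrt (3 * L ^+ 2))) => //; first exact: measurable_funTS.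
  by move=> t _; rewrite ger0_norm.
- exact: (bounded_integrable (M := `|e|)).
Qed.

Let Len0 : 0 < Len.
Proof. by rewrite -LenE (lt_le_trans _ (S_ge (ltW T0)))// subr0 mulr_gt0. Qed.

Let K := Len / (2 * pi).

Let tp : 0 < 2 * pi :> R. Proof. by rewrite mulr_gt0// pi_gt0. Qed.

Let K0 : 0 < K. Proof. by rewrite divr_gt0. Qed.

Let S00 : S 0 0 = 0.
Proof. by rewrite /S set_itv1 Rintegral_set1. Qed.

Let S_inj s t : 0 <= s -> 0 <= t -> S 0 s = S 0 t -> s = t.
Proof.
wlog st : s t / s <= t => [H|s0 t0].
  by move=> s0 t0 E; have [/H|/ltW/H] := leP s t; [exact|move=> H'; apply/esym/H'].
rewrite (S_add s0 st) => E; have := S_ge st.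
have -> : S s t = 0 by lra.
by rewrite pmulr_rle0// subr_le0 => ts; apply/eqP; rewrite eq_le st.
Qed.

(** The inverse [sig] of the rescaled arc length comes from the intermediate value theorem and
    choice; [S_inj] makes it unambiguous. [S_chord] gives the Lipschitz bound within a period. *)
Lemma arc_length_reparametrization : exists g : 'I_3 -> R -> R,
  [/\ forall s t, \sum_(i < 3) (g i s - g i t) ^+ 2 <= (K * (s - t)) ^+ 2,
      forall i t, g i (t + 2 * pi) = g i t,
      forall s t, 0 <= s < 2 * pi -> 0 <= t < 2 * pi -> (forall i, g i s = g i t) -> s = t,
      forall s, exists t, forall i, g i s = gam i t &
      forall t, exists s, forall i, g i s = gam i t].
Proof.
(* Outside [[0, 2 pi]] the value of [sig] is arbitrary. *)
have sig0 (x : R) : exists t, 0 <= x <= 2 * pi -> [/\ 0 <= t, t <= T & S 0 t = K * x].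
  have [x01|nx] := boolP (0 <= x <= 2 * pi); last by exists 0.
  have KT : K * (2 * pi) = Len by rewrite /K divfK// gt_eqF.
  have h : Num.min (S 0 0) (S 0 T) <= K * x <= Num.max (S 0 0) (S 0 T).
    rewrite S00 LenE (min_idPl (ltW Len0)) (max_idPr (ltW Len0)) -KT.
    move/andP: x01 => [x0 x1]; rewrite ler_pM2l// x1 andbT.
    by rewrite mulr_ge0// ltW.
  have [t] := @IVT R (fun t => S 0 t) 0 T (K * x) (ltW T0)
     (parameterized_integral_continuous (ltW T0) (wint 0 T)) h.
  by rewrite in_itv /= => /andP[t0 tT] E; exists t.
have /choice[sig hsig] := sig0.
have sig_0 : sig 0 = 0.
  have [|a b E] := hsig 0; first by rewrite lexx ltW.
  by apply: S_inj => //; rewrite E mulr0 S00.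
have sig_T : sig (2 * pi) = T.
  have [|a b E] := hsig (2 * pi); first by rewrite lexx ltW.
  by apply: S_inj => //; rewrite ?(ltW T0)// E LenE /K divfK// gt_eqF.
pose g0 i x := gam i (sig x).
have g0per i : g0 i (2 * pi) = g0 i 0 by rewrite /g0 sig_0 sig_T -[T]add0r gp.
have g0K s t : 0 <= s -> s <= t -> t <= 2 * pi ->
    \sum_(i < 3) (g0 i t - g0 i s) ^+ 2 <= (K * (t - s)) ^+ 2.
  move=> s0 st t1.
  have [|s0' sT Es] := hsig s; first by rewrite s0 (le_trans st).
  have [|t0' tT Et] := hsig t; first by rewrite t1 (le_trans s0).
  have [sle|/ltW tle] := leP (sig s) (sig t).
    apply: le_trans (S_chord s0' sle tT) _.
    have := S_add s0' sle; rewrite Es Et => E.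
    by rewrite (_ : S _ _ = K * (t - s))//; move: E; lra.
  have := S_chord t0' tle sT.
  have := S_add t0' tle; rewrite Es Et => E.
  rewrite (_ : S _ _ = - (K * (t - s))); last by move: E; lra.
  by rewrite sqrrN; under eq_bigr do rewrite -sqrrN opprB.
pose fl (t : R) : R := (Num.floor (t / (2 * pi)))%:~R.
pose red t := t - fl t * (2 * pi).
have redP t : 0 <= red t < 2 * pi by exact: floor_shift.
have red_id t : 0 <= t < 2 * pi -> red t = t.
  move=> /andP[t0 t1]; rewrite /red /fl (_ : Num.floor _ = 0) ?mul0r ?subr0//.
  apply: floor_def; rewrite add0r /= divr_ge0 ?(ltW tp)//=.
  by rewrite ltr_pdivrMr// mul1r.
exists (fun i t => g0 i (red t)); split.
- move=> s t; wlog st : s t / s <= t => [H|].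
    have [/H//|/ltW/H ts] := leP s t.
    by under eq_bigr do rewrite -sqrrN opprB; rewrite -sqrrN -mulrN opprB.
  have /andP[s0 s1] := redP s; have /andP[t0 t1] := redP t.
  have fst : fl s <= fl t.
    by rewrite ler_int; apply: le_floor; rewrite ler_pM2r// invr_gt0.
  under eq_bigr do rewrite -sqrrN opprB; rewrite -sqrrN -mulrN opprB.
  have sE : s = red s + fl s * (2 * pi) by rewrite subrK.
  have tE : t = red t + fl t * (2 * pi) by rewrite subrK.
  have [fE|] := eqVneq (fl s) (fl t).
    have rst : red s <= red t by rewrite /red fE lerD2r.
    rewrite (_ : t - s = red t - red s); last by rewrite /red fE; ring.
    by apply: g0K => //; exact: ltW.
  (* When [s] and [t] lie in different periods, the chord is cut at the base point, which is both
     [g0 i 0] and [g0 i (2 * pi)], and the two bounds are added by Minkowski's inequality. *)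
  move=> fne; have f1 : fl s + 1 <= fl t.
    move: fne fst; rewrite /fl eqr_int ler_int => fne fst.
    by rewrite -[1]/(1%:~R) -rmorphD /= ler_int lezD1 lt_neqAle fne.
  apply: (@le_trans _ _ ((K * (red t - 0) + K * (2 * pi - red s)) ^+ 2)).
    rewrite (eq_bigr (fun i => ((g0 i (red t) - g0 i 0) + (g0 i (2 * pi) - g0 i (red s))) ^+ 2)).
      apply: minkowski3.
      - by rewrite subr0 mulr_ge0 ?(ltW K0).
      - by rewrite mulr_ge0 ?(ltW K0)// subr_ge0 ltW.
      - by apply: g0K => //; exact: ltW.
      - by apply: g0K => //; exact: ltW.
    by move=> i _; rewrite g0per; congr (_ ^+ 2); ring.
  have a0 : 0 <= red t - 0 + (2 * pi - red s) by move: s0 s1 t0 t1; lra.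
  have b0 : 0 <= t - s by rewrite subr_ge0.
  rewrite -mulrDr lerXn2r ?nnegrE ?(mulr_ge0 (ltW K0) a0) ?(mulr_ge0 (ltW K0) b0)//.
  rewrite ler_pM2l//.
  have : 0 <= (fl t - (fl s + 1)) * (2 * pi) by rewrite mulr_ge0 ?subr_ge0// ltW.
  have -> : t - s = red t - red s + (fl t - fl s) * (2 * pi) by rewrite /red; ring.
  move: (fl t) (fl s) (red t) (red s) (@pi R) => f1' f2 r1 r2 p; lra.
- move=> i t; congr (g0 i _); rewrite /red /fl.
  have -> : (t + 2 * pi) / (2 * pi) = t / (2 * pi) + 1 by rewrite [LHS]mulrDl divff ?gt_eqF.
  rewrite floorDrz; last exact: (intr_int R 1).
  by rewrite floor1 rmorphD /=; ring.
- move=> s t s01 t01 H; have := s01; have := t01.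
  rewrite -(red_id _ s01) -(red_id _ t01) => _ _.
  have [|s0' sT Es] := hsig s; first by move/andP: s01 => [-> /ltW].
  have [|t0' tT Et] := hsig t; first by move/andP: t01 => [-> /ltW].
  have lt x : 0 <= x < 2 * pi -> 0 <= sig x < T.
    move=> /andP[x0 x1]; have [|x0' xT Ex] := hsig x; first by rewrite x0 ltW.
    rewrite x0' lt_neqAle xT andbT; apply/eqP => xE.
    move: Ex; rewrite xE LenE => Ex.
    have : K * (2 * pi) = K * x by rewrite -Ex /K divfK// gt_eqF.
    by move/(mulfI (lt0r_neq0 K0)) => X; move: x1; rewrite X ltxx.
  have sst : sig s = sig t.
    apply: ginj; [exact: lt|exact: lt|].
    by move=> i; have := H i; rewrite (red_id _ s01) (red_id _ t01).
  rewrite (red_id _ s01) (red_id _ t01).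
  by apply: (mulfI (lt0r_neq0 K0)); rewrite -Es -Et sst.
- by move=> s; exists (sig (red s)).
- move=> t; have /andP[r0 r1] := floor_shift t T0.
  set r := t - _ in r0 r1.
  have rE i : gam i r = gam i t by rewrite /r -mulNr -rmorphN periodic_int.
  pose x := S 0 r / K.
  have x01 : 0 <= x < 2 * pi.
    have S0r : 0 <= S 0 r by apply: le_trans (S_ge r0); rewrite subr0; exact: mulr_ge0 (ltW e0) r0.
    rewrite divr_ge0 ?(ltW K0)//= ltr_pdivrMr// mulrC /K divfK ?gt_eqF//.
    rewrite -LenE (S_add r0 (ltW r1)) ltrDl (lt_le_trans _ (S_ge (ltW r1)))//.
    by rewrite mulr_gt0// subr_gt0.
  exists x => i; rewrite (red_id _ x01) /g0 -rE; congr (gam i _).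
  have [|x0' xT Ex] := hsig x; first by move/andP: x01 => [-> /ltW].
  apply: S_inj => //; rewrite Ex /x mulrC divfK// gt_eqF//.
Qed.

End arc_length.

(** * The isodiametric inequality and Hausdorff measure *)

Lemma lebesgue_le_itv (R : realType) (A : set (measurableTypeR R)) (a b : R) : measurable A ->
  a <= b -> A `<=` `[a, b]%classic -> (@lebesgue_measure R A <= (b - a)%:E)%E.
Proof.
move=> mA ab Aab; apply: (@le_trans _ _ (@lebesgue_measure R `[a, b]%classic)).
  by apply: le_measure; rewrite ?inE//; exact: measurable_itv.
by rewrite /= lebesgue_measure_itv /= lte_fin; case: ifP => //= _; rewrite lee_fin subr_ge0.
Qed.

Lemma lebesgue_diam_le (R : realType) (A : set (measurableTypeR R)) (D : R) : measurable A ->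
  0 <= D -> (forall x y : R, A x -> A y -> `|x - y| <= D) -> (@lebesgue_measure R A <= D%:E)%E.
Proof.
move=> mA D0 AD; have [->|/set0P[a Aa]] := eqVneq A set0; first by rewrite measure0 lee_fin.
have lbA x : A x -> lbound A (x - D).
  by move=> Ax y Ay; have := AD x y Ax Ay; rewrite ler_norml => /andP[_ ?]; lra.
have hA : has_inf A by split; [exists a|exists (a - D); exact: lbA].
rewrite -[D in leRHS](_ : inf A + D - inf A = D); last by rewrite addrAC subrr add0r.
apply: lebesgue_le_itv => //; first by rewrite lerDl.
move=> x Ax /=; rewrite in_itv /= (ge_inf hA.2 Ax) /= -lerBlDr.
by apply: lb_le_inf; [exists a|exact: lbA].
Qed.

(* One of the sets lies in [inf A, sup A], the other in [sup A - D, inf A + D]. *)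
Lemma lebesgue_dist_le (R : realType) (A B : set (measurableTypeR R)) (D : R) :
  measurable A -> measurable B -> A !=set0 -> B !=set0 ->
  (forall x y : R, A x -> B y -> `|x - y| <= D) ->
  (@lebesgue_measure R A + @lebesgue_measure R B <= (2 * D)%:E)%E.
Proof.
move=> mA mB [a Aa] [b Bb] AB.
have hiA : has_inf A.
  by split; [exists a|exists (b - D)] => // x Ax; have := AB x b Ax Bb; rewrite ler_norml => /andP[? _]; lra.
have hsA : has_sup A.
  by split; [exists a|exists (b + D)] => // x Ax; have := AB x b Ax Bb; rewrite ler_norml => /andP[_ ?]; lra.
have isA : inf A <= sup A by exact: le_trans (ge_inf hiA.2 Aa) (ub_le_sup hsA.2 Aa).
have BI y : B y -> sup A - D <= y <= inf A + D.
  move=> By; apply/andP; split.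
    rewrite lerBlDr; apply: ge_sup; first by exists a.
    by move=> x Ax; have := AB x y Ax By; rewrite ler_norml => /andP[_ ?]; lra.
  rewrite -lerBlDr; apply: lb_le_inf; first by exists a.
  by move=> x Ax; have := AB x y Ax By; rewrite ler_norml => /andP[? _]; lra.
have -> : (2 * D)%:E = ((sup A - inf A)%:E + (inf A + D - (sup A - D))%:E)%E.
  by rewrite -EFinD; congr EFin; ring.
apply: leeD; apply: lebesgue_le_itv => //.
- by move=> x Ax /=; rewrite in_itv /= (ge_inf hiA.2 Ax) (ub_le_sup hsA.2 Ax).
- by have /andP[h1 h2] := BI b Bb; exact: le_trans h1 h2.
Qed.

Section isodiametric.
Context {R : realType}.
Notation mT := (measurableTypeR R * measurableTypeR R)%type.
Notation mu := (@lebesgue_measure R).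

Definition plane_disc (r : R) : set (R * R) := [set u | u.1 ^+ 2 + u.2 ^+ 2 < r ^+ 2].

Lemma measurable_plane_disc r : measurable (plane_disc r : set mT).
Proof.
apply: open_measurable2.
rewrite (_ : plane_disc r = (fun u : R * R => u.1 ^+ 2 + u.2 ^+ 2) @^-1` `]-oo, r ^+ 2[%classic); last first.
  by apply/seteqP; split => u /=; rewrite in_itv.
apply: open_comp => [u _|]; last exact: interval_open.
by apply: cvgD; apply: cvgM; (exact: cvg_fst || exact: cvg_snd).
Qed.

Lemma leb2_xsection (A : set mT) : leb2 R A = (\int[mu]_x mu (xsection A x))%E.
Proof. by []. Qed.

(** [leb2] is defined by slicing along one axis; uniqueness of the product measure gives the other
    axis. Steiner symmetrization uses the first slicing, the comparison with the disc the second. *)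
Lemma leb2_ysection (A : set mT) : measurable A -> leb2 R A = (\int[mu]_y mu (ysection A y))%E.
Proof.
move=> mA; apply: (@product_measure_unique _ _ _ _ _ mu mu (mu \x^ mu)%E) mA => A1 A2 m1 m2.
exact: product_measure2E.
Qed.

Lemma disc_section (r x : R) :
  mu [set y | x ^+ 2 + y ^+ 2 < r ^+ 2] = (2 * Num.sqrt (r ^+ 2 - x ^+ 2))%:E.
Proof.
have [rx|xr] := leP (r ^+ 2) (x ^+ 2).
  rewrite (ler0_sqrtr) ?subr_le0// mulr0 (_ : [set y | _] = set0) ?measure0//.
  by apply/seteqP; split => // y /=; have := sqr_ge0 y; lra.
set s := Num.sqrt _; have s0 : 0 < s by rewrite sqrtr_gt0 subr_gt0.
have ss : s ^+ 2 = r ^+ 2 - x ^+ 2 by rewrite sqr_sqrtr// subr_ge0 ltW.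
rewrite (_ : [set y | _] = `]- s, s[%classic); last first.
  apply/seteqP; split => y /=; rewrite in_itv /=.
    by move=> h; rewrite -ltr_norml -(@ltr_pXn2r _ 2) ?nnegrE ?(ltW s0)// real_normK ?num_real// ss; lra.
  rewrite -ltr_norml -(@ltr_pXn2r _ 2) ?nnegrE ?(ltW s0)// real_normK ?num_real// ss; lra.
rewrite lebesgue_measure_itv /= lte_fin gtrN// -EFinB; congr EFin; ring.
Qed.

(** Scaling is all that is required: the area of the unit disc cancels in [hausdorff2_plane_ge]. *)
Lemma leb2_plane_disc (r : R) : 0 < r ->
  leb2 R (plane_disc r) = ((r ^+ 2)%:E * leb2 R (plane_disc 1))%E.
Proof.
move=> r0.
have E s : leb2 R (plane_disc s) = (\int[mu]_x (2 * Num.sqrt (s ^+ 2 - x ^+ 2))%:E)%E.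
  rewrite leb2_xsection; apply: eq_integral => x _; rewrite -disc_section; congr (mu _).
  by apply/seteqP; split => y; rewrite /xsection /= inE.
have cG s : continuous (fun x : R => 2 * Num.sqrt (s ^+ 2 - x ^+ 2)).
  move=> x; apply: cvgM; first exact: cvg_cst.
  apply: (@continuous_comp _ _ _ (fun x : R => s ^+ 2 - x ^+ 2) Num.sqrt); last exact: sqrt_continuous.
  by apply: cvgB; [exact: cvg_cst|apply: cvgM; exact: cvg_id].
have dF : (fun x : R => r * x)^`()%classic = cst r.
  apply/funext => x; rewrite derive1E -[fun z => _]/(r *: (id : R -> R)) derive_val.
  by rewrite [LHS]mulr1.
rewrite (E r) (@increasing_ge0_integration_by_substitutionT _ (fun x => r * x)).
- rewrite E -ge0_integralZl//.
  + apply: eq_integral => x _; rewrite dF /= -EFinM; congr EFin.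
    rewrite -[LHS]/(2 * Num.sqrt (r ^+ 2 - (r * x) ^+ 2) * r).
    rewrite exprMn -[X in Num.sqrt (X - _)]mulr1 -mulrBr sqrtrM ?sqr_ge0// sqrtr_sqr gtr0_norm//.
    by rewrite expr1n; ring.
  + by apply/measurable_EFinP; apply: continuous_measurable_fun; exact: cG.
  + by rewrite lee_fin sqr_ge0.
- by move=> x y xy; rewrite ltr_pM2l.
- by rewrite dF; exact: cst_continuous.
- by rewrite dF; exact: is_cvg_cst.
- by rewrite dF; exact: is_cvg_cst.
- by move=> x; rewrite -[fun z => _]/(r *: (id : R -> R)); apply: derivableZ.
- by apply: gt0_cvgMrNy => //; exact: cvg_id.
- by apply: gt0_cvgMry => //; exact: cvg_id.
- exact: cG.
- by move=> x; rewrite mulr_ge0// sqrtr_ge0.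
Qed.

(* Steiner symmetrization with respect to the first axis, followed by a comparison of the
   horizontal slices with those of the disc. *)
Lemma isodiametric (B : set mT) (d : R) : measurable B -> 0 <= d ->
  (forall p q : R * R, B p -> B q -> (p.1 - q.1) ^+ 2 + (p.2 - q.2) ^+ 2 <= d ^+ 2) ->
  (leb2 R B <= leb2 R (plane_disc (d / 2)))%E.
Proof.
move=> mB d0 Bd; pose l x : R := fine (mu (xsection B x)).
have mBx x : measurable (xsection B x) by exact: measurable_xsection.
have lE x : mu (xsection B x) = (l x)%:E.
  rewrite /l fineK// ge0_fin_numE// (@le_lt_trans _ _ d%:E)// ?ltry//.
  apply: lebesgue_diam_le => // y1 y2; rewrite /xsection /= !inE => B1 B2.
  rewrite -(@ler_pXn2r _ 2) ?nnegrE// real_normK ?num_real//.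
  by have := Bd _ _ B1 B2; rewrite /= subrr expr0n add0r.
have l0 x : 0 <= l x by rewrite -lee_fin -lE.
have ml : measurable_fun [set: R] l.
  apply/measurable_EFinP; rewrite (_ : EFin \o l = (fun x => mu (xsection B x))).
    exact: measurable_fun_xsection.
  by apply/funext => x; rewrite lE.
(* Each vertical slice of [B] is replaced by a centred open interval of the same length. As the
   inequality is strict, a nonempty slice of [S1] comes from a nonempty slice of [B]. *)
pose S1 : set mT := [set u | 2 * `|u.2| - l u.1 < 0].
have mS1 : measurable S1.
  have mf : measurable_fun (setT : set mT) (fun u : mT => 2 * `|u.2| - l u.1).
    apply: measurable_funB; last by apply: measurableT_comp => //; exact: measurable_fst.
    apply: measurable_funM => //; apply: measurableT_comp => //; exact: measurable_snd.
  have := mf measurableT _ (measurable_itv `]-oo, 0[); rewrite setTI.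
  by congr measurable; apply/seteqP; split => u /=; rewrite in_itv.
have -> : leb2 R B = leb2 R S1.
  rewrite !leb2_xsection; apply: eq_integral => x _; rewrite lE.
  rewrite (_ : xsection S1 x = `]- (l x / 2), l x / 2[%classic).
    rewrite lebesgue_measure_itv /= lte_fin; have := l0 x; rewrite le_eqVlt => /orP[/eqP <-|lx].
      by rewrite mul0r oppr0 ltxx.
    by rewrite gtrN ?divr_gt0// -EFinB; congr EFin; lra.
  apply/seteqP; split => y; rewrite /xsection /= inE /S1 /= in_itv /= -ltr_norml; lra.
rewrite !leb2_ysection//; last exact: measurable_plane_disc.
apply: ge0_le_integral => //=.
- exact: measurable_fun_ysection.
- by apply: measurable_fun_ysection; exact: measurable_plane_disc.
move=> y _.
have -> : ysection (plane_disc (d / 2)) y = [set x | y ^+ 2 + x ^+ 2 < (d / 2) ^+ 2].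
  by apply/seteqP; split => x; rewrite /ysection /= inE /plane_disc /= addrC.
rewrite disc_section; apply: lebesgue_diam_le => //; first exact: measurable_ysection.
move=> x1 x2; rewrite /ysection /= !inE /S1 /= => h1 h2.
have ne x : 2 * `|y| - l x < 0 -> xsection B x !=set0.
  move=> h; apply/set0P/eqP => B0; move: h; rewrite /l B0 measure0 /=.
  by have := normr_ge0 y; lra.
have [b1 B1] := ne _ h1; have [b2 B2] := ne _ h2; move: B1 B2; rewrite /xsection /= !inE => B1 B2.
(* Points of [B] above [x1] and [x2] differ in height by at most [D], so [l x1 + l x2 <= 2 D] and
   therefore [2 |y| <= D]. This bounds [|x1 - x2|] by the width of the disc of diameter [d] at
   height [y]. *)
pose D := Num.sqrt (d ^+ 2 - (x1 - x2) ^+ 2).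
have D2 : D ^+ 2 = d ^+ 2 - (x1 - x2) ^+ 2.
  rewrite sqr_sqrtr// subr_ge0; apply: le_trans (Bd _ _ B1 B2) => /=.
  by rewrite lerDl sqr_ge0.
have D0 : 0 <= D by exact: sqrtr_ge0.
have := @lebesgue_dist_le R _ _ D (mBx x1) (mBx x2) (ne _ h1) (ne _ h2).
rewrite !lE -EFinD lee_fin => H.
have yD : 2 * `|y| <= D.
  suff : l x1 + l x2 <= 2 * D by move: h1 h2; lra.
  apply: H => y1 y2; rewrite /xsection /= !inE => C1 C2.
  rewrite -(@ler_pXn2r _ 2) ?nnegrE// real_normK ?num_real// D2.
  by have := Bd _ _ C1 C2; rewrite /=; lra.
rewrite -(@ler_pXn2r _ 2) ?nnegrE ?mulr_ge0 ?sqrtr_ge0// real_normK ?num_real//.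
have y2 : 4 * y ^+ 2 <= D ^+ 2.
  by rewrite -[y ^+ 2]real_normK ?num_real//; have := normr_ge0 y; nra.
rewrite exprMn sqr_sqrtr; move: y2; rewrite D2; first by lra.
by have := sqr_ge0 (x1 - x2); lra.
Qed.

End isodiametric.

Definition row3 (R : realType) (a b c : R) : 'rV[R]_3 := \row_i nth 0 [:: a; b; c] i.

(** An orthonormal basis of the plane orthogonal to [Z]: a horizontal vector orthogonal to [Z], and
    the cross product of [Z] with it, normalized. For vertical [Z] the first two coordinate vectors
    serve. *)
Lemma plane_isometry (R : realType) (Z : 'rV[R]_3) : Z != 0 ->
  exists2 Q : R * R -> 'rV[R]_3, (forall p, dotp (Q p) Z = 0) &
    forall p q, enorm (Q p - Q q) ^+ 2 = (p.1 - q.1) ^+ 2 + (p.2 - q.2) ^+ 2 /\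
      enorm (Q p) ^+ 2 = p.1 ^+ 2 + p.2 ^+ 2.
Proof.
move=> Z0.
suff [e1 [e2 [e1Z e2Z e11 e12 e22]]] : exists e1 e2 : 'rV[R]_3, [/\ dotp e1 Z = 0, dotp e2 Z = 0,
    dotp e1 e1 = 1, dotp e1 e2 = 0 & dotp e2 e2 = 1].
  have E a b : enorm (a *: e1 + b *: e2) ^+ 2 = a ^+ 2 + b ^+ 2.
    have -> : a ^+ 2 + b ^+ 2 = a ^+ 2 * dotp e1 e1 + 2 * a * b * dotp e1 e2 + b ^+ 2 * dotp e2 e2.
      by rewrite e11 e12 e22; ring.
    by rewrite enorm_sqr /dotp !sum_ord3 !mxE; ring.
  exists (fun p => p.1 *: e1 + p.2 *: e2) => [p|p q].
    have -> : dotp (p.1 *: e1 + p.2 *: e2) Z = p.1 * dotp e1 Z + p.2 * dotp e2 Z.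
      by rewrite /dotp !sum_ord3 !mxE; ring.
    by rewrite e1Z e2Z !mulr0 addr0.
  rewrite -!E; split => //; congr (enorm _ ^+ 2).
  by rewrite opprD addrACA -!scalerBl.
have [/andP[/eqP z0 /eqP z1]|z01] := boolP ((Z 0 0 == 0) && (Z 0 1 == 0)).
  exists (row3 1 0 0), (row3 0 1 0); rewrite /dotp !sum_ord3 !mxE /= z0 z1.
  by split; ring.
have sp : 0 < Z 0 0 ^+ 2 + Z 0 1 ^+ 2.
  rewrite lt_neqAle addr_ge0 ?sqr_ge0// andbT eq_sym paddr_eq0 ?sqr_ge0//.
  by rewrite !sqrf_eq0.
set s := Num.sqrt (Z 0 0 ^+ 2 + Z 0 1 ^+ 2).
set m := Num.sqrt (Z 0 0 ^+ 2 + Z 0 1 ^+ 2 + Z 0 2 ^+ 2).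
have s0 : s != 0 by rewrite gt_eqF// sqrtr_gt0.
have m0 : m != 0 by rewrite gt_eqF// sqrtr_gt0 ltr_wpDr// sqr_ge0.
have ss : s ^+ 2 = Z 0 0 ^+ 2 + Z 0 1 ^+ 2 by rewrite sqr_sqrtr// ltW.
have mm : m ^+ 2 = s ^+ 2 + Z 0 2 ^+ 2 by rewrite ss sqr_sqrtr// addr_ge0 ?sqr_ge0// ltW.
exists (row3 (- Z 0 1 / s) (Z 0 0 / s) 0).
exists (row3 (- (Z 0 0 * Z 0 2) / (s * m)) (- (Z 0 1 * Z 0 2) / (s * m)) (s ^+ 2 / (s * m))).
rewrite /dotp !sum_ord3 !mxE /=.
move: (Z 0 0) (Z 0 1) (Z 0 2) s m s0 m0 ss mm => x y z s m s0 m0 ss mm; split.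
- by field.
- have -> : - (x * z) / (s * m) * x + - (y * z) / (s * m) * y + s ^+ 2 / (s * m) * z =
    z * (s ^+ 2 - (x ^+ 2 + y ^+ 2)) / (s * m) by field; rewrite s0 m0.
  by rewrite ss subrr mulr0 mul0r.
- have -> : - y / s * (- y / s) + x / s * (x / s) + 0 * 0 = (x ^+ 2 + y ^+ 2) / s ^+ 2 by field.
  by rewrite -ss divff// sqrf_eq0.
- by field; rewrite s0 m0.
- have -> : - (x * z) / (s * m) * (- (x * z) / (s * m)) + - (y * z) / (s * m) * (- (y * z) / (s * m)) +
      s ^+ 2 / (s * m) * (s ^+ 2 / (s * m)) =
    (z ^+ 2 * (x ^+ 2 + y ^+ 2) + s ^+ 2 * s ^+ 2) / (s ^+ 2 * m ^+ 2) by field; rewrite s0 m0.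
  rewrite -ss (_ : z ^+ 2 * s ^+ 2 + _ = s ^+ 2 * m ^+ 2); last by rewrite mm; ring.
  by rewrite divff// mulf_neq0// expf_neq0.
Qed.

Section hausdorff_measure_of_planar_sets.
Context {R : realType}.
Notation mT := (measurableTypeR R * measurableTypeR R)%type.

(** The sets of a Hausdorff cover need not be measurable. Their closures are, and by this lemma they
    obey the same bound on the diameter. *)
Lemma closure_diam (A : set (R * R)) (d : R) :
  (forall p q, A p -> A q -> (p.1 - q.1) ^+ 2 + (p.2 - q.2) ^+ 2 <= d) ->
  forall p q, closure A p -> closure A q -> (p.1 - q.1) ^+ 2 + (p.2 - q.2) ^+ 2 <= d.
Proof.
have cl (q : R * R) : closed [set p : R * R | (p.1 - q.1) ^+ 2 + (p.2 - q.2) ^+ 2 <= d].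
  rewrite (_ : [set p | _] =
      (fun p : R * R => (p.1 - q.1) ^+ 2 + (p.2 - q.2) ^+ 2) @^-1` `]-oo, d]%classic); last first.
    by apply/seteqP; split => u /=; rewrite in_itv.
  apply: preimage_closed => [u _|]; last exact: interval_closed.
  by apply: cvgD; apply: cvgM; apply: cvgB; (exact: cvg_fst || exact: cvg_snd || exact: cvg_cst).
have sub (B C : set (R * R)) : closed C -> B `<=` C -> closure B `<=` C.
  by move=> cC BC; rewrite closureEbigcap => p; apply; split.
have sym (p q : R * R) : (p.1 - q.1) ^+ 2 + (p.2 - q.2) ^+ 2 = (q.1 - p.1) ^+ 2 + (q.2 - p.2) ^+ 2.
  by ring.
move=> Ad p q pA qA.
apply: (sub _ _ (cl q) _ p pA) => p' p'A /=; rewrite sym.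
by apply: (sub _ _ (cl p') _ q qA) => q' q'A /=; exact: Ad.
Qed.

Lemma plane_disc1 : plane_disc (1 : R) = disc R.
Proof. by apply/seteqP; split => u; rewrite /plane_disc /disc /= expr1n. Qed.

Lemma leb2_disc_gt0 : (0 < leb2 R (disc R))%E.
Proof.
pose Q : set mT := `[0, 2^-1]%classic `*` `[0, 2^-1]%classic.
have h : (leb2 R Q <= leb2 R (disc R))%E.
  apply: le_measure; rewrite ?inE; [by apply: measurableX; exact: measurable_itv|exact: measurable_disc|].
  by move=> u [] /=; rewrite !in_itv /= => /andP[? ?] /andP[? ?]; rewrite /disc /=; nra.
apply: lt_le_trans h.
have -> : leb2 R Q = (lebesgue_measure (`[0%R, 2^-1%R]%classic : set R) *
     lebesgue_measure (`[0%R, 2^-1%R]%classic : set R))%E.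
  by apply: product_measure1E; exact: measurable_itv.
by rewrite /= lebesgue_measure_itv /= lte_fin invr_gt0 ltr0n -EFinB -EFinM lte_fin subr0 mulr_gt0// invr_gt0.
Qed.

(** A cover of [A] pulls back along the isometry [Q] to a cover of a planar disc of radius [r]. By
    the isodiametric inequality each closed piece has at most the area of a disc of the same
    diameter, and subadditivity concludes. *)
Lemma hausdorff2_plane_ge (Z : 'rV[R]_3) (A : set 'rV[R]_3) (r : R) : Z != 0 -> 0 < r ->
  (forall T, dotp T Z = 0 -> enorm T <= r -> A T) -> ((pi * r ^+ 2)%:E <= hausdorff2 A)%E.
Proof.
move=> Z0 r0 rA; have [Q QZ Qi] := plane_isometry Z0.
(* The bound is the same for every [delta]; the value 1 ensures that all diameters are finite. *)
apply: (@le_trans _ _ (hausdorff2_pre 1 A)); last first.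
  by apply: ereal_sup_ubound; exists 1 => //; exact: ltr01.
apply: le_ereal_inf_tmp => _ [C [AC dC] <-].
have d0 k : (0 <= diameter (C k))%E by apply: ereal_sup_ubound; right.
pose d k := fine (diameter (C k)).
have dE k : diameter (C k) = (d k)%:E.
  by rewrite fineK// ge0_fin_numE// (le_lt_trans (dC k))// ltry.
have d_ge0 k : 0 <= d k by rewrite -lee_fin -dE.
pose B k : set mT := closure [set p : R * R | C k (Q p)].
have mB k : measurable (B k) by apply: closed_measurable2; exact: closed_closure.
have Bd k : (leb2 R (B k) <= leb2 R (disc R) * ((d k / 2) ^+ 2)%:E)%E.
  have H : (leb2 R (B k) <= leb2 R (plane_disc (d k / 2)))%E.
    apply: isodiametric => //; apply: closure_diam => p q Cp Cq.
    rewrite -(Qi p q).1 lerXn2r ?nnegrE ?enorm_ge0// -lee_fin -dE.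
    by apply: ereal_sup_ubound; left; exists (Q p), (Q q).
  apply: (le_trans H); have := d_ge0 k; rewrite le_eqVlt => /orP[/eqP <-|dk].
    rewrite mul0r (_ : plane_disc 0 = set0) ?measure0 ?mule_ge0//.
    apply/seteqP; split => // u; rewrite /plane_disc /= expr0n /=.
    by have := sqr_ge0 u.1; have := sqr_ge0 u.2; lra.
  by rewrite leb2_plane_disc ?divr_gt0// plane_disc1 muleC.
have cover : (leb2 R (plane_disc r) <= \sum_(0 <= k <oo) leb2 R (B k))%E.
  apply: measure_sigma_subadditive => //; first exact: measurable_plane_disc.
  move=> p pr; have Ap : A (Q p).
    apply: rA => //; rewrite -(@ler_pXn2r _ 2) ?nnegrE ?enorm_ge0 ?(ltW r0)//.
    by rewrite (Qi p p).2 ltW.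
  by have [k _ Ck] := AC _ Ap; exists k => //; exact: subset_closure.
rewrite leb2_plane_disc// plane_disc1 in cover.
have c0 := leb2_disc_gt0; have cfin := @leb2_disc_fin R.
have [c cE] : exists c, leb2 R (disc R) = c%:E.
  by exists (fine (leb2 R (disc R))); rewrite fineK// ge0_fin_numE// ltW.
rewrite cE in c0 Bd cover.
have sum_le : ((r ^+ 2)%:E <= \sum_(0 <= k <oo) ((d k / 2) ^+ 2)%:E)%E.
  rewrite -(@lee_pmul2l _ c%:E)// muleC (le_trans cover)// -nneseriesZl; last first.
    by move=> k _; rewrite lee_fin sqr_ge0.
  by apply: lee_nneseries => // k _ _; exact: measure_ge0.
have pi0 := pi_gt0 R.
have term k : (pi%:E * (diameter (C k) * (2^-1)%:E) ^+ 2 = pi%:E * ((d k / 2) ^+ 2)%:E)%E.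
  by rewrite dE expe2 -!EFinM.
rewrite EFinM (eq_eseriesr (fun k _ => term k)).
rewrite nneseriesZl ?lee_pmul2l//; last by move=> k _; rewrite lee_fin sqr_ge0.
Qed.

End hausdorff_measure_of_planar_sets.

(** * The isoperimetric inequality *)

Section finsler_bounds.
Context {R : realType}.
Variable F : 'rV[R]_3 -> 'rV[R]_3 -> R.
Hypothesis FF : finsler_metric F.
Hypothesis mF_gt0 : (0 < finsler_inf F)%E.
Hypothesis MF_lty : (finsler_sup F < +oo)%E.

Let m := fine (finsler_inf F).
Let M := fine (finsler_sup F).

Let F_unit (x y : 'rV[R]_3) : enorm y = 1 -> m <= F x y <= M.
Proof.
move=> y1; have Fv : finsler_values F (F x y)%:E by exists x, y.
have le_sup := ereal_sup_ubound Fv; have inf_le := ereal_inf_lbound Fv.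
have inf_fin : finsler_inf F \is a fin_num.
  by rewrite ge0_fin_numE ?(ltW mF_gt0)// (le_lt_trans inf_le)// ltry.
have sup_fin : finsler_sup F \is a fin_num.
  by rewrite ge0_fin_numE// (le_trans _ le_sup)// lee_fin (finsler_ge0 FF).
by rewrite -!lee_fin /m /M !fineK// inf_le le_sup.
Qed.

Let enorm0 : enorm (0 : 'rV[R]_3) = 0.
Proof. by rewrite /enorm /dotp big1 ?sqrtr0// => i _; rewrite mxE mul0r. Qed.

Let enormZ (c : R) (y : 'rV[R]_3) : 0 <= c -> enorm (c *: y) = c * enorm y.
Proof.
move=> c0; rewrite /enorm (_ : dotp _ _ = c ^+ 2 * dotp y y).
  by rewrite sqrtrM ?sqr_ge0// sqrtr_sqr ger0_norm.
by rewrite /dotp mulr_sumr; apply: eq_bigr => i _; rewrite !mxE; ring.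
Qed.

Lemma enorm_gt0 (y : 'rV[R]_3) : y != 0 -> 0 < enorm y.
Proof.
move=> y0; rewrite lt_neqAle enorm_ge0 andbT eq_sym; apply: contra y0 => /eqP e0.
have : \sum_(i < 3) y 0 i ^+ 2 == 0 by rewrite -enorm_sqr e0 expr0n.
rewrite psumr_eq0 => [/allP h|i _]; last exact: sqr_ge0.
apply/eqP/rowP => i; rewrite mxE; apply/eqP.
by have := h i; rewrite mem_index_enum sqrf_eq0 => /(_ isT).
Qed.

Lemma finsler_bounds (x y : 'rV[R]_3) : m * enorm y <= F x y <= M * enorm y.
Proof.
have [->|y0] := eqVneq y 0; first by rewrite enorm0 !mulr0 (finsler_at0 FF) lexx.
have ny := enorm_gt0 y0.
have yE : y = enorm y *: ((enorm y)^-1 *: y) by rewrite scalerA divff ?gt_eqF// scale1r.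
rewrite {2 3}yE (finsler_homogeneous FF)// mulrC [M * _]mulrC !ler_pM2l//; apply: F_unit.
by rewrite enormZ ?invr_ge0 ?(ltW ny)// mulVf// gt_eqF.
Qed.

Lemma finsler_inf_gt0 : 0 < m.
Proof.
rewrite fine_gt0// mF_gt0 /=; pose e : 'rV[R]_3 := row3 1 0 0.
apply: (@le_lt_trans _ _ (F 0 e)%:E); last exact: ltry.
apply: ereal_inf_lbound; exists 0, e; split => //.
by rewrite /enorm /dotp sum_ord3 !mxE /= !mulr0 !addr0 mulr1 sqrtr1.
Qed.

Lemma finsler_sup_gt0 : 0 < M.
Proof.
have [e e1] : exists e : 'rV[R]_3, enorm e = 1.
  exists (row3 1 0 0).
  by rewrite /enorm /dotp sum_ord3 !mxE /= !mulr0 !addr0 mulr1 sqrtr1.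
by apply: lt_le_trans finsler_inf_gt0 _; have /andP[h1 h2] := F_unit 0 e1; exact: le_trans h1 h2.
Qed.

Lemma finsler_density_le (x Z : 'rV[R]_3) :
  (0 <= finsler_area_density F x Z <= (M ^+ 2 * enorm Z)%:E)%E.
Proof.
have M0 := finsler_sup_gt0; rewrite /finsler_area_density; case: eqVneq => [->|Z0].
  by rewrite enorm0 mulr0 lexx.
have nZ := enorm_gt0 Z0; have pi0 := pi_gt0 R.
have : ((pi * M^-1 ^+ 2)%:E <= hausdorff2 (finsler_section F x Z))%E.
  apply: (hausdorff2_plane_ge Z0); first by rewrite invr_gt0.
  move=> T TZ T1; split => //; have /andP[_ h] := finsler_bounds x T.
  by rewrite (le_trans h)// -(divff (lt0r_neq0 M0)) ler_pM2l.
(* A section of infinite measure has density 0, because the inverse of [+oo] is 0. *)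
case: (hausdorff2 _) => [h| |//]; last by rewrite invey mule0 lexx lee_fin mulr_ge0 ?sqr_ge0// ltW.
rewrite lee_fin => hle.
have h0 : 0 < h by apply: lt_le_trans hle; rewrite mulr_gt0// exprn_gt0// invr_gt0.
rewrite inver gt_eqF// -EFinM !lee_fin divr_ge0 ?mulr_ge0 ?(ltW pi0) ?(ltW nZ) ?(ltW h0)//=.
rewrite ler_pdivrMr// (_ : pi * enorm Z = (M ^+ 2 * enorm Z) * (pi * M^-1 ^+ 2)).
  by rewrite ler_pM2l// mulr_gt0// exprn_gt0.
by move: M0 (@pi R) => M0 p; field; rewrite gt_eqF.
Qed.

End finsler_bounds.

Lemma norm_entry_le (R : realType) n (x : 'rV[R]_n) i : `|x 0 i| <= `|x|.
Proof.
have -> : `|x| = \big[Num.max/0]_ij `|x ij.1 ij.2| by exact: mx_normrE.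
exact: (le_bigmax 0 (fun ij : 'I_1 * 'I_n => `|x ij.1 ij.2|) (0, i)).
Qed.

Lemma is_derive_row (R : realType) n (c : R -> 'rV[R]_n) (d : 'I_n -> R) (t : R) :
  (forall i, is_derive t 1 (fun s => c s 0 i) (d i)) -> derive1 c t = \row_i d i.
Proof.
move=> cd; rewrite derive1E.
have dc : derivable c t 1 by apply/derivable_mxP => i j; rewrite ord1; have [] := cd j.
by rewrite derive_mx//; apply/rowP => i; rewrite !mxE; have [_ <-] := cd i.
Qed.

Section minimizer.
Context {R : realType}.
Notation mu := (@lebesgue_measure R).
Variables (F : 'rV[R]_3 -> 'rV[R]_3 -> R) (Gamma : set 'rV[R]_3) (T : R).
Variables (gamma : R -> 'rV[R]_3) (X : W12 R).
Hypothesis FF : finsler_metric F.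
Hypothesis mF_gt0 : (0 < finsler_inf F)%E.
Hypothesis MF_lty : (finsler_sup F < +oo)%E.
Hypothesis gp : jordan_parametrization T Gamma gamma.
Hypothesis gl : [lipschitz gamma t | t in setT].
Hypothesis Xmin : finsler_area_minimizer F Gamma X.

Let m := fine (finsler_inf F).
Let M := fine (finsler_sup F).

Let T0 : 0 < T. Proof. by case: gp. Qed.

Lemma lipschitz_curve_derivative : exists (L : R) (d : 'I_3 -> R -> R),
  [/\ forall i, measurable_fun [set: R] (d i), forall i t, `|d i t| <= L,
    {ae mu, forall t : R, 0 < t < T -> derive1 gamma t = \row_i d i t} &
    forall i s t, 0 <= s -> s <= t -> t <= T ->
      \int[mu]_(x in `[s, t]) d i x = gamma t 0 i - gamma s 0 i].
Proof.
have [L gL] : exists L, forall x y, `|gamma x - gamma y| <= L * `|x - y|.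
  case: gl => K [Kr hK]; exists (K + 1) => x y.
  by have := hK (K + 1); rewrite ltrDl ltr01 => /(_ isT (x, y)); apply.
have giL i x y : `|gamma x 0 i - gamma y 0 i| <= L * `|x - y|.
  apply: le_trans (gL x y); rewrite (_ : _ - _ = (gamma x - gamma y) 0 i) ?norm_entry_le//.
  by rewrite !mxE.
have hd' i := lipschitz_derivative T0 (giL i).
have /choice[d hd] := hd'; exists L, d; split.
- by move=> i; have [] := hd i.
- by move=> i; have [] := hd i.
- have ae i : {ae mu, forall t : R, 0 < t < T -> is_derive t 1 (fun s => gamma s 0 i) (d i t)}.
    by have [] := hd i.
  have := ae_forall_ord ae; apply: filterS.
  by move=> t all t0; apply: is_derive_row => i; exact: all.
- by move=> i; have [] := hd i.
Qed.

Lemma finsler_length_ge (d : 'I_3 -> R -> R) (L : R) : (forall i, measurable_fun [set: R] (d i)) ->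
  (forall i t, `|d i t| <= L) -> {ae mu, forall t : R, 0 < t < T -> derive1 gamma t = \row_i d i t} ->
  ((m * \int[mu]_(t in `[0, T]) Num.sqrt (\sum_(i < 3) d i t ^+ 2))%:E <= finsler_length F T gamma)%E.
Proof.
move=> md dL /ae_null[N [mN N0 hN]]; pose v t := Num.sqrt (\sum_(i < 3) d i t ^+ 2).
have m0 : 0 < m := finsler_inf_gt0 mF_gt0.
have v0 t : 0 <= v t by exact: sqrtr_ge0.
have mv : measurable_fun [set: R] v by exact: measurable_speed.
have mI : measurable (`[0, T]%classic : set (measurableTypeR R)) by exact: measurable_itv.
have vL t : v t <= Num.sqrt (3 * L ^+ 2) by apply: speed_le => i; exact: dL.
have iv : mu.-integrable `[0, T] (EFin \o v).
  apply: (bounded_integrable (M := Num.sqrt (3 * L ^+ 2))) => //.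
  - by rewrite /= lebesgue_measure_itv/=; case: ifP; rewrite ?ltry// -EFinB ltry.
  - exact: measurable_funTS.
  by move=> t _; rewrite ger0_norm.
(* The endpoints join the exceptional set because the derivative is known only inside []0, T[]. *)
pose N' : set (measurableTypeR R) := N `|` ([set 0] `|` [set T]).
have mN' : measurable N' by apply: measurableU => //; exact: measurableU.
have N'0 : mu N' = 0%E.
  apply: null_set_setU => //; first exact: measurableU.
  by apply: null_set_setU => //; exact: lebesgue_measure_set1.
(* The comparison with the possibly non-measurable integrand has to hold at every point, so the
   speed is set to 0 on the exceptional null set. *)
pose w t := v t * \1_(~` N') t.
have mw : measurable_fun [set: R] w.
  by apply: measurable_funM => //; apply: measurable_indic; exact: measurableC.
have vw : (\int[mu]_(t in `[0%R, T]) (v t)%:E = \int[mu]_(t in `[0%R, T]) (w t)%:E)%E.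
  apply: ae_eq_integral => //; [exact/measurable_EFinP/measurable_funTS|
    exact/measurable_EFinP/measurable_funTS|].
  exists N'; split => // t /=; apply: contra_notP => Nt _.
  by rewrite /w indicE mem_set// mulr1.
rewrite EFinM [X in (_ * X)%E](_ : _ = \int[mu]_(t in `[0%R, T]) (v t)%:E)%E; last first.
  by rewrite /Rintegral fineK//; exact: (integrable_fin_num mI iv).
rewrite vw -ge0_integralZl ?lee_fin ?(ltW m0)//; last 2 first.
- exact/measurable_EFinP/measurable_funTS.
- by move=> t _; rewrite lee_fin mulr_ge0.
apply: le_integral_minorant => t; rewrite /= in_itv /= => /andP[t0 tT].
rewrite -EFinM !lee_fin /w !indicE; case: (boolP (t \in ~` N')) => [|_]; last first.
  by rewrite !mulr0 lexx (finsler_ge0 FF).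
rewrite inE /= !mulr1 => /not_orP[Nt /not_orP[/= /eqP tn0 /eqP tnT]].
rewrite mulr_ge0 ?(ltW m0)//= hN//; last by rewrite !lt_neqAle eq_sym tn0 t0 tnT tT.
have /andP[h _] := finsler_bounds FF mF_gt0 MF_lty (gamma t) (\row_i d i t).
apply: le_trans h; rewrite ler_pM2l// /v /enorm /dotp.
by apply: ler_wsqrtr; apply: ler_sum => i _; rewrite !mxE expr2.
Qed.

Lemma minimizer_area_le (d : 'I_3 -> R -> R) (L e : R) : (forall i, measurable_fun [set: R] (d i)) ->
  (forall i t, `|d i t| <= L) ->
  (forall i s t, 0 <= s -> s <= t -> t <= T ->
      \int[mu]_(x in `[s, t]) d i x = gamma t 0 i - gamma s 0 i) -> 0 < e ->
  (finsler_area F X <= (M ^+ 2 / (4 * pi) *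
     (\int[mu]_(t in `[0%R, T]) Num.sqrt (\sum_(i < 3) d i t ^+ 2) + e * T) ^+ 2)%:E)%E.
Proof.
move=> md dL dI e0; have [_ cg gper ginj grange] := gp.
have pi0 := pi_gt0 R.
have gper' i t : gamma (t + T) 0 i = gamma t 0 i by rewrite gper.
have ginj' s t : 0 <= s < T -> 0 <= t < T -> (forall i, gamma s 0 i = gamma t 0 i) -> s = t.
  by move=> s01 t01 H; apply: ginj; rewrite ?in_itv//=; apply/rowP.
have [g [gK gP gI g1 g2]] := @arc_length_reparametrization R (fun i t => gamma t 0 i) d T L e T0
  gper' ginj' md dL dI e0.
set l := (X in X / (2 * pi)) in gK; rewrite -/l.
have l0 : 0 <= l.
  by rewrite addr_ge0 ?mulr_ge0 ?(ltW e0) ?(ltW T0)// Rintegral_ge0// => t _; exact: sqrtr_ge0.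
move: l l0 gK => l l0 gK; set K := l / (2 * pi) in gK.
have K0 : 0 <= K by rewrite divr_ge0// mulr_ge0// ltW.
have [Y [f [Ytr mf f0 Yf If]]] := cone_competitor K0 gK gP.
have Ycl : plateau_class Gamma Y.
  exists (fun t => \row_i g i t) => //.
  (* The boundary of the cone runs through [Gamma] along [g] itself, so the monotone change of
     parameter is the identity. *)
  exists (fun t => \row_i g i t), id; split => //; last by move=> t; exact: cvg_id.
  split.
  - by rewrite mulr_gt0.
  - move=> t; apply: cvg_row => i; rewrite mxE.
    rewrite (_ : (fun s => _) = g i); last by apply/funext => s; rewrite mxE.
    have giK (x y : R) : `|g i x - g i y| <= K * `|x - y|.
      rewrite -(@ler_pXn2r _ 2) ?nnegrE ?(mulr_ge0 K0)// exprMn !real_normK ?num_real// -exprMn.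
      apply: le_trans (gK x y); rewrite (bigD1 i)//= lerDl.
      by apply: sumr_ge0 => j _; exact: sqr_ge0.
    exact: lipschitz_continuous giK t.
  - by move=> t; apply/rowP => i; rewrite !mxE gP.
  - move=> s t; rewrite !in_itv /= => s01 t01 /rowP st; apply: gI => // i.
    by have := st i; rewrite !mxE.
  - rewrite -grange; apply/seteqP; split => _ [t _ <-].
      by have [s hs] := g1 t; exists s => //; apply/rowP => i; rewrite mxE hs.
    by have [s hs] := g2 t; exists s => //; apply/rowP => i; rewrite mxE hs.
have [_ /(_ Y Ycl) XY] := Xmin; apply: (le_trans XY).
(* The majorant depends on the angle alone and is measurable, unlike what is known of the Finsler
   density. *)
apply: (@le_trans _ _ (\int[leb2 R]_(u in disc R) (M ^+ 2 * f (ang u))%:E)%E).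
  apply: le_integral_minorant => u _.
  have /andP[-> h] := finsler_density_le FF mF_gt0 MF_lty (Y u) (cross (W12_d1 Y u) (W12_d2 Y u)).
  by apply: (le_trans h); rewrite lee_fin ler_wpM2l ?sqr_ge0.
have mMf : measurable_fun [set: R] (fun t => M ^+ 2 * f t) by apply: measurable_funM.
apply: (le_trans (polar_integral_le mMf _)); first by move=> t; rewrite mulr_ge0// sqr_ge0.
under eq_integral do rewrite EFinM.
rewrite ge0_integralZl ?lee_fin ?sqr_ge0//; last 2 first.
- by apply/measurable_EFinP; exact: measurable_funTS.
- by move=> t _; rewrite lee_fin.
rewrite muleA -EFinM (@le_trans _ _ ((2^-1 * M ^+ 2)%:E * (2 * pi * K ^+ 2)%:E)%E)//.
  by apply: lee_wpmul2l => //; rewrite lee_fin mulr_ge0 ?sqr_ge0// invr_ge0.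
(* With [K = l / (2 pi)], the product [1/2 * M^2 * 2 pi K^2] equals [M^2 l^2 / (4 pi)]. *)
rewrite -EFinM lee_fin le_eqVlt; apply/orP; left; apply/eqP.
by rewrite /K; move: (@pi R) pi0 => p p0; field; rewrite gt_eqF.
Qed.

End minimizer.

Lemma le_sqr_perturb (R : realType) (a C l T : R) : 0 <= C -> 0 <= l -> 0 < T ->
  (forall e, 0 < e -> a <= C * (l + e * T) ^+ 2) -> a <= C * l ^+ 2.
Proof.
move=> C0 l0 T0 H; apply/ler_addgt0Pr => e e0.
pose D := C * (2 * l + 1); have D0 : 0 <= D by rewrite mulr_ge0// addr_ge0// mulr_ge0.
have De : 0 < D + e by lra.
(* [h] is at most 1, so the excess [C h (2 l + h)] is at most [D h], and [D h <= e]. *)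
pose h := e / (D + e); have h0 : 0 < h by rewrite divr_gt0.
have h1 : h <= 1 by rewrite ler_pdivrMr// mul1r lerDr.
have Dh : D * h <= e by rewrite mulrCA ger_pMr// ler_pdivrMr// mul1r lerDl ltW.
have := H (h / T) (divr_gt0 h0 T0); rewrite divfK ?gt_eqF// => /le_trans; apply.
have -> : (l + h) ^+ 2 = l ^+ 2 + h * (2 * l + h) by ring.
rewrite mulrDr lerD2l (le_trans _ Dh)// /D -mulrA ler_wpM2l// mulrC ler_pM2r//; lra.
Qed.

Unset Implicit Arguments.
Set Strict Implicit.

Theorem corollary1p3 (R : realType) (F : 'rV[R]_3 -> 'rV[R]_3 -> R)
  (Gamma : set 'rV[R]_3) (T : R) (gamma : R -> 'rV[R]_3) (X : W12 R)
  (F_finsler : finsler_metric F)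
  (mF_gt0 : (0 < finsler_inf F)%E)
  (MF_lty : (finsler_sup F < +oo)%E)
  (Gamma_rectifiable : rectifiable_jordan_curve Gamma)
  (gamma_param : jordan_parametrization T Gamma gamma)
  (gamma_lipschitz : [lipschitz gamma t | t in setT])
  (X_minimizer : finsler_area_minimizer F Gamma X) :
  (finsler_area F X <=
   (fine (finsler_sup F) ^+ 2 / (4 * pi * fine (finsler_inf F) ^+ 2))%:E
   * finsler_length F T gamma ^+ 2)%E.
Proof.
have [L [d [md dL dd dI]]] := lipschitz_curve_derivative gamma_param gamma_lipschitz.
have len := finsler_length_ge F_finsler mF_gt0 MF_lty md dL dd.
have area e := minimizer_area_le F_finsler mF_gt0 MF_lty gamma_param X_minimizer md dL dI (e := e).
have m0 := finsler_inf_gt0 mF_gt0.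
have M0 := finsler_sup_gt0 F_finsler mF_gt0 MF_lty.
have T0 : 0 < T by case: gamma_param.
have pi0 := pi_gt0 R.
move: (fine (finsler_inf F)) (fine (finsler_sup F)) m0 M0 len area => m M m0 M0.
set l := Rintegral _ _ _; have l0 : 0 <= l by apply: Rintegral_ge0 => t _; exact: sqrtr_ge0.
move=> len area.
have C0 : 0 < M ^+ 2 / (4 * pi * m ^+ 2) by rewrite divr_gt0 ?mulr_gt0 ?exprn_gt0.
(* If the Finsler length is infinite, so is the right-hand side, its coefficient being positive;
   [len] excludes [-oo]. *)
case: (finsler_length F T gamma) len => [lam| |]; [|by rewrite expe2 mulyy gt0_muley ?leey|by []].
rewrite lee_fin => mlam.
have area0 : (0 <= finsler_area F X)%E.
  apply: integral_ge0 => u _.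
  by have /andP[] := finsler_density_le F_finsler mF_gt0 MF_lty (X u) (cross (W12_d1 X u) (W12_d2 X u)).
have [a aE] : exists a, finsler_area F X = a%:E.
  exists (fine (finsler_area F X)); rewrite fineK// ge0_fin_numE//.
  by apply: le_lt_trans (area 1 ltr01) _; rewrite ltry.
rewrite aE in area *; rewrite expe2 -!EFinM lee_fin.
have := @le_sqr_perturb R a (M ^+ 2 / (4 * pi)) l T _ l0 T0 area.
move=> /(_ (divr_ge0 (sqr_ge0 _) (mulr_ge0 (ler0n _ 4) (ltW pi0)))) /le_trans; apply.
(* The factor [m^2] is moved onto the Euclidean length, since [m * l] is what the Finsler length
   bounds. *)
have -> : M ^+ 2 / (4 * pi) * l ^+ 2 = M ^+ 2 / (4 * pi * m ^+ 2) * ((m * l) * (m * l)).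
  by move: (@pi R) pi0 => p p0; field; rewrite !gt_eqF.
by rewrite ler_pM2l// ler_pM// mulr_ge0// ltW.
Qed.
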